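(* Let $k\ge 1$ and $d>1$ be integers and let $j_1,\dots,j_d$ be integers with $0\le j_i<k$ for all $i$. Then each periodic meromorphic solution $f$ of $$f^{(k)}=f^{(j_1)}\cdots f^{(j_d)}$$ with at most finitely many poles in a period strip has the form $f(z)=g(e^{cz})$ with $g$ a rational function and $c$ a constant.
   Context: ''Meromorphic solution'' means a solution meromorphic in all of $\mathbb{C}$. $f^{(j)}$ is the $j$-th derivative, $f^{(0)}=f$. Periodic means having a nonzero period $\omega\in\mathbb{C}$; a corresponding period strip is a set of the form $\{z\in\mathbb{C}: 0\le \operatorname{Re}((z-z_0)/\omega)<1\}$ with $z_0\in\mathbb{C}$. *)

(* Defs.v *)
From HB Require Import structures.
From mathcomp Require Import all_boot all_order all_algebra.
From mathcomp Require Import complex.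
From mathcomp Require Import all_classical all_reals all_analysis.

Set Implicit Arguments.
Unset Strict Implicit.
Unset Printing Implicit Defensive.

Import Order.TTheory GRing.Theory Num.Theory.
Import numFieldNormedType.Exports.

Local Open Scope classical_set_scope.
Local Open Scope ring_scope.
Local Open Scope complex_scope.

(* A meromorphic function is encoded as a map into the Riemann sphere
   [option R[i]], where [None] is the point at infinity. *)
Definition pole (R : realType) (f : R[i] -> option R[i]) : set R[i] :=
  [set z | f z = None].

(* The values of [finpart f] at the poles of [f] are irrelevant. *)
Definition finpart (R : realType) (f : R[i] -> option R[i])
  : R[i]^o -> R[i]^o := fun z => odflt 0 (f z).

(* Since [R[i]^o] is a normed module over the field [R[i]] itself, [derivable]
   (as well as [^`(n)]) refers to complex differentiation. The first condition
   says that the poles are isolated and have no accumulation point. *)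
Definition meromorphic (R : realType) (f : R[i] -> option R[i]) : Prop :=
  [/\ forall z : R[i]^o, \forall w \near z^', ~ pole f w,
      forall z : R[i]^o, ~ pole f z -> derivable (finpart f) z 1
    & forall z : R[i]^o, pole f z -> `|finpart f w| @[w --> z^'] --> +oo].

Definition period_strip (R : realType) (omega z0 : R[i]) : set R[i] :=
  [set z | 0 <= complex.Re ((z - z0) / omega) < 1].

Definition Cexp (R : realType) (z : R[i]) : R[i] :=
  (expR (complex.Re z) * cos (complex.Im z))
  +i* (expR (complex.Re z) * sin (complex.Im z)).

(* Coprimality makes the zeros of [q] exactly the poles of [p / q]. *)
Definition rational_function (R : realType) (g : R[i] -> option R[i]) : Prop :=
  exists p q : {poly R[i]}, [/\ q != 0, coprimep p q &
    forall w, g w = if q.[w] == 0 then None else Some (p.[w] / q.[w])].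

(* Main.v *)
Require Import Defs.
From mathcomp Require Import all_boot all_order all_algebra.
From mathcomp Require Import complex.
From mathcomp Require Import all_classical all_reals all_analysis.
From mathcomp Require Import zify ring lra.

(** Let [s] be the period divided by [2 * pi * i], so that [F z := f (s * z)] has
    period [2 * pi * i]. As finitely many poles lie in a period strip, all poles of
    [F] lie in a vertical strip [`|Re z| <= H].

    The main point is that [F] is bounded at both ends of the plane, that is, for
    large [`|Re z|] ([growth_bounded]). Consider the right end, and let [M x] be the
    maximum of [|F|] on [H + 1 <= Re z <= x]. If [M (x + k) <= 2 ^ k * M x] for all
    large [x], then [F] grows at most like [expR (x * ln 2)]; as [ln 2 < 1], the
    function [F z * e ^ (- z)] of the variable [e ^ (- z)] has a removable
    singularity at [0] and vanishes there, so that [F] is bounded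
    ([slow_growth_bounded]). Otherwise there are arbitrarily large [x0] with
    [M (x0 + k) >= 2 ^ k * M x0]. If [F] is unbounded, halving the step [k] again and
    again then leads, by finiteness of [M], to an abscissa [x] and a step
    [rho = k / 2 ^ n] such that [M (x + rho) >= 2 ^ k * M x], that
    [M x >= 2 ^ (k * n) * M x0], and that [M (x + r * rho)] is at most a constant
    power of [2 ^ r] times [M (x + rho)] for all [r] up to a given bound
    ([growth_stop]). Let [z'] be a point where the maximum [M (x + rho)] is attained,
    and put [g w := F (z' + rho * w) / F z']. Then [g 0 = 1], [|g (-1)| <= 1 / 2],
    [|g| <= 1] on [Re w <= 0], and [|g|] is bounded on discs independently of the
    choices made. The equation becomes
    [\prod_i g^(j_i) = eta * g^(k)], where [eta] is at most of the order of
    [1 / (rho ^ k * (F z') ^ (d - 1))] and is small since [d > 1] and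
    [rho ^ k * M x >= k ^ k * M x0]. A limit [G] of such functions is entire
    with [\prod_i G^(j_i) = 0], so [G] is a polynomial; being bounded on the
    half-plane [Re w <= 0] it is constant, which contradicts [G 0 = 1] and
    [|G (-1)| <= 1 / 2] ([rescaled_limit_absurd]).

    Once [F] is bounded at both ends, multiply it by a polynomial [Q] in [e ^ z] that
    vanishes at the poles to a sufficient order ([pole_order], [clear_poles]). The
    product extends to an entire function of period [2 * pi * i] ([removable]) which
    is bounded on the left and bounded by a power of [|e ^ z|] on the right, hence is
    a polynomial in [e ^ z] ([entire_periodic_poly]). Dividing by [Q] gives the
    rational function.

    The complex analysis behind this rests on integrals over one period of a
    vertical line. By Goursat's theorem on rectangles of height [2 * pi], such an
    integral of a periodic differentiable function does not depend on the line
    ([line_int_const]). With the kernel [e ^ z / (e ^ z - e ^ p)] this gives a Cauchy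
    formula on half-planes ([cauchy_half_plane]), and then the expansion of a periodic
    function, bounded on the left, in powers of [e ^ z] ([half_plane_series]). Applied
    to [F (q + e ^ z)], the latter is the theorem on removable singularities together
    with Taylor's theorem on discs ([punctured_taylor], [taylor]). *)

Set Implicit Arguments.
Unset Strict Implicit.
Unset Printing Implicit Defensive.

Import Order.TTheory GRing.Theory Num.Theory.
Import numFieldNormedType.Exports.
Import ComplexField.Normc.

Local Open Scope classical_set_scope.
Local Open Scope ring_scope.
Local Open Scope complex_scope.

(** * The derivative as a linear approximation *)

(** Stating the error bound without division also covers the point itself, which
    makes the chain rule and the comparison with real derivatives direct. *)
Lemma is_derive1_linearP (K : numFieldType) (f : K^o -> K^o) (z D : K^o) :
  is_derive z 1 f D <-> forall e : K, 0 < e ->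
    \forall w \near z, `|f w - f z - D * (w - z)| <= e * `|w - z|.
Proof.
pose q h := h^-1 *: ((f \o shift z) (h *: (1 : K^o)) - f z).
have qE h : h != 0 -> `|q h - D| * `|h| = `|f (h + z) - f z - D * h|.
  move=> h0; rewrite -normrM mulrBl; congr `|_ - _|.
  by rewrite /q /= /shift/= /GRing.scale/= mulr1 mulrC mulVKf.
have key : (q h @[h --> (0 : K^o)^'] --> D) <-> forall e : K, 0 < e ->
    \forall w \near z, `|f w - f z - D * (w - z)| <= e * `|w - z|.
  split=> [/cvgrPdist_le H e e0|H].
    move/(_ _ e0): H => /nbhs_ballP[d /= d0 Hd].
    apply/nbhs_ballP; exists d => //= w; rewrite /ball/= => wd.
    have [->|wz] := eqVneq w z; first by rewrite !subrr mulr0 subr0 normr0 mulr0.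
    have wz0 : w - z != 0 by rewrite subr_eq0.
    rewrite -{1}(subrK z w) -qE// ler_wpM2r// distrC.
    by apply: Hd => //; rewrite /ball/= sub0r normrN distrC.
  apply/cvgrPdist_le => e e0; move/(_ _ e0): H => /nbhs_ballP[d /= d0 Hd].
  apply/nbhs_ballP; exists d => //= h; rewrite /ball/= sub0r normrN => hd h0.
  rewrite distrC -(ler_pM2r (_ : 0 < `|h|)) ?normr_gt0// qE//.
  by have := Hd (h + z); rewrite addrK; apply; rewrite /ball/= distrC addrK.
split=> [[df fD]|/key H]; first by apply/key; rewrite -fD; exact: df.
by split; [apply/cvg_ex; exists D | exact: cvg_lim H].
Qed.

(** * The modulus of a complex number *)

Section Modulus.
Context {R : realType}.
Local Notation C := R[i].
Implicit Types z w : C.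

Lemma normcE z : `|z| = (normc z)%:C. Proof. by case: z. Qed.
Lemma normc_ge0 z : 0 <= normc z.
Proof. by case: z => a b; exact: sqrtr_ge0. Qed.
Lemma normc_eq0 z : (normc z == 0) = (z == 0).
Proof. by rewrite -(inj_eq (@complexI R)) -normcE normr_eq0. Qed.
Lemma normc_gt0 z : (0 < normc z) = (z != 0).
Proof. by rewrite lt_neqAle normc_ge0 andbT eq_sym normc_eq0. Qed.
Lemma normcB z w : normc (z - w) = normc (w - z).
Proof. by rewrite -normcN opprB. Qed.
Lemma normcX z n : normc (z ^+ n) = normc z ^+ n.
Proof. by elim: n => [|n IH]; rewrite ?expr0 ?normc1 // !exprS normcM IH. Qed.
Lemma normc_real (x : R) : normc (x%:C) = `|x|.
Proof. by rewrite /normc/= expr0n/= addr0 sqrtr_sqr. Qed.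
Lemma normc_sum (I : Type) (s : seq I) (P : pred I) (F : I -> C) :
  normc (\sum_(i <- s | P i) F i) <= \sum_(i <- s | P i) normc (F i).
Proof.
elim/big_rec2: _ => [|i y1 y2 _ le12]; first by rewrite normc0.
by rewrite (le_trans (le_normcD _ _))// lerD2l.
Qed.
Lemma le_normcB z w : normc z - normc w <= normc (z - w).
Proof. by rewrite lerBlDr (le_trans _ (le_normcD _ _))// subrK. Qed.
Lemma le_normc_sub z w : normc (z - w) <= normc z + normc w.
Proof. by rewrite (le_trans (le_normcD _ _))// normcN. Qed.
Lemma le_normc_trans u z w : normc (z - w) <= normc (z - u) + normc (u - w).
Proof. by rewrite -[z - w](subrKA u) le_normcD. Qed.
Lemma normc_Re z : `|complex.Re z| <= normc z.
Proof. by case: z => a b; rewrite -[leLHS]sqrtr_sqr ler_wsqrtr// lerDl sqr_ge0. Qed.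
Lemma normc_Im z : `|complex.Im z| <= normc z.
Proof. by case: z => a b; rewrite -[leLHS]sqrtr_sqr ler_wsqrtr// lerDr sqr_ge0. Qed.
Lemma le_normc_ReIm z : normc z <= `|complex.Re z| + `|complex.Im z|.
Proof.
have -> : z = (complex.Re z)%:C + (complex.Im z)%:C * 'i.
  by case: z => a b; simpc.
rewrite (le_trans (le_normcD _ _))// normcM !normc_real.
rewrite (_ : normc 'i = 1 :> R) ?mulr1; first by case: z => a b; simpc.
by rewrite /= expr0n expr1n add0r sqrtr1.
Qed.

Lemma normc_small0 (z : C) (K : R) :
  (forall e, 0 < e -> e <= 1 -> normc z <= K * e) -> z = 0.
Proof.
move=> H; apply/eqP; rewrite -normc_eq0; apply/negPn/negP => z0.
have {}z0 : 0 < normc z by rewrite lt_neqAle eq_sym z0 normc_ge0.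
pose K' := `|K| + normc z + 1.
have K'0 : 0 < K' by rewrite ltr_wpDl// addr_ge0// ltW.
have e0 : 0 < normc z / K' by rewrite divr_gt0.
have e1 : normc z / K' <= 1.
  by rewrite ler_pdivrMr// mul1r /K' -addrA addrCA lerDl addr_ge0.
have := H _ e0 e1; apply/negP; rewrite -ltNge mulrA ltr_pdivrMr// mulrC ltr_pM2l//.
by rewrite (le_lt_trans (ler_norm K))// /K' -addrA ltrDl ltr_wpDr.
Qed.

(** The balls of [R[i]^o] have radii in [R[i]]. A positive complex number is a
    positive real, so real radii suffice. *)
Lemma nbhs_normc (z : C) (P : C -> Prop) :
  (\forall w \near (z : C^o), P w) <->
  exists2 d : R, 0 < d & forall w, normc (w - z) < d -> P w.
Proof.
split.
  move=> /nbhs_ballP[e /= e0 He]; exists (complex.Re e).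
    by move: e0; rewrite ltcE/= => /andP[].
  move=> w wd; apply: He; rewrite /ball/= distrC normcE ltcE/=.
  by move: e0; rewrite ltcE/= => /andP[/eqP -> _]; rewrite eqxx.
case=> d d0 H; apply/nbhs_ballP; exists d%:C => /=; first by rewrite ltcR.
by move=> w; rewrite /ball/= distrC normcE ltcR; exact: H.
Qed.

Lemma dnbhs_normc (z : C) (P : C -> Prop) :
  (\forall w \near (z : C^o)^', P w) <->
  exists2 d : R, 0 < d & forall w, w != z -> normc (w - z) < d -> P w.
Proof.
split=> [/nbhs_normc[d d0 H]|[d d0 H]]; first by exists d => // w; move=> *; apply: H.
by apply/nbhs_normc; exists d => // w wd wz; exact: H.
Qed.

Lemma cvg_normc (T : Type) (F : set_system T) (FF : Filter F) (u : T -> C) (l : C) :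
  (u @ F --> (l : C^o)) <-> (forall e : R, 0 < e -> \forall t \near F, normc (u t - l) < e).
Proof.
split=> [/(@cvgrPdist_lt C C^o _ _ _ _ _) H e e0|H].
  have /H : 0 < e%:C by rewrite ltcR.
  by apply: filterS => t; rewrite distrC normcE ltcR.
apply/(@cvgrPdist_lt C C^o) => e; rewrite ltcE/= => /andP[/eqP e1 e0].
near=> t; rewrite distrC normcE ltcE/= e1 eqxx/=.
by near: t; exact: H.
Unshelve. all: by end_near. Qed.

End Modulus.

Arguments normc {R} x : simpl never.

(** * Complex differentiability *)

Section ComplexDerivative.
Context {R : realType}.
Local Notation C := R[i].
Implicit Types (z w D : C) (f g : C -> C).

(** The normed module structure of [R[i]] over itself is carried by [R[i]^o]; the
    casts are made here once, so that the rules below are about functions on [R[i]]. *)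
Definition cderiv f z D := is_derive (z : C^o) 1 (f : C^o -> C^o) (D : C^o).
Definition cdiff f z := derivable (f : C^o -> C^o) (z : C^o) 1.
Definition ccont f z := forall e : R, 0 < e -> exists2 d : R, 0 < d &
  forall w, normc (w - z) < d -> normc (f w - f z) < e.

Lemma cderivP f z D : cderiv f z D <-> forall e : R, 0 < e ->
  exists2 d : R, 0 < d & forall w, normc (w - z) < d ->
    normc (f w - f z - D * (w - z)) <= e * normc (w - z).
Proof.
rewrite /cderiv is_derive1_linearP; split=> H e e0.
  have /H/nbhs_normc[d d0 Hd] : (0 : C) < e%:C by rewrite ltcR.
  by exists d => // w /Hd; rewrite !normcE -rmorphM/= lecR.
have [e1 e2] : complex.Re e > 0 /\ e = (complex.Re e)%:C.
  by case: e e0 => a b; rewrite ltcE/= => /andP[/eqP -> ->].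
have [d d0 Hd] := H _ e1; apply/nbhs_normc; exists d => // w /Hd.
by rewrite e2 !normcE -rmorphM/= lecR.
Qed.

Lemma cdiffP f z : cdiff f z <-> exists D, cderiv f z D.
Proof.
split=> [/derivableP H|[D [H _]]]; last exact: H.
by exists ('D_1 (f : C^o -> C^o) (z : C^o)).
Qed.

Lemma cdiff_cont f z : cdiff f z -> ccont f z.
Proof.
move=> /cdiffP[D /cderivP/(_ 1 ltr01)[d d0 Hd]] e e0.
pose K := normc D + 1.
have K0 : 0 < K by rewrite ltr_wpDl// normc_ge0.
exists (Num.min d (e / K)); first by rewrite lt_min d0 divr_gt0.
move=> w; rewrite lt_min ltr_pdivlMr// mulrC => /andP[/Hd H1]; apply: le_lt_trans.
rewrite /K -[f w - f z](subrK (D * (w - z))) (le_trans (le_normcD _ _))//.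
by rewrite normcM mulrDl addrC lerD2l.
Qed.

Lemma cderiv_cst a z : cderiv (fun=> a) z 0.
Proof. exact: is_derive_cst. Qed.
Lemma cderiv_id z : cderiv id z 1.
Proof. exact: is_derive_id. Qed.
Lemma cderivB f g z D E : cderiv f z D -> cderiv g z E ->
  cderiv (fun w => f w - g w) z (D - E).
Proof. exact: is_deriveB. Qed.
Lemma cderivM f g z D E : cderiv f z D -> cderiv g z E ->
  cderiv (fun w => f w * g w) z (f z * E + g z * D).
Proof. exact: is_deriveM. Qed.
Lemma cdiff_cst a z : cdiff (fun=> a) z.
Proof. exact: derivable_cst. Qed.
Lemma cdiff_id z : cdiff id z.
Proof. exact: derivable_id. Qed.
Lemma cdiffD f g z : cdiff f z -> cdiff g z -> cdiff (fun w => f w + g w) z.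
Proof. exact: derivableD. Qed.
Lemma cdiffB f g z : cdiff f z -> cdiff g z -> cdiff (fun w => f w - g w) z.
Proof. exact: derivableB. Qed.
Lemma cdiffM f g z : cdiff f z -> cdiff g z -> cdiff (fun w => f w * g w) z.
Proof. exact: derivableM. Qed.
Lemma cdiffV f z : f z != 0 -> cdiff f z -> cdiff (fun w => (f w)^-1) z.
Proof. exact: derivableV. Qed.
Lemma cderiv_near f g z D : (exists2 d : R, 0 < d & forall w, normc (w - z) < d ->
  f w = g w) -> cderiv f z D -> cderiv g z D.
Proof.
move=> [d d0 fg] /cderivP H; apply/cderivP => e /H[d' d'0 Hd'].
exists (Num.min d d') => [|w]; first by rewrite lt_min d0.
rewrite lt_min => /andP[wd /Hd']; rewrite !fg//.
by rewrite subrr normc0.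
Qed.

Lemma cdiff_near f g z : (exists2 d : R, 0 < d & forall w, normc (w - z) < d ->
  f w = g w) -> cdiff f z -> cdiff g z.
Proof. by move=> H /cdiffP[D fD]; apply/cdiffP; exists D; exact: cderiv_near fD. Qed.

Lemma cderiv_comp f g z D E : cderiv f z D -> cderiv g (f z) E ->
  cderiv (fun w => g (f w)) z (E * D).
Proof.
move=> fD gE; have fc : ccont f z by apply/cdiff_cont/cdiffP; exists D.
move/cderivP: fD => fD; move/cderivP: gE => gE; apply/cderivP => e e0.
pose K := normc D + normc E + 1.
have K0 : 0 < K by rewrite ltr_wpDl// addr_ge0 ?normc_ge0.
pose e1 := Num.min 1 (e / (K + K)).
have e10 : 0 < e1 by rewrite lt_min ltr01 divr_gt0// addr_gt0.
have [d1 d10 H1] := fD _ e10; have [d2 d20 H2] := gE _ e10.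
have [d3 d30 H3] := fc _ d20.
exists (Num.min d1 d3) => [|w]; first by rewrite lt_min d10.
rewrite lt_min => /andP[/H1{H1} H1 /H3/H2{H3 H2} H2].
have n0 := normc_ge0 (w - z); set n := normc (w - z) in H1 n0 *.
have fwz : normc (f w - f z) <= K * n.
  rewrite -[f w - f z](subrK (D * (w - z))) (le_trans (le_normcD _ _))//.
  have : e1 * n <= n by rewrite ler_piMl// /e1 ge_min lexx.
  have : 0 <= normc E * n by rewrite mulr_ge0// normc_ge0.
  by rewrite normcM -/n /K !mulrDl mul1r; lra.
have -> : g (f w) - g (f z) - E * D * (w - z) =
  (g (f w) - g (f z) - E * (f w - f z)) + E * (f w - f z - D * (w - z)) by ring.
rewrite (le_trans (le_normcD _ _))// normcM.
have : e1 * (K * n) + K * (e1 * n) <= e * n.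
  have KK : 0 < K + K by rewrite addr_gt0.
  have : e1 * (K + K) <= e by rewrite -ler_pdivlMr// /e1 ge_min lexx orbT.
  by move=> /(ler_wpM2r n0); apply: le_trans; rewrite -subr_ge0; lra.
apply: le_trans; apply: lerD; first by rewrite (le_trans H2)// ler_wpM2l// ltW.
by rewrite ler_pM ?normc_ge0// /K -addrA addrCA lerDl addr_ge0 ?normc_ge0.
Qed.

Lemma cdiff_comp f g z : cdiff f z -> cdiff g (f z) -> cdiff (fun w => g (f w)) z.
Proof.
move=> /cdiffP[D fD] /cdiffP[E gE]; apply/cdiffP; exists (E * D).
exact: cderiv_comp.
Qed.

Lemma cdiff_lin a b z : cdiff (fun w => a + b * w) z.
Proof.
by apply: cdiffD; [exact: cdiff_cst | apply: cdiffM; [exact: cdiff_cst | exact: cdiff_id]].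
Qed.

End ComplexDerivative.

(** * The complex exponential *)

Section ComplexExp.
Context {R : realType}.
Local Notation C := R[i].
Implicit Types (z w : C) (x y : R).

Definition twopii : C := 0 +i* (pi *+ 2).

Lemma twopi_gt0 : 0 < pi *+ 2 :> R. Proof. by rewrite mulrn_wgt0// pi_gt0. Qed.

Lemma mod_period (T x : R) : 0 < T -> exists n : int, 0 <= x - T *~ n < T.
Proof.
move=> T0; exists (Num.floor (x / T)).
have /andP[] := floor_itv (x / T); rewrite ler_pdivlMr// ltr_pdivrMr//.
rewrite subr_ge0 ltrBlDr -[T *~ _]mulrzl intrD mulrDl mul1r [T + _]addrC.
by move=> -> ->.
Qed.

Lemma CexpD z w : Cexp (z + w) = Cexp z * Cexp w.
Proof.
case: z w => [a b] [c d]; rewrite /Cexp/=; apply/eqP; rewrite eq_complex/=.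
by rewrite expRD cosD sinD; apply/andP; split; apply/eqP; ring.
Qed.

Lemma Cexp0 : Cexp (0 : C) = 1.
Proof. by rewrite /Cexp/= expR0 cos0 sin0 mulr1 mulr0. Qed.

Lemma normc_Cexp z : normc (Cexp z) = expR (complex.Re z).
Proof.
rewrite /Cexp /normc !exprMn -mulrDr cos2Dsin2 mulr1 sqrtr_sqr ger0_norm// expR_ge0.
Qed.

Lemma Cexp_neq0 z : Cexp z != 0.
Proof. by rewrite -normc_gt0 normc_Cexp expR_gt0. Qed.

Lemma CexpB z w : Cexp (z - w) = Cexp z / Cexp w.
Proof. by apply: (mulIf (Cexp_neq0 w)); rewrite -CexpD subrK divfK ?Cexp_neq0. Qed.

Lemma Cexp_natmul z n : Cexp (n%:R * z) = Cexp z ^+ n.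
Proof.
by elim: n => [|n IH]; rewrite ?mul0r ?Cexp0// exprS -IH -CexpD mulrS mulrDl mul1r.
Qed.

Lemma Cexp_twopii : Cexp twopii = 1.
Proof. by rewrite /Cexp/= expR0 cos2pi sin2pi mulr1 mulr0. Qed.

Lemma Cexp_periodic z : Cexp (z + twopii) = Cexp z.
Proof. by rewrite CexpD Cexp_twopii mulr1. Qed.

Lemma periodic_int (T : Type) (g : C -> T) (p : C) :
  (forall z, g (z + p) = g z) -> forall (n : int) z, g (z + p *~ n) = g z.
Proof.
move=> gp; have gpn (n : nat) z : g (z + p *+ n) = g z.
  by elim: n => [|n IH]; rewrite ?mulr0n ?addr0// mulrSr addrA gp.
by case=> n z; [exact: gpn | rewrite NegzE mulrNz -(gpn n.+1) -addrA addNr addr0].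
Qed.

Lemma twopii_mulz (n : int) : twopii *~ n = 0 +i* (pi *+ 2 *~ n).
Proof.
have H (m : nat) : twopii *+ m = 0 +i* (pi *+ 2 *+ m).
  by elim: m => // m IH; rewrite mulrSr IH [in RHS]mulrSr; simpc.
by case: n => m; rewrite -?pmulrn ?H// NegzE !mulrNz -!pmulrn H; simpc.
Qed.

(** Reduce [Im z] modulo [2 * pi]: for [0 <= y < 2 * pi] the sine of [y] vanishes only at [0]
    and [pi], and the cosine of [pi] is [-1]. *)
Lemma Cexp_eq1 z : Cexp z = 1 -> exists n : int, z = twopii *~ n.
Proof.
move=> z1; have Rz : complex.Re z = 0.
  apply: (@expR_inj R); rewrite -normc_Cexp z1 normc1 expR0 //.
have [n H] := mod_period (complex.Im z) twopi_gt0; exists n.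
set y := complex.Im z - (pi *+ 2) *~ n in H *; have /andP[y0 y2] := H.
have : Cexp (0 +i* y) = 1.
  rewrite -z1 -(periodic_int Cexp_periodic n (0 +i* y)) twopii_mulz; simpc.
  by rewrite /y subrK -Rz; case: (z).
rewrite /Cexp/= expR0 !mul1r => -[cy sy].
have y00 : y = 0.
  apply/eqP/negPn; rewrite neq_lt ltNge y0/=; apply/negP => yp.
  have [yp1|yp1|yp1] := ltgtP y pi.
  - have : 0 < sin y by rewrite sin_gt0_pi// yp yp1.
    by rewrite sy ltxx.
  - have : 0 < sin (y - pi).
      by rewrite sin_gt0_pi// subr_gt0 yp1 ltrBlDr -mulr2n.
    by rewrite sinB cospi sinpi sy !mulr0 mul0r subrr ltxx.
  - by move: cy; rewrite yp1 cospi; lra.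
move/eqP: y00; rewrite /y subr_eq0 => /eqP Iz.
by rewrite twopii_mulz -Iz -Rz; case: (z).
Qed.

Lemma Cexp_eq z w : Cexp z = Cexp w -> exists n : int, z = w + twopii *~ n.
Proof.
move=> zw; have [|n zwn] := @Cexp_eq1 (z - w).
  by rewrite CexpB zw divff// Cexp_neq0.
by exists n; rewrite -zwn addrC subrK.
Qed.

(** Polar coordinates. *)
Lemma Cexp_surj w : w != 0 -> exists z, Cexp z = w.
Proof.
move=> w0; have r0 : 0 < normc w by rewrite normc_gt0.
pose r := normc w; pose u := w / r%:C.
have ur : w = r%:C * u by rewrite /u mulrC divfK// -normc_eq0 normc_real gtr0_norm// gt_eqF.
have : normc u = 1.
  apply: (mulfI (lt0r_neq0 r0)).
  by rewrite -[in LHS](gtr0_norm r0) -normc_real -normcM -/r -ur mulr1.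
case: u ur => a b ur; rewrite /normc => ab1.
have {}ab1 : a ^+ 2 + b ^+ 2 = 1.
  by rewrite -[LHS]sqr_sqrtr ?ab1 ?expr1n// addr_ge0// sqr_ge0.
have a1 : -1 <= a <= 1.
  by rewrite -ler_norml -(@ler_pXn2r _ 2)// ?nnegrE// expr1n real_normK ?num_real// -ab1 lerDl sqr_ge0.
have [s [cs ss]] : exists s, cos s = a /\ sin s = b.
  have b2 : sin (acos a) = `|b| by rewrite sin_acos// -ab1 addrC addKr sqrtr_sqr.
  have [b0|b0] := leP 0 b.
    by exists (acos a); rewrite acosK// b2 ger0_norm.
  exists (- acos a); rewrite cosN sinN acosK// b2 ltr0_norm// opprK//.
exists (ln r +i* s); rewrite /Cexp/= lnK ?posrE// cs ss ur.
by rewrite /real_complex_def; simpc.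
Qed.

Lemma real_derive_linear (f : R -> R) x D : is_derive x 1 f D ->
  forall e : R, 0 < e -> exists2 d : R, 0 < d & forall y, `|y - x| < d ->
    `|f y - f x - D * (y - x)| <= e * `|y - x|.
Proof.
move=> /is_derive1_linearP H e /H /nbhs_ballP[d /= d0 Hd]; exists d => // y yx.
by apply: Hd; rewrite /ball/= distrC.
Qed.

(** By the functional equation it is enough to differentiate at [0], where the real
    and imaginary parts are controlled by the real derivatives of [expR], [cos] and [sin]. *)
Lemma cderiv_Cexp z : cderiv (@Cexp R) z (Cexp z).
Proof.
suff H0 : cderiv (@Cexp R) (0 : C) 1.
  have : cderiv (fun w => Cexp z * Cexp (w - z)) z (Cexp z * (1 * 1)).
    have -> : Cexp z * (1 * 1) = Cexp z * (1 * 1) + Cexp (z - z) * 0 by ring.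
    apply: cderivM; first exact: cderiv_cst.
    rewrite -[X in _ * X](subr0 1); apply: (@cderiv_comp _ (fun w => w - z)).
      apply: cderivB; [exact: cderiv_id|exact: cderiv_cst].
    by rewrite subrr.
  rewrite !mulr1; apply: cderiv_near; exists 1 => // w _.
  by rewrite -CexpD addrC subrK.
apply/cderivP => e e0.
have [d1 d10 H1] : exists2 d : R, 0 < d &
    forall y, `|y| < d -> `|expR y - 1 - y| <= Num.min (e / 8) 1 * `|y|.
  have m0 : 0 < Num.min (e / 8) 1 :> R by rewrite lt_min ltr01 divr_gt0.
  have [d d0 Hd] := real_derive_linear (is_derive_expR (0 : R)) m0.
  by exists d => // y; move: (Hd y); rewrite subr0 expR0 mul1r.
have [d2 d20 H2] : exists2 d : R, 0 < d &
    forall y, `|y| < d -> `|cos y - 1| <= e / 8 * `|y|.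
  have m0 : 0 < e / 8 :> R by rewrite divr_gt0.
  have [d d0 Hd] := real_derive_linear (is_derive_cos (0 : R)) m0.
  by exists d => // y; move: (Hd y); rewrite sin0 cos0 !subr0 oppr0 mul0r subr0.
have [d3 d30 H3] : exists2 d : R, 0 < d &
    forall y, `|y| < d -> `|sin y - y| <= e / 8 * `|y|.
  have m0 : 0 < e / 8 :> R by rewrite divr_gt0.
  have [d d0 Hd] := real_derive_linear (is_derive_sin (0 : R)) m0.
  by exists d => // y; move: (Hd y); rewrite sin0 cos0 mul1r !subr0.
pose d := Num.min (Num.min d1 (Num.min d2 d3)) (Num.min (e / 8) (1 / 2)).
exists d; first by rewrite !lt_min d10 d20 d30 !divr_gt0.
case=> x y; rewrite subr0 mul1r Cexp0 => xyd.
have xd := le_lt_trans (normc_Re (x +i* y)) xyd.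
have yd := le_lt_trans (normc_Im (x +i* y)) xyd.
have xn := normc_Re (x +i* y); have yn := normc_Im (x +i* y).
move: xd yd xn yn; set n := normc _ => /=; rewrite !lt_min.
move=> /andP[/andP[xd1 /andP[xd2 xd3]] /andP[xe x2]].
move=> /andP[/andP[yd1 /andP[yd2 yd3]] /andP[ye y2]] xn yn.
apply: (le_trans (le_normc_ReIm _)); rewrite /= subr0.
have {}H1 := H1 _ xd1; have {}H2 := H2 _ yd2; have {}H3 := H3 _ yd3.
have H1a : `|expR x - 1 - x| <= e / 8 * `|x|.
  by apply: le_trans H1 _; rewrite ler_wpM2r// ge_min lexx.
have H1b : `|expR x - 1 - x| <= `|x|.
  by apply: le_trans H1 _; rewrite ler_piMl// ge_min lexx orbT.
have ex2 : `|expR x - 1| <= 2 * `|x|.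
  rewrite -[expR x - 1](subrK x) (le_trans (ler_normD _ _))//; lra.
have ex : `|expR x| <= 2.
  rewrite -[expR x](subrK 1) (le_trans (ler_normD _ _))// normr1; lra.
have -> : expR x * cos y - 1 - x = (expR x - 1 - x) + expR x * (cos y - 1) by ring.
have -> : expR x * sin y - y = expR x * (sin y - y) + (expR x - 1) * y by ring.
apply: (le_trans (lerD (ler_normD _ _) (ler_normD _ _))); rewrite !normrM.
have A1 : `|expR x| * `|cos y - 1| <= 2 * (e / 8 * `|y|) by exact: ler_pM.
have A2 : `|expR x| * `|sin y - y| <= 2 * (e / 8 * `|y|) by exact: ler_pM.
have A3 : `|expR x - 1| * `|y| <= (2 * (e / 8)) * `|y|.
  by rewrite ler_wpM2r// (le_trans ex2)// ler_wpM2l// ltW.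
have e80 : 0 <= e / 8 by rewrite ltW// divr_gt0.
have := mulr_ge0 e80 (le_trans (normr_ge0 x) xn).
have := ler_wpM2l e80 xn; have := ler_wpM2l e80 yn; lra.
Qed.

Lemma cdiff_Cexp z : cdiff (@Cexp R) z.
Proof. by apply/cdiffP; exists (Cexp z); exact: cderiv_Cexp. Qed.

End ComplexExp.

(** * Integrals of complex functions of a real variable *)

Section PathIntegral.
Context {R : realType}.
Local Notation C := R[i].
Local Notation mu := (@lebesgue_measure R).
Implicit Types (u v : R -> R) (g h : R -> C) (a b c : R).

Definition rint u a b := \int[mu]_(t in `[a, b]) u t.

Lemma cont_integrable u a b : continuous u -> mu.-integrable `[a, b] (EFin \o u).
Proof.
move=> cu; apply: continuous_compact_integrable; first exact: segment_compact.
exact: continuous_subspaceT.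
Qed.

Lemma rint_split u a b c : continuous u -> a <= b -> b <= c ->
  rint u a c = rint u a b + rint u b c.
Proof.
move=> cu ab bc; have iac := cont_integrable a c cu.
have := @Rintegral_itvB R u (BLeft a) (BRight c) b iac.
rewrite !bnd_simp => /(_ ab bc) H; apply/eqP.
rewrite /rint addrC -subr_eq H; apply/eqP.
apply: Rintegral_itv_obnd_cbnd; apply: integrableS (cont_integrable b c cu) => //.
by apply: subset_itvr; rewrite bnd_simp.
Qed.

Lemma rintB u v a b : continuous u -> continuous v ->
  rint (fun t => u t - v t) a b = rint u a b - rint v a b.
Proof. by move=> cu cv; apply: RintegralB => //; exact: cont_integrable. Qed.

Lemma rintZ r u a b : continuous u -> rint (fun t => r * u t) a b = r * rint u a b.
Proof. by move=> cu; apply: RintegralZl => //; exact: cont_integrable. Qed.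

Lemma rint_cst r a b : a <= b -> rint (fun=> r) a b = r * (b - a).
Proof.
move=> ab; rewrite /rint Rintegral_cst//; congr (_ * _).
have /= -> := @lebesgue_measure_itv R `[a, b]%R.
rewrite lte_fin; by case: ltgtP ab => // -> _; rewrite subrr.
Qed.

Lemma rint_bound u a b M : continuous u -> a <= b ->
  (forall t, a <= t <= b -> `|u t| <= M) -> `|rint u a b| <= M * (b - a).
Proof.
move=> cu ab uM; rewrite -rint_cst//.
apply: (le_trans (le_normr_Rintegral _ _)) => //; first exact: cont_integrable.
apply: le_Rintegral => //.
- apply: (@cont_integrable (fun t => `|u t|)) => t.
  exact: (continuous_comp (cu t) (@norm_continuous _ _ _)).
- by apply: (@cont_integrable (fun=> M)) => t; exact: cvg_cst.
Qed.

Lemma rint_id a b : a <= b -> rint id a b = (b ^+ 2 - a ^+ 2) / 2.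
Proof.
rewrite le_eqVlt => /predU1P[->|ab].
  by rewrite /rint set_itv1 Rintegral_set1 subrr mul0r.
pose F (t : R) : R := 2^-1 * t ^+ 2.
have dF (t : R) : is_derive t 1 F t.
  have H : is_derive t 1 (fun t : R => t ^+ 2) (2 * t).
    have := @is_deriveX R R id 2 t 1 1 (is_derive_id _ _).
    by rewrite /GRing.scale/= mulr1 expr1.
  by have := is_deriveZ (2^-1 : R) H; rewrite /GRing.scale/= mulKf.
have cF : continuous F.
  by move=> t; apply: differentiable_continuous; apply/derivable1_diffP; exact: ex_derive.
rewrite /rint /Rintegral (@continuous_FTC2 _ _ F)//=.
- by rewrite /F -mulrBr mulrC.
- by apply: continuous_subspaceT => t; exact: cvg_id.
- by split=> [t _| |]; [exact: ex_derive | apply: cvg_at_right_filter; exact: cF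
    | apply: cvg_at_left_filter; exact: cF].
- by move=> t _; rewrite derive1E derive_val.
Qed.

Definition cint g a b : C :=
  rint (fun t => complex.Re (g t)) a b +i* rint (fun t => complex.Im (g t)) a b.

Definition pcont g := forall t, forall e : R, 0 < e -> exists2 d : R, 0 < d &
  forall s, `|s - t| < d -> normc (g s - g t) < e.

Lemma pcont_part g : pcont g ->
  continuous (fun t => complex.Re (g t)) /\ continuous (fun t => complex.Im (g t)).
Proof.
move=> cg; split=> t; apply/cvgrPdist_lt => e /(cg t)[d d0 Hd];
  apply/nbhs_ballP; exists d => //= s; rewrite /ball/= distrC => /Hd;
  apply: le_lt_trans; rewrite distrC.
  by apply: le_trans (normc_Re _); case: (g s) (g t) => ? ? [].
by apply: le_trans (normc_Im _); case: (g s) (g t) => ? ? [].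
Qed.

Lemma cint_split g a b c : pcont g -> a <= b -> b <= c ->
  cint g a c = cint g a b + cint g b c.
Proof.
by move=> /pcont_part[cr ci] ab bc; rewrite /cint (rint_split cr ab bc) (rint_split ci ab bc); simpc.
Qed.

Lemma eq_cint g h a b : (forall t, a <= t <= b -> g t = h t) ->
  cint g a b = cint h a b.
Proof.
move=> gh; rewrite /cint; congr (_ +i* _); apply: eq_Rintegral => t;
  by rewrite inE/= in_itv/= => /gh ->.
Qed.

Lemma cintB g h a b : pcont g -> pcont h ->
  cint (fun t => g t - h t) a b = cint g a b - cint h a b.
Proof.
move=> /pcont_part[gr gi] /pcont_part[hr hi]; rewrite /cint; simpc.
rewrite -!rintB//.
by congr (rint _ _ _ +i* rint _ _ _); apply/funext => t; case: (g t) (h t) => ? ? [].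
Qed.

Lemma cintZ (k : C) g a b : pcont g -> cint (fun t => k * g t) a b = k * cint g a b.
Proof.
case: k => k1 k2 /pcont_part[gr gi].
have cZ r u : continuous u -> continuous (fun t => r * u t).
  by move=> cu t; apply: cvgMr; exact: cu.
rewrite /cint; simpc; rewrite -!rintZ//.
rewrite -rintB; [|exact: cZ..].
rewrite (_ : rint (fun t => k1 * complex.Im (g t)) a b + _ =
   rint (fun t => k1 * complex.Im (g t) + k2 * complex.Re (g t)) a b); last first.
  by apply/esym; apply: RintegralD => //; apply: cont_integrable; exact: cZ.
by congr (rint _ _ _ +i* rint _ _ _); apply/funext => t; case: (g t).
Qed.

Lemma cint_cst (k : C) a b : a <= b -> cint (fun=> k) a b = k * (b - a)%:C.
Proof. by case: k => k1 k2 ab; rewrite /cint/= !rint_cst//; simpc. Qed.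

(** Bounding the real and imaginary parts separately costs the factor 2, which is
    harmless in all uses and spares rotating the integral onto the real axis. *)
Lemma cint_bound g a b M : pcont g -> a <= b ->
  (forall t, a <= t <= b -> normc (g t) <= M) ->
  normc (cint g a b) <= 2 * M * (b - a).
Proof.
move=> /pcont_part[gr gi] ab gM; rewrite (le_trans (le_normc_ReIm _))//.
rewrite -mulrA mulr2n mulrDl mul1r.
by apply: lerD; apply: rint_bound => // t /gM; apply: le_trans;
  [exact: normc_Re | exact: normc_Im].
Qed.

Lemma pcont_cst k : pcont (fun=> k).
Proof. by move=> t e e0; exists 1 => // s _; rewrite subrr normc0. Qed.

Lemma pcont_real : pcont (fun t => t%:C).
Proof. by move=> t e e0; exists e => // s; rewrite -rmorphB normc_real. Qed.

Lemma pcontB g h : pcont g -> pcont h -> pcont (fun t => g t - h t).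
Proof.
move=> cg ch t e e0; have e20 : 0 < e / 2 by rewrite divr_gt0.
have [d1 d10 H1] := cg t _ e20; have [d2 d20 H2] := ch t _ e20.
exists (Num.min d1 d2) => [|s]; first by rewrite lt_min d10.
rewrite lt_min => /andP[/H1 {}H1 /H2 {}H2].
rewrite (_ : _ - _ = (g s - g t) - (h s - h t)); last by ring.
by rewrite (le_lt_trans (le_normc_sub _ _))// [e](splitr e) ltrD.
Qed.

Lemma pcontM g h : pcont g -> pcont h -> pcont (fun t => g t * h t).
Proof.
move=> cg ch t e e0; pose K := normc (g t) + normc (h t) + 1.
have K0 : 0 < K by rewrite ltr_wpDl// addr_ge0 ?normc_ge0.
have e10 : 0 < Num.min 1 (e / (K + K)).
  by rewrite lt_min ltr01 divr_gt0// addr_gt0.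
have [d1 d10 H1] := cg t _ e10; have [d2 d20 H2] := ch t _ e10.
exists (Num.min d1 d2) => [|s]; first by rewrite lt_min d10.
rewrite lt_min => /andP[/H1 {}H1 /H2 {}H2].
move: H1 H2; rewrite !lt_min => /andP[_ H1] /andP[H3 H2].
have -> : g s * h s - g t * h t = (g s - g t) * h s + g t * (h s - h t) by ring.
rewrite (le_lt_trans (le_normcD _ _))// !normcM.
have hs : normc (h s) <= K.
  rewrite -[h s](subrK (h t)) (le_trans (le_normcD _ _))// /K.
  have := normc_ge0 (g t); lra.
have gt0 : normc (g t) <= K by rewrite /K; have := normc_ge0 (h t); lra.
have : normc (g s - g t) * normc (h s) + normc (g t) * normc (h s - h t) <=
  normc (g s - g t) * K + K * normc (h s - h t).
  by rewrite lerD// ?ler_wpM2l ?ler_wpM2r// normc_ge0.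
move=> /le_lt_trans; apply.
have KK : 0 < K + K by rewrite addr_gt0.
move: H1 H2; rewrite !ltr_pdivlMr//; nra.
Qed.

Lemma cint_affine (p q : C) a b : a <= b ->
  cint (fun t => p + q * t%:C) a b = p * (b - a)%:C + q * ((b ^+ 2 - a ^+ 2) / 2)%:C.
Proof.
move=> ab.
have -> : cint (fun t => p + q * t%:C) a b = cint (fun t => p - (- q) * t%:C) a b.
  by congr cint; apply/funext => t; rewrite mulNr opprK.
rewrite cintB; [|exact: pcont_cst|exact: pcontM (pcont_cst _) pcont_real].
rewrite cintZ; last exact: pcont_real.
rewrite cint_cst// mulNr opprK; congr (_ + _ * _).
by rewrite /cint rint_id// rint_cst// mul0r.
Qed.

End PathIntegral.

(** * Goursat's theorem *)

Lemma ccontB (R : realType) (f g : R[i] -> R[i]) z :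
  ccont f z -> ccont g z -> ccont (fun w => f w - g w) z.
Proof.
move=> cf cg e e0; have e20 : 0 < e / 2 by rewrite divr_gt0.
have [d1 d10 H1] := cf _ e20; have [d2 d20 H2] := cg _ e20.
exists (Num.min d1 d2) => [|s]; first by rewrite lt_min d10.
rewrite lt_min => /andP[/H1 {}H1 /H2 {}H2].
rewrite (_ : _ - _ = (f s - f z) - (g s - g z)); last by ring.
by rewrite (le_lt_trans (le_normc_sub _ _))// [e](splitr e) ltrD.
Qed.

Section Goursat.
Context {R : realType}.
Local Notation C := R[i].
Implicit Types (U : C -> C) (a b c d : R).

Lemma complexB (x y x' y' : R) : x +i* y - (x' +i* y') = (x - x') +i* (y - y').
Proof. by []. Qed.

(** The integral over the boundary of [[a, b] x [c, d]], taken counterclockwise. *)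
Definition rect_int U a b c d : C :=
  cint (fun x => U (x +i* c)) a b + 'i * cint (fun y => U (b +i* y)) c d
  - cint (fun x => U (x +i* d)) a b - 'i * cint (fun y => U (a +i* y)) c d.

Lemma pcont_h U y : (forall z, ccont U z) -> pcont (fun x => U (x +i* y)).
Proof.
move=> cU x e /(cU (x +i* y))[d d0 Hd]; exists d => // s sx; apply: Hd.
by rewrite complexB subrr complexr0 normc_real.
Qed.

Lemma pcont_v U x : (forall z, ccont U z) -> pcont (fun y => U (x +i* y)).
Proof.
move=> cU y e /(cU (x +i* y))[d d0 Hd]; exists d => // s sx; apply: Hd.
by rewrite complexB subrr /normc expr0n add0r sqrtr_sqr.
Qed.

Lemma rect_int_split U a m b c n d : (forall z, ccont U z) ->
  a <= m -> m <= b -> c <= n -> n <= d ->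
  rect_int U a b c d = rect_int U a m c n + rect_int U m b c n
                     + rect_int U a m n d + rect_int U m b n d.
Proof.
move=> cU am mb cn nd; rewrite /rect_int.
rewrite !(cint_split (pcont_h _ cU) am mb) !(cint_split (pcont_v _ cU) cn nd).
ring.
Qed.

(** The boundary integral of an affine function is zero, so that only the distance
    of [U] to such a function counts. *)
Lemma rect_int_local U p D e a b c d : (forall z, ccont U z) ->
  a <= b -> c <= d -> 0 <= e ->
  (forall x y, a <= x <= b -> c <= y <= d ->
    normc (U (x +i* y) - U p - D * (x +i* y - p)) <= e) ->
  normc (rect_int U a b c d) <= 4 * e * ((b - a) + (d - c)).
Proof.
move=> cU ab cd e0 H.
pose V z := U z - (U p + D * (z - p)).
have cA z : ccont (fun z => U p + D * (z - p)) z.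
  apply: cdiff_cont; apply: cdiffD; first exact: cdiff_cst.
  apply: cdiffM; first exact: cdiff_cst.
  by apply: cdiffB; [exact: cdiff_id | exact: cdiff_cst].
have Hh y : c <= y <= d -> cint (fun x => U (x +i* y)) a b =
    cint (fun x => V (x +i* y)) a b + cint (fun x => U p + D * (x +i* y - p)) a b.
  move=> cyd; rewrite /V cintB ?subrK//; first exact: pcont_h.
  exact: (@pcont_h (fun z => U p + D * (z - p))).
have Hv x : a <= x <= b -> cint (fun y => U (x +i* y)) c d =
    cint (fun y => V (x +i* y)) c d + cint (fun y => U p + D * (x +i* y - p)) c d.
  move=> axb; rewrite /V cintB ?subrK//; first exact: pcont_v.
  exact: (@pcont_v (fun z => U p + D * (z - p))).
have Ah y : cint (fun x => U p + D * (x +i* y - p)) a b =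
    (U p + D * (0 +i* y - p)) * (b - a)%:C + D * ((b ^+ 2 - a ^+ 2) / 2)%:C.
  rewrite -cint_affine//; apply: eq_cint => t _.
  rewrite (_ : t +i* y = t%:C + 0 +i* y); last by simpc.
  ring.
have Av x : cint (fun y => U p + D * (x +i* y - p)) c d =
    (U p + D * (x%:C - p)) * (d - c)%:C + D * 'i * ((d ^+ 2 - c ^+ 2) / 2)%:C.
  rewrite -cint_affine//; apply: eq_cint => t _.
  rewrite (_ : x +i* t = x%:C + 'i * t%:C); last by simpc.
  ring.
have cV z : ccont V z.
  exact: (@ccontB _ U (fun z => U p + D * (z - p))).
have -> : rect_int U a b c d = rect_int V a b c d.
  rewrite /rect_int !Hh ?lexx ?cd// !Hv ?lexx ?ab// !Ah !Av.
  rewrite (_ : 0 +i* c = 'i * c%:C); last by simpc.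
  rewrite (_ : 0 +i* d = 'i * d%:C); last by simpc.
  rewrite !rmorphM !rmorphB !rmorphXn /=.
  rewrite (_ : 2^-1%:C = 2^-1 :> C); last by rewrite fmorphV/= rmorph_nat.
  have i2 : 'i * 'i = -1 :> C by rewrite -expr2 sqr_i.
  move: (b%:C) (a%:C) (c%:C) (d%:C) (cint _ _ _) (cint _ _ _) (cint _ _ _) (cint _ _ _) => b' a' c' d' X Y Z T.
  ring: i2.
have B1 y : c <= y <= d -> normc (cint (fun x => V (x +i* y)) a b) <= 2 * e * (b - a).
  move=> cyd; apply: cint_bound => //; first exact: pcont_h.
  by move=> t atb; rewrite /V opprD addrA H.
have B2 x : a <= x <= b -> normc (cint (fun y => V (x +i* y)) c d) <= 2 * e * (d - c).
  move=> cyd; apply: cint_bound => //; first exact: pcont_v.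
  by move=> t atb; rewrite /V opprD addrA H.
have ni : normc ('i : C) = 1 by rewrite /normc expr0n expr1n add0r sqrtr1.
rewrite /rect_int.
have := B1 c; have := B1 d; have := B2 a; have := B2 b; rewrite !lexx ab cd /=.
move=> /(_ isT) b1 /(_ isT) b2 /(_ isT) b3 /(_ isT) b4.
apply: (le_trans (le_normc_sub _ _)); rewrite normcM ni mul1r.
have := le_normc_sub (cint (fun x => V (x +i* c)) a b + 'i * cint (fun y => V (b +i* y)) c d)
  (cint (fun x => V (x +i* d)) a b).
have := le_normcD (cint (fun x => V (x +i* c)) a b) ('i * cint (fun y => V (b +i* y)) c d).
rewrite normcM ni mul1r; move: b1 b2 b3 b4.
move: (normc _) (normc _) (normc _) (normc _) (normc _) (normc _); clear => *; lra.
Qed.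

Lemma nested_intervals (u : nat -> R) (L : R) : 0 <= L ->
  (forall n, u n <= u n.+1) ->
  (forall n, u n.+1 + L / 2 ^+ n.+1 <= u n + L / 2 ^+ n) ->
  exists p, forall n, u n <= p <= u n + L / 2 ^+ n.
Proof.
move=> L0 um ud.
have um' n k : u n <= u (k + n)%N by elim: k => // k /le_trans; apply; exact: um.
have ud' n k : u (k + n)%N + L / 2 ^+ (k + n) <= u n + L / 2 ^+ n.
  by elim: k => // k IH; apply: le_trans IH; exact: ud.
have nm n m : u n <= u m + L / 2 ^+ m.
  have p2 k : 0 <= L / 2 ^+ k by rewrite divr_ge0// exprn_ge0.
  case/orP: (leq_total n m) => nm.
    by rewrite (le_trans (um' n (m - n)%N))// subnK// lerDl.
  by rewrite (le_trans _ (ud' m (n - m)%N))// subnK// lerDl.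
have hs : has_sup (range u).
  by split; [exists (u 0%N), 0%N | exists (u 0%N + L / 2 ^+ 0) => _ [n _ <-]; exact: nm].
exists (sup (range u)) => n; apply/andP; split.
  by apply: ub_le_sup; [exact: hs.2 | exists n].
by apply: ge_sup; [exact: hs.1 | move=> _ [m _ <-]; exact: nm].
Qed.

(** One of the four quarters of a rectangle carries at least a quarter of the
    integral. Along the resulting nested rectangles the integral decreases at most like
    [4 ^- n], but differentiability at their common point makes it [o(4 ^- n)].
    Differentiability is required relative to the closed rectangle only, since the
    theorem is applied to a function that is extended across the sides by projection. *)
Lemma goursat U a b c d : (forall z, ccont U z) -> a <= b -> c <= d ->
  (forall p, a <= complex.Re p <= b -> c <= complex.Im p <= d ->
    exists D, forall e : R, 0 < e -> exists2 r : R, 0 < r & forall w,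
      a <= complex.Re w <= b -> c <= complex.Im w <= d -> normc (w - p) < r ->
      normc (U w - U p - D * (w - p)) <= e * normc (w - p)) ->
  rect_int U a b c d = 0.
Proof.
move=> cU ab cd dU.
pose L := b - a; pose H := d - c.
have L0 : 0 <= L by rewrite subr_ge0.
have H0 : 0 <= H by rewrite subr_ge0.
pose Q n (p : R * R) := rect_int U p.1 (p.1 + L / 2 ^+ n) p.2 (p.2 + H / 2 ^+ n).
have p2 (k : nat) : 0 < 2 ^+ k :> R by rewrite exprn_gt0.
have half (T : R) n : T / 2 ^+ n = T / 2 ^+ n.+1 + T / 2 ^+ n.+1.
  by rewrite exprS; field; rewrite lt0r_neq0.
have Ln n : 0 <= L / 2 ^+ n by rewrite divr_ge0// ltW.
have Hn n : 0 <= H / 2 ^+ n by rewrite divr_ge0// ltW.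
have step (np : nat * (R * R)) : exists p' : R * R,
    [/\ np.2.1 <= p'.1, np.2.2 <= p'.2,
       p'.1 + L / 2 ^+ np.1.+1 <= np.2.1 + L / 2 ^+ np.1,
       p'.2 + H / 2 ^+ np.1.+1 <= np.2.2 + H / 2 ^+ np.1 &
       normc (Q np.1 np.2) <= 4 * normc (Q np.1.+1 p')].
  case: np => n [x y] /=.
  pose x' := x + L / 2 ^+ n.+1; pose y' := y + H / 2 ^+ n.+1.
  have xx : x <= x' by rewrite /x' lerDl.
  have yy : y <= y' by rewrite /y' lerDl.
  have x2 : x' + L / 2 ^+ n.+1 = x + L / 2 ^+ n by rewrite (half L n) /x' addrA.
  have y2 : y' + H / 2 ^+ n.+1 = y + H / 2 ^+ n by rewrite (half H n) /y' addrA.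
  have : Q n (x, y) = Q n.+1 (x, y) + Q n.+1 (x', y) + Q n.+1 (x, y') + Q n.+1 (x', y').
    rewrite /Q/= x2 y2; apply: rect_int_split => //.
      by rewrite -x2 lerDl.
    by rewrite -y2 lerDl.
  move=> EQ.
  have EN : normc (Q n (x, y)) <= normc (Q n.+1 (x, y)) + normc (Q n.+1 (x', y))
      + normc (Q n.+1 (x, y')) + normc (Q n.+1 (x', y')).
    rewrite EQ (le_trans (le_normcD _ _))// lerD2r.
    by rewrite (le_trans (le_normcD _ _))// lerD2r le_normcD.
  have xl : x + L / 2 ^+ n.+1 <= x + L / 2 ^+ n by rewrite -x2 -/x' lerDl.
  have yl : y + H / 2 ^+ n.+1 <= y + H / 2 ^+ n by rewrite -y2 -/y' lerDl.
  have [s1|s1] := leP (normc (Q n (x, y))) (4 * normc (Q n.+1 (x, y))).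
    by exists (x, y).
  have [s2|s2] := leP (normc (Q n (x, y))) (4 * normc (Q n.+1 (x', y))).
    by exists (x', y); split => //=; rewrite x2.
  have [s3|s3] := leP (normc (Q n (x, y))) (4 * normc (Q n.+1 (x, y'))).
    by exists (x, y'); split => //=; rewrite y2.
  have [s4|s4] := leP (normc (Q n (x, y))) (4 * normc (Q n.+1 (x', y'))).
    by exists (x', y'); split => //=; rewrite ?x2 ?y2.
  move: EN s1 s2 s3 s4; move: (normc _) (normc _) (normc _) (normc _) (normc _); clear => *; lra.
have [f Hf] := choice step.
pose q := fix q n := if n is m.+1 then f (m, q m) else (a, c).
have qS n : q n.+1 = f (n, q n) by [].
have Qn n : normc (rect_int U a b c d) <= 4 ^+ n * normc (Q n (q n)).
  elim: n => [|n IH].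
    by rewrite expr0 mul1r /Q/= expr0 !divr1 /L /H !(addrC _ (_ - _)) !subrK.
  apply: (le_trans IH); rewrite exprS -mulrA mulrCA ler_wpM2l ?exprn_ge0//.
  by have [_ _ _ _] := Hf (n, q n).
have [px Hpx] : exists p, forall n, (q n).1 <= p <= (q n).1 + L / 2 ^+ n.
  by apply: nested_intervals => // n; have [] := Hf (n, q n).
have [py Hpy] : exists p, forall n, (q n).2 <= p <= (q n).2 + H / 2 ^+ n.
  by apply: nested_intervals => // n; have [] := Hf (n, q n).
have ina n : a <= (q n).1.
  by elim: n => [|n /le_trans]; [exact: lexx | apply; have [] := Hf (n, q n)].
have inb n : (q n).1 + L / 2 ^+ n <= b.
  elim: n => [|n]; first by rewrite /= expr0 divr1 /L addrC subrK.
  by apply: le_trans; have [] := Hf (n, q n).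
have inc n : c <= (q n).2.
  by elim: n => [|n /le_trans]; [exact: lexx | apply; have [] := Hf (n, q n)].
have ind n : (q n).2 + H / 2 ^+ n <= d.
  elim: n => [|n]; first by rewrite /= expr0 divr1 /H addrC subrK.
  by apply: le_trans; have [] := Hf (n, q n).
have pxab : a <= px <= b.
  have /andP[p1 p3] := Hpx 0%N; apply/andP; split; first exact: le_trans p1.
  exact: le_trans (inb 0%N).
have pyab : c <= py <= d.
  have /andP[p1 p3] := Hpy 0%N; apply/andP; split; first exact: le_trans p1.
  exact: le_trans (ind 0%N).
have [D HD] := dU (px +i* py) pxab pyab.
have main e : 0 < e -> normc (rect_int U a b c d) <= 4 * e * (L + H) ^+ 2.
  move=> e0; have [r r0 Hr] := HD _ e0.
  have [n nr] : exists n, (L + H) / 2 ^+ n < r.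
    exists (Num.bound ((L + H) / r)).
    by rewrite ltr_pdivrMr// mulrC -ltr_pdivrMr// upper_nthrootP.
  apply: (le_trans (Qn n)).
  have e1 : 0 <= e * ((L + H) / 2 ^+ n).
    by rewrite mulrDl (mulr_ge0 (ltW e0))// addr_ge0.
  have := @rect_int_local U (px +i* py) D (e * ((L + H) / 2 ^+ n)) (q n).1 ((q n).1 + L / 2 ^+ n)
    (q n).2 ((q n).2 + H / 2 ^+ n) cU.
  rewrite !lerDl => /(_ (Ln n) (Hn n) e1) B.
  have {}B : normc (Q n (q n)) <= 4 * (e * ((L + H) / 2 ^+ n)) * ((L + H) / 2 ^+ n).
    move: B; rewrite [(q n).1 + _ - _]addrAC [(q n).2 + _ - _]addrAC !subrr !add0r -mulrDl => B.
    apply: B => x y /andP[x1 x2] /andP[y1 y2].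
    have /andP[p1 p3] := Hpx n; have /andP[p4 p5] := Hpy n.
    have wp : normc (x +i* y - (px +i* py)) <= (L + H) / 2 ^+ n.
      rewrite (le_trans (le_normc_ReIm _))// complexB /= mulrDl.
      by apply: lerD; rewrite ler_norml; apply/andP; split;
        move: x1 x2 y1 y2 p1 p3 p4 p5; clear => *; lra.
    apply: (le_trans (Hr _ _ _ _)) => /=.
    - by rewrite (le_trans (ina n))//= (le_trans x2).
    - by rewrite (le_trans (inc n))//= (le_trans y2).
    - exact: le_lt_trans wp nr.
    - by rewrite ler_wpM2l// ltW.
  apply: (le_trans (ler_wpM2l _ B)); first by rewrite exprn_ge0.
  rewrite le_eqVlt; apply/orP; left; apply/eqP.
  rewrite (_ : 4 = 2 ^+ 2 :> R) -?exprM; last by rewrite expr2; lra.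
  by rewrite mulnC exprM; field; rewrite lt0r_neq0.
apply/eqP; rewrite -normc_eq0; apply/negPn/negP => I0.
have {}I0 : 0 < normc (rect_int U a b c d) by rewrite lt_neqAle eq_sym I0 normc_ge0.
have K0 : 0 < 8 * ((L + H) ^+ 2 + 1) by rewrite mulr_gt0// ltr_wpDl// sqr_ge0.
have := main (normc (rect_int U a b c d) / (8 * ((L + H) ^+ 2 + 1))) (divr_gt0 I0 K0).
rewrite leNgt => /negP; apply.
set N := normc _ in I0 *; set K := 8 * _ in K0 *.
rewrite (_ : 4 * (N / K) * _ = 4 * N * (L + H) ^+ 2 / K); last by ring.
rewrite ltr_pdivrMr// /K.
have := mulr_ge0 (ltW I0) (sqr_ge0 (L + H)); move: I0; lra.
Qed.

End Goursat.

(** * Continuity and difference quotients *)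

Section ContinuityRules.
Context {R : realType}.
Local Notation C := R[i].
Implicit Types (f g : C -> C) (z w : C).

Lemma ccontP f z : ccont f z <-> (f w @[w --> (z : C^o)] --> (f z : C^o)).
Proof.
have K := @cvg_normc R C^o (nbhs (z : C^o)) _ f (f z).
by split=> [H|/K H e /H/nbhs_normc //]; apply/K => e /H ?; apply/nbhs_normc.
Qed.

Lemma ccontM f g z : ccont f z -> ccont g z -> ccont (fun w => f w * g w) z.
Proof. by move=> /ccontP cf /ccontP cg; apply/ccontP; exact: (cvgM cf cg). Qed.

Lemma ccontV f z : f z != 0 -> ccont f z -> ccont (fun w => (f w)^-1) z.
Proof. by move=> f0 /ccontP cf; apply/ccontP; exact: (cvgV f0 cf). Qed.

Lemma ccont_near f g z : (exists2 d : R, 0 < d & forall w, normc (w - z) < d ->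
  f w = g w) -> ccont f z -> ccont g z.
Proof.
move=> [d d0 fg] cf e /cf[d' d'0 Hd]; exists (Num.min d d') => [|w].
  by rewrite lt_min d0.
by rewrite lt_min => /andP[wd /Hd]; rewrite !fg// subrr normc0.
Qed.

Lemma ccont_neq0 f z : f z != 0 -> ccont f z ->
  exists2 d : R, 0 < d & forall w, normc (w - z) < d -> f w != 0.
Proof.
rewrite -normc_gt0 => f0 /(_ _ f0)[d d0 Hd]; exists d => // w /Hd.
by apply: contraTneq => ->; rewrite sub0r normcN ltxx.
Qed.

Definition dquot f p D z := if z == p then D else (f z - f p) / (z - p).

Lemma ccont_dquot f p D : cderiv f p D -> ccont (dquot f p D) p.
Proof.
move=> /cderivP H e e0; have e20 : 0 < e / 2 by rewrite divr_gt0.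
have [d d0 Hd] := H _ e20; exists d => // w wp; rewrite /dquot eqxx.
have [_|wp0] := eqVneq w p; first by rewrite subrr normc0.
have wp1 : w - p != 0 by rewrite subr_eq0.
have -> : (f w - f p) / (w - p) - D = (f w - f p - D * (w - p)) / (w - p).
  by rewrite [RHS]mulrBl mulfK.
rewrite normcM normcV ltr_pdivrMr ?normc_gt0// (le_lt_trans (Hd _ wp))//.
by rewrite ltr_pM2r ?normc_gt0// ltr_pdivrMr// ltr_pMr// ltr1n.
Qed.

End ContinuityRules.

(** * Integrals over one period of a vertical line *)

Section LineIntegral.
Context {R : realType}.
Local Notation C := R[i].
Local Notation Re := complex.Re.
Local Notation Im := complex.Im.
Implicit Types (f g psi : C -> C) (x a b : R) (z p : C).

Definition line_int psi x := cint (fun y => psi (x +i* y)) 0 (pi *+ 2).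

Definition twopii_periodic (T : Type) (psi : C -> T) := forall z, psi (z + twopii) = psi z.

Lemma pcont_line psi x : (forall y, ccont psi (x +i* y)) -> pcont (fun y => psi (x +i* y)).
Proof.
move=> c y e /(c y)[d d0 Hd]; exists d => // s sy; apply: Hd.
by rewrite complexB subrr /normc expr0n add0r sqrtr_sqr.
Qed.

Lemma line_int_bound psi x M : (forall y, ccont psi (x +i* y)) ->
  (forall y, 0 <= y <= pi *+ 2 -> normc (psi (x +i* y)) <= M) ->
  normc (line_int psi x) <= 2 * M * (pi *+ 2).
Proof.
move=> c H; rewrite -[X in _ * X]subr0; apply: cint_bound => //.
  exact: pcont_line.
exact/ltW/twopi_gt0.
Qed.

Lemma line_intB f g x : (forall y, ccont f (x +i* y)) -> (forall y, ccont g (x +i* y)) ->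
  line_int (fun z => f z - g z) x = line_int f x - line_int g x.
Proof. by move=> cf cg; apply: cintB; exact: pcont_line. Qed.

Lemma line_intZ k f x : (forall y, ccont f (x +i* y)) ->
  line_int (fun z => k * f z) x = k * line_int f x.
Proof. by move=> cf; apply: cintZ; exact: pcont_line. Qed.

Lemma line_int_cst k x : line_int (fun=> k) x = k * (pi *+ 2)%:C.
Proof. by rewrite /line_int cint_cst ?subr0//; exact/ltW/twopi_gt0. Qed.

Lemma eq_line_int f g x : (forall y, f (x +i* y) = g (x +i* y)) ->
  line_int f x = line_int g x.
Proof. by move=> fg; apply: eq_cint. Qed.

(** Goursat's theorem on a rectangle of height [2 * pi]: the horizontal sides cancel
    by periodicity. *)
Lemma line_int_const psi a b : a <= b -> twopii_periodic psi ->
  (forall z, a <= Re z <= b -> cdiff psi z) -> line_int psi a = line_int psi b.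
Proof.
move=> ab pp dpsi.
pose cl x := Num.max a (Num.min b x).
have clab x : a <= cl x <= b by rewrite /cl le_max lexx ge_max ab ge_min lexx.
have clid x : a <= x <= b -> cl x = x.
  by move=> /andP[ax xb]; rewrite /cl (min_idPr xb) (max_idPr ax).
have cl_lip x y : `|cl x - cl y| <= `|x - y|.
  wlog xy : x y / x <= y => [H|].
    by case/orP: (le_total x y) => [|/H]; [exact: H | rewrite distrC (distrC y)].
  have c1 : cl x <= cl y by rewrite /cl ge_max !le_max lexx/= le_min2// orbT.
  rewrite distrC (distrC x) !ger0_norm ?subr_ge0// lerBlDr [in leLHS]/cl ge_max.
  apply/andP; split.
    by rewrite -[leLHS]add0r lerD ?subr_ge0//; case/andP: (clab x).
  have : Num.min b x <= cl x by rewrite le_max lexx orbT.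
  rewrite -(lerD2l (y - x)); apply: le_trans; case: (leP b x) => _.
    by rewrite ge_min lerDr subr_ge0 xy.
  by rewrite subrK ge_min lexx orbT.
(* Goursat's theorem asks for continuity on the plane: project to the strip *)
pose U z := psi (cl (Re z) +i* Im z).
have cU z : ccont U z.
  move=> e e0; have [d d0 Hd] := cdiff_cont (dpsi (cl (Re z) +i* Im z) (clab _)) e0.
  exists (d / 2) => [|w]; first by rewrite divr_gt0.
  rewrite ltr_pdivlMr// => wz; apply: Hd.
  rewrite (le_lt_trans (le_normc_ReIm _))// (le_lt_trans _ wz)//= mulr_natr mulr2n.
  rewrite lerD// ?(le_trans (cl_lip _ _))//.
    by apply: le_trans (normc_Re _); case: (w) (z) => ? ? [].
  by apply: le_trans (normc_Im _); case: (w) (z) => ? ? [].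
have tp := ltW (@twopi_gt0 R).
have := @goursat R U a b 0 (pi *+ 2) cU ab tp.
have Uab x y : a <= x <= b -> U (x +i* y) = psi (x +i* y) by move=> /clid xab; rewrite /U xab.
have -> : rect_int U a b 0 (pi *+ 2) = 'i * (line_int psi b - line_int psi a).
  rewrite /rect_int /line_int.
  rewrite (@eq_cint _ (fun x => U (x +i* (pi *+ 2))) (fun x => U (x +i* 0))).
    rewrite (@eq_cint _ (fun y => U (b +i* y)) (fun y => psi (b +i* y))).
      rewrite (@eq_cint _ (fun y => U (a +i* y)) (fun y => psi (a +i* y))); first by ring.
      by move=> t _; rewrite Uab ?lexx.
    by move=> t _; rewrite Uab ?lexx ?ab.
  move=> t tab; rewrite !Uab// -(pp (t +i* 0)); congr psi.
  by rewrite /twopii; simpc.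
move=> H; apply/eqP; rewrite eq_sym -subr_eq0.
have i0 : ('i : C) != 0 by rewrite eq_complex/= oner_eq0 andbF.
rewrite -(inj_eq (mulfI i0)) mulr0; apply/eqP; apply: H => p pab _.
have [D /cderivP HD] := (cdiffP _ _).1 (dpsi p pab).
exists D => e /HD[r r0 Hr]; exists r => // w wab _ /Hr.
by rewrite /U !clid//; case: (w) (p) => ? ? [].
Qed.

(** Compactness of one period. *)
Lemma line_unif_cont psi x0 e : (forall y, ccont psi (x0 +i* y)) -> 0 < e ->
  exists2 d : R, 0 < d & forall x y, `|x - x0| < d -> 0 <= y <= pi *+ 2 ->
    normc (psi (x +i* y) - psi (x0 +i* y)) < e.
Proof.
move=> c e0.
have := (@compact_near_coveringP R `[0, pi *+ 2]).1
  (@segment_compact R 0 (pi *+ 2)) R (nbhs x0)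
  (fun x y => normc (psi (x +i* y) - psi (x0 +i* y)) < e) _.
case.
  move=> y _; have e20 : 0 < e / 2 by rewrite divr_gt0.
  have [d d0 Hd] := c y _ e20; have d20 : 0 < d / 2 by rewrite divr_gt0.
  exists (ball y (d / 2), ball x0 (d / 2)).
    by split; [exact: nbhsx_ballx | exact: nbhsx_ballx].
  case=> y' x [/=]; rewrite /ball/= => yy xx.
  rewrite (le_lt_trans (le_normc_trans (psi (x0 +i* y)) _ _))// [e](splitr e) ltrD//.
    apply: Hd; rewrite (le_lt_trans (le_normc_ReIm _))// [d](splitr d) ltrD//=.
      by rewrite distrC.
    by rewrite distrC.
  rewrite normcB; apply: Hd; rewrite complexB subrr /normc expr0n add0r sqrtr_sqr.
  by rewrite distrC (lt_trans yy)// ltr_pdivrMr// ltr_pMr// ltr1n.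
move=> d /= d0 Hd; exists d => // x y xd y2; apply: (Hd x) => /=.
  by rewrite distrC.
by rewrite in_itv.
Qed.

(** The integrals over the lines near [x0] tend to the integral over [x0]. This
    serves for a difference quotient, which is continuous but not known to be
    differentiable at its centre. *)
Lemma line_int_const_except psi a b x0 : a <= x0 <= b -> twopii_periodic psi ->
  (forall z, a <= Re z <= b -> Re z != x0 -> cdiff psi z) ->
  (forall y, ccont psi (x0 +i* y)) -> line_int psi a = line_int psi b.
Proof.
move=> /andP[ax xb] pp dpsi c0.
have cA x y : a <= x <= b -> ccont psi (x +i* y).
  by move=> xab; have [->//|xx] := eqVneq x x0; apply/cdiff_cont/dpsi.
have close e : 0 < e -> exists2 d : R, 0 < d & forall x, a <= x <= b -> `|x - x0| < d ->
    normc (line_int psi x - line_int psi x0) < e.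
  move=> e0; have K0 : 0 < 4 * (pi *+ 2) :> R by rewrite mulr_gt0// twopi_gt0.
  have e10 : 0 < e / (4 * (pi *+ 2)) by rewrite divr_gt0.
  have [d d0 Hd] := line_unif_cont c0 e10.
  exists d => // x xab xd.
  rewrite /line_int -cintB; [|apply: pcont_line => y; exact: cA|exact: pcont_line].
  apply: (@le_lt_trans _ _ (2 * (e / (4 * (pi *+ 2))) * (pi *+ 2 - 0))).
    apply: cint_bound.
    - by apply: pcontB; apply: pcont_line => // y; exact: cA.
    - exact/ltW/twopi_gt0.
    - by move=> y y2; apply/ltW/Hd.
  rewrite subr0 (_ : _ * _ = e / 2).
    by rewrite ltr_pdivrMr// ltr_pMr// ltr1n.
  by move: (lt0r_neq0 (@twopi_gt0 R)); move: (pi *+ 2) => T T0; field; rewrite ?T0.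
have zero (u : C) : (forall e, 0 < e -> normc u < e) -> u = 0.
  by move=> H; apply: (@normc_small0 _ _ 1) => e e0 _; rewrite mul1r ltW// H.
have L : line_int psi a = line_int psi x0.
  have [->//|ax0] := eqVneq a x0.
  have {}ax0 : a < x0 by rewrite lt_neqAle ax0.
  apply/eqP; rewrite -subr_eq0; apply/eqP/zero => e /close[d d0 Hd].
  pose x := Num.max a (x0 - d / 2).
  have xx0 : x < x0 by rewrite /x gt_max ax0 ltrBlDr ltrDl divr_gt0.
  have axx : a <= x by rewrite /x le_max lexx.
  rewrite (@line_int_const psi a x)//; last first.
    move=> z /andP[az zx]; apply: dpsi; first by rewrite az (le_trans zx)// (le_trans (ltW xx0)).
    by rewrite lt_eqF// (le_lt_trans zx).
  apply: Hd; first by rewrite axx (le_trans (ltW xx0)).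
  rewrite ltr0_norm ?subr_lt0// opprB ltrBlDr -ltrBlDl /x lt_max; apply/orP; right.
  by rewrite ltrD2l ltrN2 ltr_pdivrMr// ltr_pMr// ltr1n.
have L2 : line_int psi b = line_int psi x0.
  have [->//|bx0] := eqVneq b x0.
  have {}bx0 : x0 < b by rewrite lt_neqAle eq_sym bx0.
  apply/eqP; rewrite -subr_eq0; apply/eqP/zero => e /close[d d0 Hd].
  pose x := Num.min b (x0 + d / 2).
  have xx0 : x0 < x by rewrite /x lt_min bx0 ltrDl divr_gt0.
  have axx : x <= b by rewrite /x ge_min lexx.
  rewrite -(@line_int_const psi x b)//; last first.
    move=> z /andP[az zx]; apply: dpsi; first by rewrite zx (le_trans ax)// (le_trans (ltW xx0)).
    by rewrite gt_eqF// (lt_le_trans xx0).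
  apply: Hd; first by rewrite axx (le_trans ax)// ltW.
  rewrite gtr0_norm ?subr_gt0// ltrBlDl /x gt_min; apply/orP; right.
  by rewrite ltrD2l ltr_pdivrMr// ltr_pMr// ltr1n.
by rewrite L L2.
Qed.

End LineIntegral.

(** * Cauchy's formula on a half-plane *)

Section CauchyHalfPlane.
Context {R : realType}.
Local Notation C := R[i].
Local Notation Re := complex.Re.
Local Notation Im := complex.Im.
Implicit Types (psi : C -> C) (x : R) (z p : C).

(** The logarithmic derivative of [Cexp z - Cexp p], which is the periodic
    counterpart of the Cauchy kernel [1 / (z - p)]. *)
Definition ckernel p z := Cexp z / (Cexp z - Cexp p).

Lemma Cexp_sub_ge p z : expR (Re z) - expR (Re p) <= normc (Cexp z - Cexp p).
Proof. by rewrite -!normc_Cexp le_normcB. Qed.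

Lemma Cexp_neq_Re p z : Re z != Re p -> Cexp z != Cexp p.
Proof. by apply: contra_neq => /(congr1 normc); rewrite !normc_Cexp => /expR_inj. Qed.

Lemma cdiff_ckernel p z : Cexp z != Cexp p -> cdiff (ckernel p) z.
Proof.
move=> zp; apply: cdiffM; first exact: cdiff_Cexp.
apply: cdiffV; first by rewrite subr_eq0.
by apply: cdiffB; [exact: cdiff_Cexp | exact: cdiff_cst].
Qed.

Lemma ckernel_periodic p : twopii_periodic (ckernel p).
Proof. by move=> z; rewrite /ckernel Cexp_periodic. Qed.

(** The integral does not depend on the line, and the kernel tends to 1 as [Re z]
    tends to [+oo]. *)
Lemma line_int_ckernel p x : Re p < x -> line_int (ckernel p) x = (pi *+ 2)%:C.
Proof.
move=> px; apply/eqP; rewrite -subr_eq0; apply/eqP.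
apply: (@normc_small0 _ _ (2 * (pi *+ 2))) => e e0 e1.
(* to the right of this [y] the kernel differs from 1 by at most [e] *)
pose y := Num.max x (Re p + ln (1 + e^-1)).
have xy : x <= y by rewrite /y le_max lexx.
have py : Re p < y by rewrite (lt_le_trans px).
rewrite (@line_int_const _ _ x y)//; last 2 first.
- exact: ckernel_periodic.
- move=> z /andP[xz _]; apply/cdiff_ckernel/Cexp_neq_Re.
  by rewrite gt_eqF// (lt_le_trans px).
have zp s : Cexp (y +i* s) != Cexp p by apply: Cexp_neq_Re; rewrite gt_eqF.
rewrite -[(_)%:C]mul1r -(line_int_cst _ y) -line_intB; last 2 first.
- by move=> s; apply/cdiff_cont/cdiff_ckernel.
- by move=> s; apply/cdiff_cont/cdiff_cst.
rewrite mulrAC; apply: line_int_bound => [s|s _].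
  apply: ccontB; apply: cdiff_cont; [exact: cdiff_ckernel | exact: cdiff_cst].
have e1' : 0 < 1 + e^-1 by rewrite addr_gt0// invr_gt0.
rewrite /ckernel -(divff (_ : Cexp (y +i* s) - Cexp p != 0)) ?subr_eq0//.
rewrite -mulrBl opprB addrC subrK normcM normcV normc_Cexp.
have ep := expR_gt0 (Re p).
have ey : expR (Re p) * (1 + e^-1) <= expR y.
  by rewrite -{1}(lnK (_ : 1 + e^-1 \is Num.pos)) ?posrE// -expRD ler_expR /y le_max lexx orbT.
have ge := Cexp_sub_ge p (y +i* s); rewrite /= in ge.
have ne : expR (Re p) / e <= expR y - expR (Re p).
  by rewrite lerBrDl; move: ey; rewrite mulrDr mulr1.
have n0 : 0 < normc (Cexp (y +i* s) - Cexp p).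
  by rewrite (lt_le_trans _ ge)// (lt_le_trans _ ne)// divr_gt0.
by rewrite ler_pdivrMr// mulrC -ler_pdivrMr// (le_trans ne).
Qed.

(** The function [(psi z - psi p) * ckernel p z] extends continuously to the zeros of
    the denominator, and tends to 0 as [Re z] tends to [-oo]; its integral over any line
    is therefore 0. *)
Lemma cauchy_half_plane psi (x1 B : R) x p : twopii_periodic psi ->
  (forall z, Re z <= x -> cdiff psi z) ->
  (forall z, Re z <= x1 -> normc (psi z) <= B) -> Re p < x ->
  line_int (fun z => psi z * ckernel p z) x = (pi *+ 2)%:C * psi p.
Proof.
move=> pp dpsi bpsi px.
have /cdiffP[D psiD] : cdiff psi p by apply: dpsi; exact: ltW.
pose phi z := if Cexp z == Cexp p then D else (psi z - psi p) * ckernel p z.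
have pphi : twopii_periodic phi by move=> z; rewrite /phi Cexp_periodic pp ckernel_periodic.
have expc z : ccont (@Cexp R) z by exact/cdiff_cont/cdiff_Cexp.
have dphi z : Re z <= x -> Cexp z != Cexp p -> cdiff phi z.
  move=> zx2 zp; apply: (@cdiff_near _ (fun w => (psi w - psi p) * ckernel p w)).
    have [d d0 Hd] : exists2 d : R, 0 < d & forall w, normc (w - z) < d -> Cexp w - Cexp p != 0.
      apply: (@ccont_neq0 _ (fun w => Cexp w - Cexp p)); first by rewrite subr_eq0.
      by apply: ccontB => //; exact/cdiff_cont/cdiff_cst.
    by exists d => // w /Hd; rewrite subr_eq0 /phi => /negbTE ->.
  apply: cdiffM; last exact: cdiff_ckernel.
  by apply: cdiffB; [exact: dpsi | exact: cdiff_cst].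
have cphip : ccont phi p.
  have cq := ccont_dquot (cderiv_Cexp p).
  have q0 : dquot (@Cexp R) p (Cexp p) p != 0 by rewrite /dquot eqxx Cexp_neq0.
  have [d d0 Hd] := ccont_neq0 q0 cq.
  apply: (@ccont_near _ (fun w => dquot psi p D w *
      (Cexp w * (dquot (@Cexp R) p (Cexp p) w)^-1))).
    exists d => // w /Hd; rewrite /phi /dquot; have [->|wp] := eqVneq w p.
      by move=> _; rewrite eqxx divff ?mulr1// Cexp_neq0.
    move=> Hw; have [ewp|ewp] := eqVneq (Cexp w) (Cexp p).
      by move: Hw; rewrite ewp subrr mul0r eqxx.
    have w1 : w - p != 0 by rewrite subr_eq0.
    have w2 : Cexp w - Cexp p != 0 by rewrite subr_eq0.
    by rewrite /ckernel; field; rewrite w1 w2.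
  apply: ccontM; first exact: ccont_dquot.
  by apply: ccontM => //; exact: ccontV.
have cphi z : Re z <= x -> ccont phi z.
  move=> zx2; have [zp|zp] := eqVneq (Cexp z) (Cexp p); last exact/cdiff_cont/dphi.
  have [n zn] := Cexp_eq zp.
  move=> e /cphip[d d0 Hd]; exists d => // w wz.
  have -> : phi z = phi p by rewrite zn (periodic_int pphi).
  rewrite -(periodic_int pphi (- n)) mulrNz; apply: Hd.
  by rewrite addrAC -addrA -opprD -zn.
have phi0 : line_int phi x = 0.
  apply: (@normc_small0 _ _ (2 * (`|B| + normc (psi p)) * (pi *+ 2))) => e e0 e1.
  (* this choice gives [expR y / (expR (Re p) - expR y) <= e] *)
  pose y := Num.min (Num.min x1 x) (Re p + ln (e / (1 + e))).
  have e2 : 0 < e / (1 + e) by rewrite divr_gt0// addr_gt0.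
  have yx : y <= x by rewrite /y !ge_min lexx orbT.
  have yx1 : y <= x1 by rewrite /y !ge_min lexx.
  have eye : expR y * (1 + e) <= expR (Re p) * e.
    rewrite -ler_pdivlMr ?addr_gt0// -mulrA -{1}(lnK (_ : e / (1 + e) \is Num.pos)) ?posrE//.
    by rewrite -expRD ler_expR /y ge_min lexx orbT.
  have yp : y < Re p.
    rewrite -ltr_expR -(ltr_pM2r (_ : 0 < 1 + e)) ?addr_gt0//.
    by rewrite (le_lt_trans eye)// ltr_pM2l ?expR_gt0// ltrDr.
  rewrite -(@line_int_const_except _ phi y x (Re p)) ?(ltW yp) ?(ltW px)//; last 2 first.
  - by move=> z /andP[_ zx] zp; apply: dphi => //; exact: Cexp_neq_Re.
  - by move=> s; apply: cphi => /=; exact: ltW.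
  rewrite (_ : _ * e = 2 * ((`|B| + normc (psi p)) * e) * (pi *+ 2)); last by ring.
  apply: line_int_bound => [s|s _].
    by apply: cphi.
  have zp : Cexp (y +i* s) != Cexp p by apply: Cexp_neq_Re; rewrite lt_eqF.
  rewrite /phi (negbTE zp) normcM /ckernel normcM normcV normc_Cexp/=.
  have gap := Cexp_sub_ge (y +i* s) p; rewrite normcB /= in gap.
  have n0 : 0 < normc (Cexp (y +i* s) - Cexp p).
    by rewrite (lt_le_trans _ gap)// subr_gt0 ltr_expR.
  have k1 : expR y / normc (Cexp (y +i* s) - Cexp p) <= e.
    rewrite ler_pdivrMr// (le_trans _ (ler_wpM2l (ltW e0) gap))//.
    by rewrite mulrBr lerBrDr; move: eye; rewrite mulrDr mulr1 (mulrC _ e) (mulrC _ e).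
  rewrite ler_pM ?normc_ge0 ?divr_ge0 ?expR_ge0 ?normc_ge0//.
  rewrite (le_trans (le_normc_sub _ _))// lerD2r.
  by rewrite (le_trans (bpsi _ _))// ler_norm.
have -> : line_int (fun z => psi z * ckernel p z) x =
    line_int (fun z => phi z - (- psi p) * ckernel p z) x.
  apply: eq_line_int => y; rewrite /phi (negbTE (Cexp_neq_Re _)) ?gt_eqF//; ring.
have ck y : ccont (ckernel p) (x +i* y).
  by apply/cdiff_cont/cdiff_ckernel/Cexp_neq_Re; rewrite gt_eqF.
rewrite line_intB; last 2 first.
- by move=> y; exact: cphi.
- by move=> y; apply: ccontM => //; exact/cdiff_cont/cdiff_cst.
by rewrite line_intZ// phi0 line_int_ckernel// mulNr opprK add0r mulrC.
Qed.

End CauchyHalfPlane.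

(** * Expansion in powers of the exponential *)

Section HalfPlaneSeries.
Context {R : realType}.
Local Notation C := R[i].
Local Notation Re := complex.Re.
Local Notation Im := complex.Im.
Implicit Types (psi : C -> C) (x : R) (z p : C).

Lemma ler_dist_normc (u v : C) : `|normc u - normc v| <= normc (u - v).
Proof.
have := le_normcB u v; have := le_normcB v u; rewrite (normcB v u) ler_norml => ? ?.
by apply/andP; split; lra.
Qed.

Lemma line_bounded psi x : twopii_periodic psi -> (forall y, ccont psi (x +i* y)) ->
  exists M, forall y, normc (psi (x +i* y)) <= M.
Proof.
move=> pp c.
have cg : continuous (fun y : R => normc (psi (x +i* y))).
  move=> y; apply/cvgrPdist_lt => e e0; have [d d0 Hd] := pcont_line c y e0.
  apply/nbhs_ballP; exists d => //= s; rewrite /ball/= distrC => /Hd.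
  apply: le_lt_trans; rewrite distrC; exact: ler_dist_normc.
have [y0 _ Hy0] := EVT_max (ltW (@twopi_gt0 R)) (continuous_subspaceT cg).
exists (normc (psi (x +i* y0))) => y.
have [n /andP[n0 n1]] := mod_period y (@twopi_gt0 R).
rewrite -(periodic_int pp (- n)) mulrNz twopii_mulz complexB subr0.
by apply: Hy0; rewrite in_itv/= n0 ltW.
Qed.

(** Expand the kernel of Cauchy's formula in a geometric series in [Cexp (p - z)].
    A downward closed set [D] of abscissas covers half-planes and the whole plane at
    once. The partial sums are kept explicit, with their rate of convergence. *)
Lemma half_plane_series psi (D : set R) (xr x1 B : R) : twopii_periodic psi ->
  (forall x y, x <= y -> D y -> D x) -> D xr ->
  (forall z, D (Re z) -> cdiff psi z) ->
  (forall z, Re z <= x1 -> normc (psi z) <= B) ->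
  exists c : nat -> C,
    (forall x B' n, D x -> (forall y, normc (psi (x +i* y)) <= B') ->
       normc (c n) * expR x ^+ n <= 2 * B') /\
    (forall p x, Re p < x -> D x -> exists K, forall N,
       normc (psi p - \sum_(n < N) c n * Cexp p ^+ n) <= K * expR (Re p - x) ^+ N).
Proof.
move=> pp Ddown Dxr dpsi bpsi.
pose g n z := psi z * Cexp (- z) ^+ n.
have dexpN q n z : cdiff (fun z => Cexp (q - z) ^+ n) z.
  rewrite (_ : (fun z => _) = fun z => Cexp (n%:R * q + (- n%:R) * z)).
    by apply: (@cdiff_comp _ (fun z => n%:R * q + - n%:R * z)); [exact: cdiff_lin|exact: cdiff_Cexp].
  by apply/funext => w; rewrite -Cexp_natmul; congr Cexp; ring.
have dg n z : D (Re z) -> cdiff (g n) z.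
  move=> zx2; apply: cdiffM; first exact: dpsi.
  rewrite (_ : (fun w : C => Cexp (- w) ^+ n) = fun w => Cexp (0 - w) ^+ n) //.
  by apply/funext => w; rewrite sub0r.
have pg n : twopii_periodic (g n).
  move=> z; rewrite /g pp; congr (_ * _ ^+ _).
  by rewrite opprD CexpB Cexp_twopii divr1.
pose c n := (pi *+ 2)%:C^-1 * line_int (g n) xr.
have T0 : (pi *+ 2)%:C != 0 :> C.
  by rewrite -normc_eq0 normc_real gtr0_norm ?gt_eqF// twopi_gt0.
have cE x n : D x -> (pi *+ 2)%:C * c n = line_int (g n) x.
  move=> xx2; rewrite /c (mulVKf T0); case: (leP x xr) => xx.
    rewrite -(@line_int_const _ (g n) x xr)// => z /andP[_ zx].
    by apply: dg; exact: Ddown Dxr.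
  apply: line_int_const => //; first exact: ltW.
  by move=> z /andP[_ zx]; apply: dg; exact: Ddown xx2.
exists c; split.
  move=> x B' n xx2 HB.
  have : normc (line_int (g n) x) <= 2 * (B' / expR x ^+ n) * (pi *+ 2).
    apply: line_int_bound => [y|y _]; first by apply/cdiff_cont/dg.
    rewrite /g normcM normcX normc_Cexp/= expRN exprVn.
    by rewrite ler_wpM2r// invr_ge0 exprn_ge0// expR_ge0.
  rewrite -(cE x)// normcM normc_real gtr0_norm ?twopi_gt0// mulrC.
  rewrite ler_pM2r ?twopi_gt0// mulrA ler_pdivlMr//.
  by rewrite exprn_gt0// expR_gt0.
move=> p x px xx2.
pose h N z := psi z * (Cexp (p - z) ^+ N * ckernel p z).
have dpsix z : Re z <= x -> cdiff psi z by move=> zx; apply: dpsi; exact: Ddown xx2.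
have zp y : Cexp (x +i* y) != Cexp p by apply: Cexp_neq_Re; rewrite gt_eqF.
have ch N y : ccont (h N) (x +i* y).
  apply: cdiff_cont; apply: cdiffM; first exact: dpsi.
  by apply: cdiffM; [exact: dexpN | exact: cdiff_ckernel].
have key N : line_int (h N) x = (pi *+ 2)%:C * (psi p - \sum_(n < N) c n * Cexp p ^+ n).
  elim: N => [|N IH].
    rewrite big_ord0 subr0 -(cauchy_half_plane pp dpsix bpsi px).
    by apply: eq_line_int => y; rewrite /h expr0 mul1r.
  rewrite big_ord_recr/= opprD addrA mulrBr -IH.
  rewrite mulrA (cE x)// mulrC -line_intZ; last first.
    by move=> y; exact/cdiff_cont/dg.
  rewrite -line_intB//; last first.
    move=> y; apply: ccontM; first exact/cdiff_cont/cdiff_cst.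
    exact/cdiff_cont/dg.
  apply: eq_line_int => y; rewrite /h /g /ckernel.
  have -> : Cexp (p - (x +i* y)) = Cexp p / Cexp (x +i* y) by rewrite CexpB.
  have -> : Cexp (- (x +i* y)) = (Cexp (x +i* y))^-1.
    by rewrite -[- _]sub0r CexpB Cexp0 mul1r.
  have e0 := Cexp_neq0 (x +i* y).
  have e1 : Cexp (x +i* y) - Cexp p != 0 by rewrite subr_eq0.
  rewrite exprS exprMn; move: (_^-1 ^+ N) (Cexp p ^+ N) => b a.
  by field; rewrite e0 e1.
have [M HM] : exists M, forall y, normc (psi (x +i* y)) <= M.
  by apply: line_bounded => // y; exact/cdiff_cont/dpsi.
exists (2 * (M * (expR x / (expR x - expR (Re p))))) => N.
have gap0 : 0 < expR x - expR (Re p) by rewrite subr_gt0 ltr_expR.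
have : normc (line_int (h N) x) <=
    2 * (M * (expR (Re p - x) ^+ N * (expR x / (expR x - expR (Re p))))) * (pi *+ 2).
  apply: line_int_bound => // y _; rewrite /h !normcM.
  rewrite ler_pM ?mulr_ge0 ?normc_ge0// normcX normc_Cexp/=.
  have -> : complex.Re (p - (x +i* y)) = Re p - x by case: (p).
  rewrite ler_wpM2l ?exprn_ge0 ?expR_ge0// normcV normc_Cexp/=.
  have ge := Cexp_sub_ge p (x +i* y); rewrite /= in ge.
  have n0 := lt_le_trans gap0 ge.
  by apply: (ler_wpM2l (expR_ge0 x)); rewrite (lef_pV2 n0 gap0).
rewrite key normcM normc_real gtr0_norm ?twopi_gt0// mulrC ler_pM2r ?twopi_gt0//.
by move=> /le_trans; apply; rewrite le_eqVlt; apply/orP; left; apply/eqP; ring.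
Qed.

End HalfPlaneSeries.

(** * Power series *)

Section PowerSeries.
Context {R : realType}.
Local Notation C := R[i].
Implicit Types (c : nat -> C) (h w : C) (K rho theta : R).

Definition ppart c h N := \sum_(n < N) c n * h ^+ n.
Definition pser c h : C := lim ((ppart c h : nat -> C^o) @ \oo).
Definition coef_bound c rho K := forall n, normc (c n) * rho ^+ n <= K.

Lemma expr_small theta e : 0 <= theta < 1 -> 0 < e -> \forall N \near \oo, theta ^+ N < e.
Proof.
move=> /andP[t0 t1] e0.
have : (theta ^+ n @[n --> \oo] --> 0) by apply: cvg_expr; rewrite ger0_norm.
move=> /cvgrPdist_lt/(_ _ e0); apply: filterS => n.
by rewrite sub0r normrN ger0_norm ?exprn_ge0.
Qed.

Lemma rate_cvg (u : nat -> C) (s : C) K theta : 0 <= theta < 1 ->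
  (forall N, normc (s - u N) <= K * theta ^+ N) -> (u : nat -> C^o) @ \oo --> (s : C^o).
Proof.
move=> t H; apply/cvg_normc => e e0.
have K0 : 0 < `|K| + 1 by rewrite ltr_wpDl.
have := expr_small t (divr_gt0 e0 K0); apply: filterS => N.
rewrite ltr_pdivlMr// => tN; rewrite normcB (le_lt_trans (H N))//.
rewrite (le_lt_trans _ tN)// mulrC ler_wpM2l//.
  by rewrite exprn_ge0//; case/andP: t.
by rewrite (le_trans (ler_norm K))// lerDl.
Qed.

Lemma pser_eq c h s K theta : 0 <= theta < 1 ->
  (forall N, normc (s - ppart c h N) <= K * theta ^+ N) -> pser c h = s.
Proof.
by move=> t H; apply: (@cvg_lim C^o (@norm_hausdorff C C^o)); exact: rate_cvg H.
Qed.

Lemma real_rate_limit (u : nat -> R) (b : nat -> R) :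
  (forall N M, (N <= M)%N -> `|u M - u N| <= b N) -> (forall N, 0 <= b N) ->
  exists l, forall N, `|l - u N| <= b N.
Proof.
move=> H b0.
have cross N M : u N - b N <= u M + b M.
  case/orP: (leq_total N M) => NM.
    by have := H _ _ NM; have := b0 M; rewrite ler_norml => ? /andP[]; lra.
  by have := H _ _ NM; have := b0 N; rewrite ler_norml => ? /andP[]; lra.
have hs : has_sup (range (fun N => u N - b N)).
  split; first by exists (u 0%N - b 0%N), 0%N.
  by exists (u 0%N + b 0%N) => _ [N _ <-]; exact: cross.
exists (sup (range (fun N => u N - b N))) => N; rewrite ler_norml.
have : u N - b N <= sup (range (fun N => u N - b N)).
  by apply: ub_le_sup; [exact: hs.2 | exists N].
have : sup (range (fun N => u N - b N)) <= u N + b N.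
  by apply: ge_sup; [exact: hs.1 | move=> _ [M _ <-]; exact: cross].
by move=> ? ?; apply/andP; split; lra.
Qed.

Lemma geom_sum_le theta N : 0 <= theta < 1 -> \sum_(n < N) theta ^+ n <= (1 - theta)^-1.
Proof.
move=> /andP[t0 t1]; have t10 : 0 < 1 - theta by rewrite subr_gt0.
rewrite -[leRHS]mul1r ler_pdivlMr// mulrC.
have -> : (1 - theta) * \sum_(n < N) theta ^+ n = 1 - theta ^+ N.
  by rewrite -[LHS]opprK -mulNr opprB -subrX1 opprB.
by rewrite gerBl exprn_ge0.
Qed.

Lemma ppart_tail c h rho K theta : 0 <= theta < 1 -> 0 < rho -> coef_bound c rho K ->
  normc h <= theta * rho -> forall N M, (N <= M)%N ->
  normc (ppart c h M - ppart c h N) <= K / (1 - theta) * theta ^+ N.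
Proof.
move=> t r0 cK hr N M NM; have /andP[t0 t1] := t.
have K0 : 0 <= K by rewrite (le_trans _ (cK 0%N))// mulr_ge0 ?normc_ge0.
rewrite /ppart -!(big_mkord xpredT (fun n => c n * h ^+ n)).
rewrite (big_cat_nat (leq0n N) NM)/= addrAC subrr add0r.
rewrite (le_trans (normc_sum _ _ _))//.
rewrite -{1}[N]add0n big_addn big_mkord.
apply: (@le_trans _ _ (\sum_(n < M - N) K * theta ^+ N * theta ^+ n)).
  apply: ler_sum => i _; rewrite normcM normcX -mulrA -exprD addnC.
  apply: (@le_trans _ _ (normc (c (N + i)%N) * (theta * rho) ^+ (N + i))).
    by rewrite ler_wpM2l ?normc_ge0// lerXn2r// nnegrE ?normc_ge0// mulr_ge0// ltW.
  by rewrite exprMn mulrCA mulrC ler_wpM2r// exprn_ge0.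
rewrite -mulr_sumr mulrAC ler_wpM2r// ?exprn_ge0// ler_wpM2l//.
exact: geom_sum_le.
Qed.

Lemma pser_tail c h rho K theta : 0 <= theta < 1 -> 0 < rho -> coef_bound c rho K ->
  normc h <= theta * rho -> forall N,
  normc (pser c h - ppart c h N) <= 2 * (K / (1 - theta)) * theta ^+ N.
Proof.
move=> t r0 cK hr; have /andP[t0 t1] := t.
have K0 : 0 <= K by rewrite (le_trans _ (cK 0%N))// mulr_ge0 ?normc_ge0.
pose b N := K / (1 - theta) * theta ^+ N.
have b0 N : 0 <= b N by rewrite mulr_ge0 ?exprn_ge0// divr_ge0// subr_ge0 ltW.
have tl := ppart_tail t r0 cK hr.
have [l1 H1] : exists l, forall N, `|l - complex.Re (ppart c h N)| <= b N.
  apply: real_rate_limit => // N M /tl; apply: le_trans.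
  by apply: le_trans (normc_Re _); case: (ppart c h M) (ppart c h N) => ? ? [].
have [l2 H2] : exists l, forall N, `|l - complex.Im (ppart c h N)| <= b N.
  apply: real_rate_limit => // N M /tl; apply: le_trans.
  by apply: le_trans (normc_Im _); case: (ppart c h M) (ppart c h N) => ? ? [].
have H N : normc (l1 +i* l2 - ppart c h N) <= 2 * (K / (1 - theta)) * theta ^+ N.
  rewrite (le_trans (le_normc_ReIm _))// -mulrA mulr2n mulrDl mul1r.
  by move: (H1 N) (H2 N); case: (ppart c h N) => ? ? /= ? ?; exact: lerD.
by move=> N; rewrite (pser_eq t H).
Qed.

Lemma pser_cvg c h rho K : coef_bound c rho K -> normc h < rho ->
  (ppart c h : nat -> C^o) @ \oo --> (pser c h : C^o).
Proof.
move=> cK hr; have r0 : 0 < rho by rewrite (le_lt_trans (normc_ge0 h)).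
have t : 0 <= normc h / rho < 1.
  by rewrite divr_ge0 ?normc_ge0 ?(ltW r0)//= ltr_pdivrMr// mul1r.
by apply: (rate_cvg t); apply: (pser_tail t r0 cK); rewrite divfK// gt_eqF.
Qed.

Lemma pser_poly c J w : (forall n, (J <= n)%N -> c n = 0) -> pser c w = ppart c w J.
Proof.
move=> c0; apply: (@cvg_lim C^o (@norm_hausdorff C C^o)).
apply: cvg_near_cst; exists J => // N /= JN.
rewrite /ppart -!(big_mkord xpredT (fun n => c n * w ^+ n)).
rewrite (big_cat_nat (leq0n _) JN)/= [X in _ + X = _](_ : _ = 0) ?addr0//.
by rewrite big_nat_cond big1// => n; rewrite andbT => /andP[Jn _]; rewrite c0 ?mul0r.
Qed.

(** Coefficients of the derived power series. *)
Definition dcoef c n := n.+1%:R * c n.+1.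

(** Each of the first [m] powers of [theta] is at least [theta ^+ m]. *)
Lemma natmul_expr_le theta m : 0 <= theta < 1 -> m%:R * theta ^+ m <= (1 - theta)^-1.
Proof.
move=> t; apply: le_trans (geom_sum_le m t); have /andP[t0 t1] := t.
rewrite -[m in m%:R]card_ord -sum1_card natr_sum mulr_suml.
apply: ler_sum => i _; rewrite mul1r ler_wiXn2l ?(ltW t1)//.
exact: ltnW.
Qed.

Lemma normc_nat n : normc (n%:R : C) = n%:R.
Proof. by rewrite -[n%:R](rmorph_nat (real_complex R)) normc_real ger0_norm. Qed.

Lemma coef_bound_dcoef c rho K sigma : 0 < sigma < rho -> coef_bound c rho K ->
  coef_bound (dcoef c) sigma (K * (1 - sigma / rho)^-1 / sigma).
Proof.
move=> /andP[s0 sr] cK; have r0 := lt_trans s0 sr.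
have K0 : 0 <= K by rewrite (le_trans _ (cK 0%N))// mulr_ge0 ?normc_ge0.
have t : 0 <= sigma / rho < 1 by rewrite divr_ge0 ?ltW//= ltr_pdivrMr// mul1r.
move=> n; rewrite /dcoef normcM normc_nat.
rewrite ler_pdivlMr// -[_ * sigma]mulrA -exprSr.
have -> : sigma ^+ n.+1 = (sigma / rho) ^+ n.+1 * rho ^+ n.+1.
  by rewrite -exprMn divfK// gt_eqF.
rewrite mulrACA [leLHS]mulrC.
apply: ler_pM => //; last exact: natmul_expr_le.
  by rewrite mulr_ge0 ?normc_ge0 ?exprn_ge0// ltW.
by rewrite mulr_ge0 ?exprn_ge0//; case/andP: t.
Qed.

(** The constant is a coefficient of the second derivative, so that the remainders
    of the terms of a power series sum up to a bound in terms of [dcoef (dcoef c)]. *)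
Lemma monomial_remainder h w sigma n : normc h <= sigma -> normc w <= sigma ->
  normc (w ^+ n.+2 - h ^+ n.+2 - n.+2%:R * h ^+ n.+1 * (w - h)) <=
  n.+2%:R * n.+1%:R * sigma ^+ n * normc (w - h) ^+ 2.
Proof.
move=> hs ws; have s0 := le_trans (normc_ge0 h) hs.
have n0 := sqr_ge0 (normc (w - h)).
elim: n => [|n IH].
  have -> : w ^+ 2 - h ^+ 2 - 2 * h ^+ 1 * (w - h) = (w - h) ^+ 2 by ring.
  by rewrite normcX expr0 mulr1 mulr1 ler_peMl// ler1n.
have -> : w ^+ n.+3 - h ^+ n.+3 - n.+3%:R * h ^+ n.+2 * (w - h) =
  w * (w ^+ n.+2 - h ^+ n.+2 - n.+2%:R * h ^+ n.+1 * (w - h)) +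
  n.+2%:R * h ^+ n.+1 * (w - h) ^+ 2.
  by rewrite -[n.+3%:R]natr1 !exprS; ring.
rewrite (le_trans (le_normcD _ _))// !normcM !normcX normc_nat.
apply: (@le_trans _ _ (sigma * (n.+2%:R * n.+1%:R * sigma ^+ n * normc (w - h) ^+ 2) +
    n.+2%:R * sigma ^+ n.+1 * normc (w - h) ^+ 2)).
  apply: lerD; first by rewrite ler_pM ?normc_ge0.
  rewrite ler_wpM2r// ler_wpM2l// lerXn2r// nnegrE ?normc_ge0//.
rewrite ![sigma ^+ n.+1]exprS -[n.+3%:R]natr1 -[n.+2%:R]natr1 -[n.+1%:R]natr1.
have : 0 <= sigma * sigma ^+ n * normc (w - h) ^+ 2.
  by rewrite mulr_ge0// mulr_ge0// exprn_ge0.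
have : 0 <= n%:R :> R by [].
set T := normc (w - h) ^+ 2; set S := sigma ^+ n; move: (n%:R) => m m0 ST.
rewrite -subr_ge0 (_ : _ - _ = (m + 1 + 1) * (sigma * S * T)); last by ring.
by rewrite mulr_ge0// !addr_ge0.
Qed.

(** The remainders of the terms add up to a quadratic remainder, uniformly on the
    disc of radius [sigma]. Each passage to derived coefficients shrinks the radius,
    whence the chain [sigma < tau < tau' < rho]. *)
Lemma pser_deriv c h rho K : coef_bound c rho K -> normc h < rho ->
  cderiv (pser c) h (pser (dcoef c) h).
Proof.
move=> cK hr; pose sigma := (normc h + rho) / 2; pose tau := (sigma + rho) / 2.
have h0 := normc_ge0 h.
have hs : normc h < sigma by rewrite /sigma ltr_pdivlMr//; lra.
have st : sigma < tau by rewrite /tau /sigma ltr_pdivlMr//; lra.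
have tr : tau < rho by rewrite /tau /sigma ltr_pdivrMr//; lra.
have s0 := le_lt_trans h0 hs; have t0 := lt_trans s0 st.
have r0 := lt_trans t0 tr.
pose tau' := (tau + rho) / 2.
have tt : tau < tau' < rho.
  by rewrite /tau' ltr_pdivlMr// ltr_pdivrMr//; apply/andP; split; lra.
have [K1 dK1] : exists K1, coef_bound (dcoef c) tau' K1.
  by eexists; apply: coef_bound_dcoef cK; case/andP: tt => [/(lt_trans t0) -> ->].
have [K2 dK2] : exists K2, coef_bound (dcoef (dcoef c)) tau K2.
  by eexists; apply: coef_bound_dcoef dK1; case/andP: tt => [-> _]; rewrite t0.
have K20 : 0 <= K2 by rewrite (le_trans _ (dK2 0%N))// mulr_ge0 ?normc_ge0.
pose X := K2 * (1 - sigma / tau)^-1.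
have th : 0 <= sigma / tau < 1 by rewrite divr_ge0 ?ltW//= ltr_pdivrMr// mul1r.
have X0 : 0 <= X by rewrite mulr_ge0// invr_ge0 subr_ge0 ltW//; case/andP: th.
have quad w : normc w < sigma ->
    normc (pser c w - pser c h - pser (dcoef c) h * (w - h)) <= X * normc (w - h) ^+ 2.
  move=> ws; apply/ler_addgt0Pr => e e0.
  have c1 := pser_cvg cK (lt_trans ws (lt_trans st tr)).
  have c2 := pser_cvg cK hr.
  have c3 : (ppart (dcoef c) h : nat -> C^o) @ \oo --> (pser (dcoef c) h : C^o).
    by apply: pser_cvg dK1 _; case/andP: tt => tt _; rewrite (lt_trans hs)// (lt_trans st).
  have shift2 (u : nat -> C^o) (l : C^o) : u @ \oo --> l -> (fun n => u n.+2) @ \oo --> l.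
    by move=> ul; have := ul; rewrite -(cvg_shiftn 2) => H; move: H; under eq_fun do rewrite addn2.
  have shift1 (u : nat -> C^o) (l : C^o) : u @ \oo --> l -> (fun n => u n.+1) @ \oo --> l.
    by move=> ul; have := ul; rewrite -(cvg_shiftn 1) => H; move: H; under eq_fun do rewrite addn1.
  pose v N : C := ppart c w N.+2 - ppart c h N.+2 - ppart (dcoef c) h N.+1 * (w - h).
  have cv : (v : nat -> C^o) @ \oo -->
      (pser c w - pser c h - pser (dcoef c) h * (w - h) : C^o).
    apply: (@cvgB _ C^o); first by apply: (@cvgB _ C^o); exact: shift2.
    by apply: cvgM; [exact: shift1 | exact: cvg_cst].
  have vb N : normc (v N) <= X * normc (w - h) ^+ 2.
    have -> : v N = \sum_(n < N) c n.+2 * (w ^+ n.+2 - h ^+ n.+2 - n.+2%:R * h ^+ n.+1 * (w - h)).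
      rewrite /v /ppart !big_ord_recl/= !expr0 !mulr1 /dcoef mul1r.
      rewrite (_ : _ - _ - _ = \sum_(i < N) c i.+2 * w ^+ i.+2 - \sum_(i < N) c i.+2 * h ^+ i.+2
         - (\sum_(i < N) i.+2%:R * c i.+2 * h ^+ i.+1) * (w - h)).
        rewrite mulr_suml -!sumrB; apply: eq_bigr => i _; ring.
      rewrite /bump/= !expr1; set A := \sum_(i < N) _; set A' := \sum_(i < N) _; set A'' := \sum_(i < N) _.
      ring.
    rewrite (le_trans (normc_sum _ _ _))//.
    apply: (@le_trans _ _ (\sum_(n < N) K2 * (sigma / tau) ^+ n * normc (w - h) ^+ 2)).
      apply: ler_sum => n _; rewrite normcM.
      apply: (@le_trans _ _ (normc (c n.+2) * (n.+2%:R * n.+1%:R * sigma ^+ n * normc (w - h) ^+ 2))).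
        rewrite ler_wpM2l ?normc_ge0//; apply: monomial_remainder; exact: ltW.
      rewrite mulrA ler_wpM2r ?sqr_ge0//.
      have := dK2 n; rewrite /dcoef !normcM !normc_nat => dn.
      rewrite [leLHS](_ : _ = n.+1%:R * (n.+2%:R * normc (c n.+2)) * sigma ^+ n); last by ring.
      have {1}-> : sigma = tau * (sigma / tau) by rewrite mulrC divfK// gt_eqF.
      by rewrite exprMn [leLHS]mulrA ler_wpM2r// exprn_ge0//; case/andP: th.
    rewrite -mulr_suml ler_wpM2r ?sqr_ge0// -mulr_sumr ler_wpM2l//.
    exact: geom_sum_le.
  have /cvg_normc/(_ _ e0)[N _ /(_ N)] := cv => /(_ (leqnn _)) vN.
  rewrite -[X in normc X](subrK (v N)) (le_trans (le_normcD _ _))// addrC lerD//.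
  by rewrite normcB ltW.
apply/cderivP => e e0; exists (Num.min (sigma - normc h) (e / (X + 1))).
  by rewrite lt_min subr_gt0 hs divr_gt0// ltr_wpDl.
move=> w; rewrite lt_min => /andP[w1 w2].
have ws : normc w < sigma.
  by rewrite -[w](subrK h) (le_lt_trans (le_normcD _ _))// -ltrBrDr.
rewrite (le_trans (quad w ws))// expr2 mulrA ler_wpM2r ?normc_ge0//.
have X1 : 0 < X + 1 by rewrite ltr_wpDl.
move: w2; rewrite ltr_pdivlMr// => w2.
rewrite (le_trans _ (ltW w2))// mulrC ler_wpM2l ?normc_ge0// lerDl//.
Qed.

End PowerSeries.

(** * Expansions on discs *)

Section Taylor.
Context {R : realType}.
Local Notation C := R[i].
Local Notation Re := complex.Re.
Implicit Types (F : C -> C) (c : nat -> C) (h w q : C) (r rho K : R).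

Lemma pser0 c : pser c 0 = c 0%N.
Proof.
apply: (@pser_eq _ _ _ _ (normc (c 0%N)) 0); first by rewrite lexx ltr01.
case=> [|N]; first by rewrite /ppart big_ord0 subr0 expr0 mulr1.
rewrite /ppart big_ord_recl/= expr0 mulr1 big1 ?addr0 ?subrr ?normc0//.
  by rewrite expr0n mulr0.
by move=> i _; rewrite expr0n mulr0.
Qed.

Lemma ccont_eq f g (z : C) d : ccont f z -> ccont g z -> 0 < d ->
  (forall w, w != z -> normc (w - z) < d -> f w = g w) -> f z = g z.
Proof.
move=> cf cg d0 fg; apply/eqP; rewrite -subr_eq0; apply/eqP.
apply: (@normc_small0 _ _ 2) => e e0 _.
have [d1 d10 H1] := cf e e0; have [d2 d20 H2] := cg e e0.
(* a single point close to [z] is enough for the comparison *)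
pose t := Num.min d (Num.min d1 d2) / 2.
have t0 : 0 < t by rewrite divr_gt0// !lt_min d0 d10.
have tlt : t < Num.min d (Num.min d1 d2).
  by rewrite ltr_pdivrMr// ltr_pMr ?ltr1n// !lt_min d0 d10.
move: tlt; rewrite !lt_min => /andP[td /andP[t1 t2]].
have tn : normc (z + t%:C - z) = t by rewrite addrAC subrr add0r normc_real gtr0_norm.
have := H1 (z + t%:C); rewrite tn => /(_ t1) {}H1.
have := H2 (z + t%:C); rewrite tn => /(_ t2) {}H2.
have E : f (z + t%:C) = g (z + t%:C).
  apply: fg; last by rewrite tn.
  by rewrite -subr_eq0 addrAC subrr add0r -normc_gt0 normc_real gtr0_norm.
rewrite (le_trans (le_normc_trans (f (z + t%:C)) _ _))// mulr2n mulrDl mul1r.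
by rewrite lerD//; [rewrite normcB ltW | rewrite E ltW].
Qed.

(** In the coordinate [h = Cexp z] a punctured disc is a half-plane, on which
    [F (q + Cexp z)] is periodic, and bounded far to the left when [F] is bounded near
    [q]. Its expansion in powers of [Cexp z] is the expansion of [F] at [q]; the
    singularity at [q] turns out to be removable. *)
Lemma punctured_taylor F q r s B : 0 < r -> 0 < s ->
  (forall h, 0 < normc h -> normc h < r -> cdiff F (q + h)) ->
  (forall h, 0 < normc h -> normc h < s -> normc (F (q + h)) <= B) ->
  exists c, [/\
    forall rho B', 0 < rho < r -> (forall h, normc h = rho -> normc (F (q + h)) <= B') ->
      coef_bound c rho (2 * B'),
    forall rho, 0 < rho < r -> exists K, coef_bound c rho K &
    forall h, 0 < normc h -> normc h < r -> F (q + h) = pser c h].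
Proof.
move=> r0 s0 dF bF; pose psi z := F (q + Cexp z).
have pp : twopii_periodic psi by move=> z; rewrite /psi Cexp_periodic.
have dpsi z : Re z < ln r -> cdiff psi z.
  move=> zr; apply: (@cdiff_comp _ (fun z => q + Cexp z)).
    by apply: cdiffD; [exact: cdiff_cst | exact: cdiff_Cexp].
  apply: dF; rewrite normc_Cexp ?expR_gt0//.
  by rewrite -(lnK (_ : r \is Num.pos)) ?posrE// ltr_expR.
have bpsi z : Re z <= ln (s / 2) -> normc (psi z) <= B.
  move=> zs; apply: bF; rewrite normc_Cexp ?expR_gt0//.
  have s2 : 0 < s / 2 by rewrite divr_gt0.
  apply: (@le_lt_trans _ _ (s / 2)); last by rewrite ltr_pdivrMr// ltr_pMr// ltr1n.
  by rewrite -[leRHS]lnK ?posrE// ler_expR.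
have Ddown (x y : R) : x <= y -> y < ln r -> x < ln r by exact: le_lt_trans.
have Dr : ln r - 1 < ln r by rewrite ltrBlDr ltrDl.
have [c [Hc1 Hc2]] :=
  @half_plane_series _ _ (fun x => x < ln r) _ _ _ pp Ddown Dr dpsi bpsi.
have bnd rho B' : 0 < rho < r -> (forall h, normc h = rho -> normc (F (q + h)) <= B') ->
      coef_bound c rho (2 * B').
  move=> /andP[rho0 rr] H n; rewrite -{1}(lnK (_ : rho \is Num.pos)) ?posrE//.
  apply: Hc1; first by rewrite ltr_ln ?posrE.
  by move=> y; apply: H; rewrite normc_Cexp/= lnK ?posrE.
exists c; split => //.
- move=> rho /andP[rho0 rr].
  have [M HM] : exists M, forall y, normc (psi (ln rho +i* y)) <= M.
    by apply: line_bounded => // y; apply/cdiff_cont/dpsi; rewrite /= ltr_ln ?posrE.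
  exists (2 * M); apply: bnd; first by rewrite rho0.
  move=> h hr; have h0 : h != 0 by rewrite -normc_gt0 hr.
  have [z zh] := Cexp_surj h0; rewrite -zh.
  have zr : Re z = ln rho by apply: (@expR_inj R); rewrite lnK ?posrE// -normc_Cexp zh.
  by have := HM (complex.Im z); rewrite -zr /psi; case: (z).
- move=> h h0 hr; have h0' : h != 0 by rewrite -normc_gt0.
  have [z zh] := Cexp_surj h0'.
  pose rho := (normc h + r) / 2.
  have hrho : normc h < rho by rewrite /rho ltr_pdivlMr//; lra.
  have rhor : rho < r by rewrite /rho ltr_pdivrMr//; lra.
  have rho0 := lt_trans h0 hrho.
  have Rez : expR (Re z) = normc h by rewrite -normc_Cexp zh.
  have zrho : Re z < ln rho by rewrite -ltr_expR lnK ?posrE// Rez.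
  have [|K HK] := Hc2 z (ln rho) zrho; first by rewrite ltr_ln ?posrE.
  symmetry; apply: (@pser_eq _ _ _ _ K (expR (Re z - ln rho))).
    by rewrite expR_ge0/= expR_lt1 subr_lt0.
  by move=> N; have := HK N; rewrite /psi zh.
Qed.

Lemma taylor F q r : 0 < r -> (forall h, normc h < r -> cdiff F (q + h)) ->
  exists c, [/\
    forall rho B', 0 < rho < r -> (forall h, normc h = rho -> normc (F (q + h)) <= B') ->
      coef_bound c rho (2 * B'),
    forall rho, 0 < rho < r -> exists K, coef_bound c rho K &
    forall h, normc h < r -> F (q + h) = pser c h].
Proof.
move=> r0 dF.
have cF : ccont F q by rewrite -[q]addr0; apply/cdiff_cont/dF; rewrite normc0.
have [s s0 Hs] := cF _ ltr01.
have [||c [H1 H2 H3]] := @punctured_taylor F q r s (1 + normc (F q)) r0 s0.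
- by move=> h _; exact: dF.
- move=> h _ hs; rewrite -[F (q + h)](subrK (F q)) (le_trans (le_normcD _ _))// lerD2r.
  by apply/ltW/Hs; rewrite addrAC subrr add0r.
exists c; split => // h hr.
have [h0|h0] := eqVneq h 0; last by apply: H3; rewrite ?normc_gt0.
rewrite h0; have r20 : 0 < r / 2 < r.
  by rewrite divr_gt0//= ltr_pdivrMr// ltr_pMr// ltr1n.
have [K HK] := H2 _ r20.
apply: (@ccont_eq (fun h => F (q + h)) (pser c) 0 r) => //.
- apply/cdiff_cont; apply: (@cdiff_comp _ (fun h => q + h)).
    by apply: cdiffD; [exact: cdiff_cst | exact: cdiff_id].
  by rewrite -[X in cdiff F (q + X)]/0; apply: dF; rewrite normc0.
- apply/cdiff_cont/cdiffP; exists (pser (dcoef c) 0).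
  by apply: pser_deriv HK _; rewrite normc0; case/andP: r20.
- by move=> w w0; rewrite subr0 => wr; apply: H3 => //; rewrite normc_gt0.
Qed.

Lemma coef_bound_iter c r m : (forall rho, 0 < rho < r -> exists K, coef_bound c rho K) ->
  forall rho, 0 < rho < r -> exists K, coef_bound (iter m dcoef c) rho K.
Proof.
move=> H; elim: m => // m IH rho /andP[rho0 rr].
have [|K HK] := IH ((rho + r) / 2).
  by rewrite ltr_pdivlMr// ltr_pdivrMr//; apply/andP; split; lra.
eexists; apply: (coef_bound_dcoef _ HK); rewrite rho0/= ltr_pdivlMr//; lra.
Qed.

Lemma pser_derive1n F q c r : (forall rho, 0 < rho < r -> exists K, coef_bound c rho K) ->
  (forall h, normc h < r -> F (q + h) = pser c h) ->
  forall m h, normc h < r ->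
    derive1n m (F : C^o -> C^o) (q + h) = pser (iter m dcoef c) h.
Proof.
move=> cK FE; elim=> [|m IH] h hr; first exact: FE.
rewrite derive1nS derive1E.
have h0 := normc_ge0 h.
have hr2 : normc h < (normc h + r) / 2 by rewrite ltr_pdivlMr//; lra.
have [|K HK] := coef_bound_iter m cK (rho := (normc h + r) / 2).
  rewrite (le_lt_trans h0 hr2)/= ltr_pdivrMr//; lra.
suff : cderiv (derive1n m (F : C^o -> C^o)) (q + h) (pser (iter m.+1 dcoef c) h).
  by move=> H; rewrite (@derive_val _ _ _ _ _ _ _ H).
apply: (@cderiv_near _ (fun w => pser (iter m dcoef c) (w - q))).
  exists (r - normc h); first by rewrite subr_gt0.
  move=> w wr; rewrite -IH; first by rewrite addrC subrK.
  rewrite (_ : w - q = (w - (q + h)) + h); last by ring.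
  by rewrite (le_lt_trans (le_normcD _ _))// -ltrBrDr.
rewrite -[X in cderiv _ _ X]mulr1; apply: (@cderiv_comp _ (fun w => w - q)).
  rewrite -[X in cderiv _ _ X]subr0; apply: cderivB; [exact: cderiv_id | exact: cderiv_cst].
rewrite addrAC subrr add0r; exact: pser_deriv HK hr2.
Qed.

Lemma iter_dcoef c m n : iter m dcoef c n = ((n + m) ^_ m)%:R * c (n + m)%N.
Proof.
elim: m n => [|m IH] n; first by rewrite addn0 ffactn0 mul1r.
rewrite iterS /dcoef IH mulrA -natrM addSnnS; congr (_%:R * _).
by rewrite ffactnSr mulnC; congr (_ * _)%N; rewrite -addSnnS addnK.
Qed.

(** The lowest nonzero term dominates near the centre. *)
Lemma pser_lower c rho K : 0 < rho -> coef_bound c rho K -> (exists n, c n != 0) ->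
  exists m (a d : R), [/\ 0 < a, 0 < d &
    forall h, normc h < d -> a * normc h ^+ m <= normc (pser c h)].
Proof.
move=> r0 cK ex; case: (ex_minnP ex) => m cm0 mmin.
have K0 : 0 <= K by rewrite (le_trans _ (cK 0%N))// mulr_ge0 ?normc_ge0.
have cm : 0 < normc (c m) by rewrite normc_gt0.
have rm : 0 < rho ^+ m.+1 by rewrite exprn_gt0.
pose d := Num.min (rho / 2) (normc (c m) * rho ^+ m.+1 / (8 * K + 1)).
have K8 : 0 < 8 * K + 1 by rewrite ltr_wpDl// mulr_ge0.
exists m, (normc (c m) / 2), d; split; first by rewrite divr_gt0.
  by rewrite lt_min !divr_gt0// mulr_gt0.
move=> h; rewrite /d lt_min => /andP[h1 h2].
have h0 := normc_ge0 h.
have t1 : normc h / rho <= 1 / 2 by rewrite ler_pdivrMr// mulrC mul1r ltW.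
have t : 0 <= normc h / rho < 1.
  by rewrite divr_ge0 ?(ltW r0)//= (le_lt_trans t1)//; lra.
have := pser_tail t r0 cK (_ : normc h <= normc h / rho * rho).
rewrite divfK ?gt_eqF// => /(_ (lexx _) m.+1).
have -> : ppart c h m.+1 = c m * h ^+ m.
  rewrite /ppart big_ord_recr/= big1 ?add0r// => i _.
  have [->|ci] := eqVneq (c i) 0; first by rewrite mul0r.
  by have := mmin i ci; rewrite leqNgt ltn_ord.
move=> T.
have {}T : normc (pser c h - c m * h ^+ m) <= normc (c m) / 2 * normc h ^+ m.
  apply: (le_trans T).
  have i2 : (1 - normc h / rho)^-1 <= 2.
    by rewrite -[leRHS]invrK lef_pV2 ?posrE ?invr_gt0//; lra.
  apply: (@le_trans _ _ (2 * (K * 2) * (normc h / rho) ^+ m.+1)).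
    by rewrite ler_wpM2r ?exprn_ge0 ?ler_wpM2l//; case/andP: t.
  have -> : 2 * (K * 2) * (normc h / rho) ^+ m.+1 =
      normc h ^+ m * (4 * K * normc h / rho ^+ m.+1).
    by rewrite expr_div_n [normc h ^+ m.+1]exprSr; move: (_^-1) => ?; ring.
  rewrite [leRHS]mulrC ler_wpM2l ?exprn_ge0// ler_pdivrMr//.
  move: h2; rewrite ltr_pdivlMr// => /ltW.
  have := mulr_ge0 h0 K0; lra.
have := le_normcB (c m * h ^+ m) (pser c h); rewrite normcB normcM normcX => T2.
by move: T T2; move: (normc h ^+ m) (normc (pser c h)) (normc _) => X P Q; lra.
Qed.

End Taylor.

(** * Limits of rescaled solutions *)

Section LimitAlongUltrafilter.
Context {R : realType}.
Local Notation C := R[i].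
Implicit Types (c : nat -> C) (h w : C) (rho K : R).

Section Ultra.
Variables (T : Type) (U : set_system T).
Context {UU : UltraFilter U}.

(** Limits along an ultrafilter replace the extraction of subsequences, which would
    have to be repeated for each Taylor coefficient. *)
Lemma ultra_real_limit (u : T -> R) K : (\forall t \near U, `|u t| <= K) ->
  exists l : R, u @ U --> l.
Proof.
move=> uK; have [|l [_ ul]] := @segment_compact R (- K) K (u @ U) _.
  by apply: filterS uK => t /=; rewrite in_itv/= ler_norml.
exists l => V Vl; have [//|UV] := in_ultra_setVsetC (u @^-1` V) UU.
by have [x [/= Vx]] := ul (~` V) V UV Vl.
Qed.

Lemma ultra_complex_limit (u : T -> C) K : (\forall t \near U, normc (u t) <= K) ->
  exists l : C, (u : T -> C^o) @ U --> (l : C^o).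
Proof.
move=> uK.
have [l1 H1] : exists l : R, (fun t => complex.Re (u t)) @ U --> l.
  apply: (@ultra_real_limit _ K); apply: filterS uK => t; apply: le_trans; exact: normc_Re.
have [l2 H2] : exists l : R, (fun t => complex.Im (u t)) @ U --> l.
  apply: (@ultra_real_limit _ K); apply: filterS uK => t; apply: le_trans; exact: normc_Im.
exists (l1 +i* l2); apply/(@cvg_normc R T U) => e e0.
have e20 : 0 < e / 2 by rewrite divr_gt0.
move/cvgrPdist_lt/(_ _ e20) : H1; move/cvgrPdist_lt/(_ _ e20) : H2.
apply: filterS2 => t; rewrite distrC => b2; rewrite distrC => b1.
rewrite (le_lt_trans (le_normc_ReIm _))// [e](splitr e).
by case: (u t) b1 b2 => ? ? /= ? ?; rewrite ltrD.
Qed.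

End Ultra.

Section ComplexLimits.
Variables (T : Type) (U : set_system T).
Context {UF : ProperFilter U}.
Implicit Types (u v : T -> C).

Lemma ccvgD u v (a b : C) : (u : T -> C^o) @ U --> (a : C^o) ->
  (v : T -> C^o) @ U --> (b : C^o) -> (fun t => u t + v t : C^o) @ U --> (a + b : C^o).
Proof. by move=> ua vb; exact: (cvgD ua vb). Qed.

Lemma ccvgM u v (a b : C) : (u : T -> C^o) @ U --> (a : C^o) ->
  (v : T -> C^o) @ U --> (b : C^o) -> (fun t => u t * v t : C^o) @ U --> (a * b : C^o).
Proof. by move=> ua vb; exact: (cvgM ua vb). Qed.

Lemma ccvg_cst (a : C) : (fun _ : T => a : C^o) @ U --> (a : C^o).
Proof. exact: cvg_cst. Qed.

Lemma ccvg_unique u (a b : C) : (u : T -> C^o) @ U --> (a : C^o) ->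
  (u : T -> C^o) @ U --> (b : C^o) -> a = b.
Proof. exact: (cvg_unique (@norm_hausdorff C C^o)). Qed.

End ComplexLimits.

Section Tannery.
Variables (T : Type) (U : set_system T).
Context {UF : ProperFilter U}.

(** A common coefficient bound makes the tails uniformly small, and the partial sums
    converge term by term. *)
Lemma tannery (b : T -> nat -> C) c rho K w : normc w < rho ->
  (\forall t \near U, coef_bound (b t) rho K) -> coef_bound c rho K ->
  (forall n, (fun t => b t n : C^o) @ U --> (c n : C^o)) ->
  (fun t => pser (b t) w : C^o) @ U --> (pser c w : C^o).
Proof.
move=> wr bK cK bc; have r0 := le_lt_trans (normc_ge0 w) wr.
pose theta := normc w / rho.
have t : 0 <= theta < 1.
  by rewrite divr_ge0 ?normc_ge0 ?(ltW r0)//= ltr_pdivrMr// mul1r.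
have wt : normc w <= theta * rho by rewrite /theta divfK// gt_eqF.
have cp N : (fun t => ppart (b t) w N : C^o) @ U --> (ppart c w N : C^o).
  elim: N => [|N IH].
    have -> : (fun t => ppart (b t) w 0) = fun=> ppart c w 0.
      by apply/funext => s; rewrite /ppart !big_ord0.
    exact: ccvg_cst.
  have -> : (fun t => ppart (b t) w N.+1) = fun t => ppart (b t) w N + b t N * w ^+ N.
    by apply/funext => s; rewrite /ppart big_ord_recr.
  rewrite [ppart c w N.+1](_ : _ = ppart c w N + c N * w ^+ N); last first.
    by rewrite /ppart big_ord_recr.
  apply: ccvgD; first exact: IH.
  by apply: ccvgM; [exact: bc | exact: ccvg_cst].
apply/(@cvg_normc R T U) => e e0.
pose X := 2 * (K / (1 - theta)).
have X0 : 0 < `|X| + 1 by rewrite ltr_wpDl.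
have e3X : 0 < e / 3 / (`|X| + 1) by rewrite !divr_gt0.
have [N _ /(_ N (leqnn _)) /= HN] := expr_small t e3X.
have {}HN : X * theta ^+ N < e / 3.
  move: HN; rewrite ltr_pdivlMr// mulrC; apply: le_lt_trans.
  rewrite ler_wpM2r ?exprn_ge0//; first by case/andP: t.
  by rewrite (le_trans (ler_norm X))// lerDl.
have e30 : 0 < e / 3 by rewrite divr_gt0.
move/(@cvg_normc R T U): (cp N) => /(_ _ e30) H.
apply: filterS2 bK H => s bs ps.
have T1 := pser_tail t r0 bs wt N; have T2 := pser_tail t r0 cK wt N.
rewrite -/X in T1 T2.
rewrite (le_lt_trans (le_normc_trans (ppart (b s) w N) _ _))//.
have := le_normc_trans (ppart c w N) (ppart (b s) w N) (pser c w).
by rewrite (normcB (ppart c w N) (pser c w)); lra.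
Qed.

End Tannery.

Lemma cvg_normc_le (T : Type) (U : set_system T) {UF : ProperFilter U} (u : T -> C) (l : C) K :
  (u : T -> C^o) @ U --> (l : C^o) -> (\forall t \near U, normc (u t) <= K) -> normc l <= K.
Proof.
move=> /(@cvg_normc R T U) ul uK; apply/ler_addgt0Pr => e /ul H.
have [t [t1 t2]] := filter_ex (filterI H uK).
rewrite -[l](subrK (u t)) (le_trans (le_normcD _ _))// addrC lerD//.
by rewrite normcB ltW.
Qed.

Lemma coef_bound_iter_unif m rho K sigma : 0 < sigma < rho ->
  exists K', forall c, coef_bound c rho K -> coef_bound (iter m dcoef c) sigma K'.
Proof.
elim: m sigma => [|m IH] sigma /andP[s0 sr].
  exists K => c cK n; apply: le_trans (cK n).
  by rewrite ler_wpM2l ?normc_ge0// lerXn2r// ?nnegrE ?ltW// (lt_trans s0).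
have [|K' HK'] := IH ((sigma + rho) / 2).
  by rewrite ltr_pdivlMr// ltr_pdivrMr//; apply/andP; split; lra.
eexists => c /HK' H; rewrite iterS; apply: coef_bound_dcoef H.
by rewrite s0/= ltr_pdivlMr//; lra.
Qed.

(** The leading term would dominate for large [t], so it vanishes, and the degree
    goes down. *)
Lemma bounded_poly_const c J : (forall t : R, 0 <= t -> normc (ppart c (- t%:C) J.+1) <= 1) ->
  forall n, (0 < n <= J)%N -> c n = 0.
Proof.
elim: J => [|J IH] H n; first by rewrite leqn0; case: n.
have cJ : c J.+1 = 0.
  apply/eqP; rewrite -normc_eq0; apply/negPn/negP => c0.
  have {}c0 : 0 < normc (c J.+1) by rewrite lt_neqAle eq_sym c0 normc_ge0.
  pose S := 2 + \sum_(i < J.+1) normc (c i).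
  have S0 : 0 < S by rewrite ltr_wpDr// sumr_ge0// => i _; exact: normc_ge0.
  pose t := S / normc (c J.+1) + 1.
  have t1 : 1 <= t by rewrite /t lerDr divr_ge0// ltW.
  have t0 : 0 < t by rewrite (lt_le_trans _ t1).
  have := H t (ltW t0); rewrite /ppart big_ord_recr/= => Ht.
  have nt : normc (- t%:C : C) = t by rewrite normcN normc_real gtr0_norm.
  have tail : normc (\sum_(i < J.+1) c i * (- t%:C) ^+ i) <= (S - 2) * t ^+ J.
    rewrite (le_trans (normc_sum _ _ _))// /S [2 + _]addrC addrK mulr_suml.
    apply: ler_sum => i _; rewrite normcM normcX nt ler_wpM2l ?normc_ge0//.
    by apply: ler_weXn2l => //; rewrite -ltnS.
  have := le_normcB (c J.+1 * (- t%:C) ^+ J.+1) (- \sum_(i < J.+1) c i * (- t%:C) ^+ i).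
  rewrite opprK addrC normcN normcM normcX nt => low.
  have tJ : 1 <= t ^+ J by rewrite exprn_ege1.
  have : normc (c J.+1) * t ^+ J.+1 <= (S - 1) * t ^+ J.
    by move: Ht low tail; rewrite [c J.+1 * _ + _]addrC; lra.
  rewrite exprS mulrA ler_pM2r ?(lt_le_trans _ tJ)//.
  by rewrite /t mulrDr mulr1 mulrCA divff ?gt_eqF// mulr1; lra.
move=> /andP[n0]; rewrite leq_eqVlt => /predU1P[->//|nJ].
apply: IH; last by rewrite n0.
move=> t t0; have := H t t0.
by rewrite {1}/ppart big_ord_recr/= cJ mul0r addr0.
Qed.

(** Here [c N] are the Taylor coefficients at 0 of a function on the disc of radius
    [N]. Along an ultrafilter the coefficients converge to those of an entire function
    [G] with [|G| <= 1] on the left half-plane, [G 0 = 1] and [|G (-1)| <= 1 / 2]. Since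
    [eta] tends to 0, a product of derivatives of [G] vanishes. By [pser_lower] the
    zeros of a nonzero power series are isolated, so one of these derivatives is zero
    and [G] is a polynomial; bounded on the negative axis, [G] is constant. *)
Lemma rescaled_limit_absurd (k d : nat) (j : 'I_d -> nat) (L : R)
    (c : nat -> nat -> C) (eta : nat -> C) :
  (forall N r : nat, (0 < r < N)%N -> coef_bound (c N) r%:R (2 * L ^+ (2 * r.+1))) ->
  (forall N w, complex.Re w <= 0 -> normc w < N%:R -> normc (pser (c N) w) <= 1) ->
  (forall N, (1 < N)%N -> normc (pser (c N) (-1)) <= 1 / 2) ->
  (forall N, c N 0%N = 1) ->
  (forall N w, normc w < N%:R ->
     \prod_(i < d) pser (iter (j i) dcoef (c N)) w =
     eta N * pser (iter k dcoef (c N)) w) ->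
  (eta : nat -> C^o) @ \oo --> (0 : C^o) -> False.
Proof.
move=> ca cc cd c0 cf eta0.
have [U [UU sU]] := ultraFilterLemma (@eventually_filter).
have near_big (m : nat) : \forall N \near U, (m < N)%N.
  by apply: sU; exists m.+1.
have ca' r : (0 < r)%N -> \forall N \near U, coef_bound (c N) r%:R (2 * L ^+ (2 * r.+1)).
  by move=> r0; apply: filterS (near_big r) => N rN; apply: ca; rewrite r0.
(* the coefficients of the limit function *)
have [b Hb] : {b : nat -> C & forall n, (fun N => c N n : C^o) @ U --> (b n : C^o)}.
  apply: (@choice _ _ (fun n l => (fun N => c N n : C^o) @ U --> (l : C^o))) => n.
  apply: ultra_complex_limit; apply: filterS (ca' 1%N isT) => N /(_ n).
  by rewrite expr1n mulr1; exact.
have ba r : (0 < r)%N -> coef_bound b r%:R (2 * L ^+ (2 * r.+1)).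
  move=> r0 n; have rn : 0 < r%:R ^+ n :> R by rewrite exprn_gt0// ltr0n.
  rewrite -ler_pdivlMr//; apply: (cvg_normc_le (Hb n)).
  by apply: filterS (ca' r r0) => N /(_ n); rewrite ler_pdivlMr.
have big (w : C) : exists r : nat, (0 < r)%N /\ normc w < r%:R.
  exists (Num.bound (normc w)).+1; split=> //.
  by rewrite (lt_trans (archi_boundP (normc_ge0 w)))// ltr_nat.
have cvgd m w : (fun N => pser (iter m dcoef (c N)) w : C^o) @ U -->
    (pser (iter m dcoef b) w : C^o).
  have [r [r0 wr]] := big w.
  pose sigma := (normc w + r%:R) / 2.
  have ws : normc w < sigma by rewrite /sigma ltr_pdivlMr//; lra.
  have sr : 0 < sigma < r%:R.
    by rewrite (le_lt_trans (normc_ge0 w) ws)/= /sigma ltr_pdivrMr//; lra.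
  have [K' HK'] := coef_bound_iter_unif m (2 * L ^+ (2 * r.+1)) sr.
  apply: (tannery ws (K := K')).
  - by apply: filterS (ca' r r0) => N; exact: HK'.
  - exact/HK'/ba.
  - move=> n; rewrite iter_dcoef.
    have -> : (fun N => iter m dcoef (c N) n) =
        fun N => ((n + m) ^_ m)%:R * c N (n + m)%N.
      by apply/funext => N; rewrite iter_dcoef.
    by apply: ccvgM; [exact: ccvg_cst | exact: Hb].
have prod0 w : \prod_(i < d) pser (iter (j i) dcoef b) w = 0.
  have l1 : (fun N => \prod_(i < d) pser (iter (j i) dcoef (c N)) w : C^o) @ U -->
     (\prod_(i < d) pser (iter (j i) dcoef b) w : C^o).
    elim: d j {cf} => [|d' IH] j'.
      rewrite big_ord0 (_ : (fun _ => _) = fun=> 1); first exact: ccvg_cst.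
      by apply/funext => N; rewrite big_ord0.
    rewrite big_ord_recr/= (_ : (fun _ => _) = fun N =>
      (\prod_(i < d') pser (iter (j' (widen_ord (leqnSn d') i)) dcoef (c N)) w) *
      pser (iter (j' ord_max) dcoef (c N)) w); last first.
      by apply/funext => N; rewrite big_ord_recr.
    by apply: ccvgM; [exact: (IH (fun i => j' (widen_ord (leqnSn d') i))) | exact: cvgd].
  have l2 : (fun N => \prod_(i < d) pser (iter (j i) dcoef (c N)) w : C^o) @ U --> (0 : C^o).
    have [r [r0 wr]] := big w.
    have l3 : (fun N => eta N * pser (iter k dcoef (c N)) w : C^o) @ U -->
        (0 * pser (iter k dcoef b) w : C^o).
      apply: ccvgM; last exact: cvgd.
      by move=> V /eta0; exact: sU.
    rewrite mul0r in l3; apply: cvg_trans l3; apply: near_eq_cvg.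
    apply: filterS (near_big r) => N rN; rewrite cf//.
    by rewrite (lt_trans wr)// ltr_nat.
  exact: (ccvg_unique l1 l2).
have [i bi] : exists i : 'I_d, forall n, iter (j i) dcoef b n = 0.
  apply: contrapT => /forallNP nz.
  have low (i : 'I_d) : exists e : R, 0 < e /\
      forall w, w != 0 -> normc w < e -> pser (iter (j i) dcoef b) w != 0.
    have /existsNP[n /eqP bn] := nz i.
    have [|K' HK'] := @coef_bound_iter_unif (j i) 1%:R (2 * L ^+ (2 * 2)) (1 / 2).
      by rewrite divr_gt0//= ltr_pdivrMr// mul1r ltr1n.
    have h2 : 0 < 1 / 2 :> R by rewrite divr_gt0.
    have [|m [a [e [a0 e0 He]]]] := pser_lower h2 (HK' b (ba 1%N isT)); first by exists n.
    exists e; split => // w w0 /He H; rewrite -normc_gt0 (lt_le_trans _ H)//.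
    by rewrite mulr_gt0// exprn_gt0// normc_gt0.
  have [e [e0 He]] : exists e : R, 0 < e /\ forall (i : 'I_d) w, w != 0 -> normc w < e ->
      pser (iter (j i) dcoef b) w != 0.
    have [e He] := choice low.
    exists (\big[Num.min/1]_(i < d) e i); split.
      by apply: lt_bigmin => // i _; case: (He i).
    move=> i w w0 we; apply: (He i).2 => //; apply: (lt_le_trans we).
    exact: bigmin_le_cond.
  have w0 : ((e / 2)%:C : C) != 0 by rewrite -normc_gt0 normc_real gtr0_norm divr_gt0.
  have := prod0 (e / 2)%:C; apply/eqP/prodf_neq0 => i _; apply: He => //.
  by rewrite normc_real gtr0_norm ?divr_gt0// ltr_pdivrMr// ltr_pMr// ltr1n.
pose J := j i.
have b0 n : (J <= n)%N -> b n = 0.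
  move=> Jn; have := bi (n - J)%N; rewrite iter_dcoef subnK// => /eqP.
  rewrite mulf_eq0 pnatr_eq0 -leqn0 leqNgt ffact_gt0 Jn/= => /eqP //.
have bpoly w : pser b w = ppart b w J.+1.
  by apply: pser_poly => n /ltnW; exact: b0.
have b1 : b 0%N = 1.
  apply: (ccvg_unique (Hb 0%N)).
  rewrite (_ : (fun _ => _) = fun=> 1); first exact: ccvg_cst.
  by apply/funext => N; rewrite c0.
have bn0 : forall n, (0 < n <= J)%N -> b n = 0.
  apply: bounded_poly_const => t t0; rewrite -bpoly.
  apply: (cvg_normc_le (cvgd 0%N (- t%:C))) => /=.
  have [r [_ tr]] := big (- t%:C).
  apply: filterS (near_big r) => N rN; apply: cc; first by rewrite /= oppr_le0.
  by rewrite (lt_trans tr)// ltr_nat.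
have : normc (pser b (-1)) <= 1 / 2.
  apply: (cvg_normc_le (cvgd 0%N (-1))) => /=.
  by apply: filterS (near_big 1%N) => N; exact: cd.
rewrite bpoly /ppart big_ord_recl/= expr0 mulr1 b1 big1 ?addr0.
  by rewrite normc1; lra.
by move=> n _; rewrite bn0 ?mul0r//= /bump/= add1n ltn_ord.
Qed.

End LimitAlongUltrafilter.

(** * Growth of periodic functions *)

Section GrowthTools.
Context {R : realType}.
Local Notation C := R[i].
Local Notation Re := complex.Re.
Implicit Types (F psi : C -> C) (c : nat -> C).

(** Start from an interval of length [k] over which [M] is multiplied by [L] or more,
    and halve the step [rho] as long as the conclusion fails. If
    [M (x + r * rho)] exceeds [L ^+ (2 * r) * M (x + rho)], then [M] is multiplied by more
    than [L] over one of the [2 * (r - 1)] half-steps in between, and the search goes on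
    from there. A round moves [x] by at most [N * rho], so [x] stays
    bounded, whereas [M x >= L ^+ n * M x0] after [n] rounds: the search ends. *)
Lemma growth_stop (M : R -> R) (x0 k L : R) (N : nat) : 0 < k -> 2 <= L ->
  (forall x y, x0 <= x -> x <= y -> M x <= M y) -> 0 < M x0 ->
  L * M x0 <= M (x0 + k) ->
  exists (n : nat) x, [/\ x0 <= x, L ^+ n * M x0 <= M x, L * M x <= M (x + k / 2 ^+ n) &
    forall r : nat, (0 < r <= N)%N ->
      M (x + r%:R * (k / 2 ^+ n)) <= L ^+ (2 * r) * M (x + k / 2 ^+ n)].
Proof.
move=> k0 L2 Mm M0 start; apply: contrapT => nstop.
have L0 : 0 < L by rewrite (lt_le_trans _ L2).
have L1 : 1 <= L by rewrite (le_trans _ L2)// ler1n.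
pose rho n := k / 2 ^+ n.
have rho0 n : 0 < rho n by rewrite divr_gt0// exprn_gt0.
have rhoS n : rho n = rho n.+1 + rho n.+1.
  by rewrite /rho exprS; field; rewrite expf_neq0.
have Mpos x : x0 <= x -> 0 < M x by move=> x0x; rewrite (lt_le_trans M0)// Mm.
have step n x : x0 <= x -> L ^+ n * M x0 <= M x -> L * M x <= M (x + rho n) ->
    exists y, [/\ x <= y, y <= x + N%:R * rho n, L ^+ n.+1 * M x0 <= M y &
      L * M y <= M (y + rho n.+1)].
  move=> x0x Mx Lx; apply: contrapT => nstep; apply: nstop.
  exists n, x; split => // r /andP[r0 rN].
  have xr : x0 <= x + rho n by rewrite ler_wpDr// ltW.
  (* as long as [nstep] holds, each half-step multiplies [M] by less than [L] *)
  have H i : (i <= 2 * r.-1)%N ->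
      M (x + rho n + i%:R * rho n.+1) <= L ^+ i * M (x + rho n).
    elim: i => [|i IH] ir; first by rewrite mul0r addr0 expr0 mul1r.
    have {}IH := IH (ltnW ir).
    have xy : x + rho n <= x + rho n + i%:R * rho n.+1.
      by rewrite lerDl mulr_ge0// ltW.
    have : M (x + rho n + i%:R * rho n.+1 + rho n.+1) < L * M (x + rho n + i%:R * rho n.+1).
      rewrite ltNge; apply/negP => Ly; apply: nstep.
      exists (x + rho n + i%:R * rho n.+1); split => //.
      - by rewrite (le_trans _ xy)// lerDl ltW.
      - rewrite -addrA lerD2l {1}rhoS.
        have : (i%:R : R) + 2 <= 2 * N%:R.
          have iN : (i + 2 <= 2 * N)%N by clear -ir r0 rN; lia.
          by move: iN; rewrite -(ler_nat R) natrD natrM.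
        by move=> /(ler_wpM2r (ltW (rho0 n.+1))); rewrite (rhoS n); lra.
      - rewrite exprS -mulrA (le_trans (ler_wpM2l (ltW L0) Mx))//.
        by rewrite (le_trans Lx)// Mm.
    have -> : x + rho n + i%:R * rho n.+1 + rho n.+1 = x + rho n + i.+1%:R * rho n.+1.
      by rewrite -natr1; ring.
    by move=> /ltW/le_trans; apply; rewrite exprS -mulrA ler_wpM2l// ltW.
  have := H (2 * r.-1)%N (leqnn _).
  have -> : x + rho n + (2 * r.-1)%:R * rho n.+1 = x + r%:R * rho n.
    rewrite -[in RHS](prednK r0) -natr1 natrM rhoS; ring.
  move=> /le_trans; apply; rewrite (ler_wpM2r (ltW (Mpos _ xr)))//.
  by rewrite ler_weXn2l// leq_mul2l leq_pred.
have seq n : exists x, [/\ x0 <= x, x <= x0 + N%:R * (2 * k - 2 * rho n),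
    L ^+ n * M x0 <= M x & L * M x <= M (x + rho n)].
  elim: n => [|n [x [h1 h2 h3 h4]]].
    exists x0; split => //; first by rewrite lerDl /rho expr0 divr1 subrr mulr0.
      by rewrite expr0 mul1r.
    by rewrite /rho expr0 divr1.
  have [y [y1 y2 y3 y4]] := step n x h1 h3 h4; exists y; split => //.
    exact: le_trans h1 y1.
  rewrite (le_trans y2)// (le_trans (lerD h2 (lexx _)))//.
  by rewrite rhoS le_eqVlt; apply/orP; left; apply/eqP; ring.
have top n : L ^+ n * M x0 <= M (x0 + N%:R * (2 * k)).
  have [x [h1 h2 h3 _]] := seq n; rewrite (le_trans h3)// Mm// (le_trans h2)//.
  by rewrite lerD2l ler_wpM2l// gerBl mulr_ge0// ltW.
pose X := M (x0 + N%:R * (2 * k)) / M x0.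
have := top (Num.bound X); apply/negP; rewrite -ltNge -ltr_pdivrMr//.
rewrite (lt_le_trans (upper_nthrootP (leqnn _)))// lerXn2r// nnegrE//.
exact: ltW.
Qed.

(** By periodicity the values are those taken on a compact rectangle. *)
Lemma strip_max F a b : a <= b -> twopii_periodic F ->
  (forall z, a <= Re z <= b -> ccont F z) ->
  exists z0, a <= Re z0 <= b /\ forall z, a <= Re z <= b -> normc (F z) <= normc (F z0).
Proof.
move=> ab pF cF.
pose g (p : R * R) := normc (F (p.1 +i* p.2)).
have [|||p pA Hp] := @compact_EVT_max _ R g (`[a, b] `*` `[0, pi *+ 2]).
- by exists (a, 0); split; rewrite /= in_itv/= ?lexx ?ab// ltW// twopi_gt0.
- by apply: compact_setX; exact: segment_compact.
- apply: continuous_in_subspaceT => -[x y]; rewrite inE => -[/= xab _].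
  move: xab; rewrite in_itv/= => xab.
  apply/cvgrPdist_lt => e e0; have [d d0 Hd] := cF (x +i* y) xab e e0.
  have d20 : 0 < d / 2 by rewrite divr_gt0.
  exists (ball x (d / 2), ball y (d / 2)).
    by split; exact: nbhsx_ballx.
  move=> -[x' y'] [/=]; rewrite /ball/= => b1 b2.
  rewrite /g/= (le_lt_trans (ler_dist_normc _ _))// normcB; apply: Hd.
  rewrite (le_lt_trans (le_normc_ReIm _))// [d](splitr d) ltrD//=.
    by rewrite distrC.
  by rewrite distrC.
exists (p.1 +i* p.2); split; first by move: pA; rewrite inE => -[/=]; rewrite in_itv.
move=> [x y] xab; have [n /andP[n0 n1]] := mod_period y (@twopi_gt0 R).
rewrite -(periodic_int pF (- n)) mulrNz twopii_mulz complexB subr0.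
have := Hp (x, y - pi *+ 2 *~ n); apply; rewrite inE; split => /=; rewrite in_itv//=.
by rewrite n0 ltW.
Qed.

Lemma half_plane_pser psi (D : set R) (xr x1 B : R) : twopii_periodic psi ->
  (forall x, D x -> exists2 y, x < y & D y) ->
  (forall x y, x <= y -> D y -> D x) -> D xr ->
  (forall z, D (Re z) -> cdiff psi z) ->
  (forall z, Re z <= x1 -> normc (psi z) <= B) ->
  exists c,
    (forall x B', D x -> (forall y, normc (psi (x +i* y)) <= B') ->
       coef_bound c (expR x) (2 * B')) /\
    (forall p, D (Re p) -> psi p = pser c (Cexp p)).
Proof.
move=> pp Dopen Ddown Dxr dpsi bpsi.
have [c [H1 H2]] := half_plane_series pp Ddown Dxr dpsi bpsi.
exists c; split; first by move=> x B' xx2 HB n; exact: H1.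
move=> p /Dopen[x px Dx]; have [K HK] := H2 p x px Dx; symmetry; apply: pser_eq HK.
by rewrite expR_ge0/= expR_lt1 subr_lt0.
Qed.

Lemma pser_near0 c rho K h : 0 < rho -> coef_bound c rho K -> normc h <= rho / 2 ->
  normc (pser c h - c 0%N) <= 4 * K / rho * normc h.
Proof.
move=> r0 cK hr; have h0 := normc_ge0 h.
have K0 : 0 <= K by rewrite (le_trans _ (cK 0%N))// mulr_ge0 ?normc_ge0.
have t1 : normc h / rho <= 1 / 2 by rewrite ler_pdivrMr//; lra.
have t : 0 <= normc h / rho < 1.
  by rewrite divr_ge0 ?(ltW r0)//= (le_lt_trans t1)//; lra.
have := pser_tail t r0 cK (_ : normc h <= normc h / rho * rho).
rewrite divfK ?gt_eqF// => /(_ (lexx _) 1%N).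
rewrite /ppart big_ord_recl big_ord0 expr0 mulr1 addr0 expr1 => /le_trans; apply.
have i2 : (1 - normc h / rho)^-1 <= 2.
  by rewrite -[leRHS]invrK lef_pV2 ?posrE ?invr_gt0//; lra.
rewrite (_ : 4 * K / rho * normc h = 2 * (K * 2) * (normc h / rho)); last by ring.
by rewrite ler_wpM2r ?ler_wpM2l//; case/andP: t.
Qed.

(** The function [psi z := F (- z) * Cexp z] is a power series in [Cexp z] far to the
    left. As [a < 1] it tends to 0 there, so the constant term is zero, and [psi z] is at
    most of the order of [Cexp z], that is, [F] is bounded. *)
Lemma slow_growth_bounded F (H X0 a Z : R) : twopii_periodic F -> H < X0 -> 0 <= a -> a < 1 ->
  (forall z, H < Re z -> cdiff F z) ->
  (forall z, X0 <= Re z -> normc (F z) <= Z * expR (a * Re z)) ->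
  exists X1 B, forall z, X1 <= Re z -> normc (F z) <= B.
Proof.
move=> pF HX a0 a1 dF bF.
pose psi z := F (- z) * Cexp z.
have Z0 : 0 <= Z.
  have := le_trans (normc_ge0 _) (bF X0%:C (lexx _)).
  by rewrite pmulr_lge0// expR_gt0.
have bpsi z : Re z <= - X0 -> normc (psi z) <= Z * expR ((1 - a) * Re z).
  move=> zX; rewrite /psi normcM normc_Cexp.
  rewrite (_ : (1 - a) * Re z = a * Re (- z) + Re z); last by case: (z) => u v /=; ring.
  rewrite expRD mulrA ler_wpM2r ?expR_ge0// bF//.
  by move: zX; case: (z) => u v /=; rewrite lerNr.
have XH : - X0 < - H by rewrite ltrN2.
have a10 : 0 < 1 - a by rewrite subr_gt0.
pose B := Z * expR ((1 - a) * - X0).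
have bpsi' z : Re z <= - X0 -> normc (psi z) <= B.
  move=> zX; rewrite (le_trans (bpsi z zX))// ler_wpM2l// ler_expR ler_wpM2l//.
  exact: ltW.
have ppsi : twopii_periodic psi.
  move=> z; rewrite /psi Cexp_periodic opprD; congr (_ * _).
  by have := pF (- z - twopii); rewrite subrK.
have dpsi z : Re z < - H -> cdiff psi z.
  move=> zH; apply: cdiffM; last exact: cdiff_Cexp.
  apply: (@cdiff_comp _ (fun z => - z)).
    rewrite (_ : (fun z => - z) = fun z => 0 + (-1) * z); first exact: cdiff_lin.
    by apply/funext => w; ring.
  by apply: dF; move: zH; case: (z) => u v /=; rewrite ltrNr.
have Dopen x : x < - H -> exists2 y, x < y & y < - H.
  by move=> xH; exists ((x - H) / 2); rewrite ?ltr_pdivlMr ?ltr_pdivrMr//; lra.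
have [c [c1 c2]] := @half_plane_pser _ (fun x => x < - H) _ _ _ ppsi Dopen
  (fun x y xy yH => le_lt_trans xy yH) XH dpsi bpsi'.
have c0 : c 0%N = 0.
  apply: (@normc_small0 _ _ (2 * Z)) => e e0 e1.
  pose x := Num.min (- X0) (ln e / (1 - a)).
  have xX : x <= - X0 by rewrite /x ge_min lexx.
  have := c1 x (Z * expR ((1 - a) * x)) (le_lt_trans xX XH) _ 0%N.
  rewrite expr0 mulr1 => /(_ _)/le_trans; apply.
    by move=> y; apply: bpsi.
  rewrite mulrA ler_wpM2l ?mulr_ge0// -[leRHS]lnK ?posrE// ler_expR.
  by rewrite mulrC -ler_pdivlMr// /x ge_min lexx orbT.
exists (X0 + ln 2), (4 * (2 * B) / expR (- X0)) => z zX.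
have cb : coef_bound c (expR (- X0)) (2 * B).
  by apply: c1 => // y; exact: bpsi'.
have ez0 := expR_gt0 (Re (- z)).
have eX : expR (Re (- z)) <= expR (- X0) / 2.
  rewrite -{1}(lnK (_ : (2 : R) \is Num.pos)) ?posrE// -expRN -expRD ler_expR.
  by case: (z) zX => u v /=; lra.
have zX0 : Re (- z) < - H.
  rewrite (le_lt_trans _ XH)// -ler_expR (le_trans eX)// ler_pdivrMr// ler_peMr ?expR_ge0//.
  by rewrite ler1n.
have := pser_near0 (expR_gt0 _) cb (_ : normc (Cexp (- z)) <= _).
rewrite normc_Cexp => /(_ eX); rewrite c0 subr0 -(c2 (- z))//.
by rewrite /psi opprK normcM normc_Cexp ler_pM2r.
Qed.

End GrowthTools.

(** * Solutions are bounded at the ends of the plane *)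

Section Growth.
Context {R : realType}.
Local Notation C := R[i].
Local Notation Re := complex.Re.

Lemma pser_scale (b : nat -> C) rho K (al t w : C) : coef_bound b rho K ->
  normc (t * w) < rho -> pser (fun n => al * b n * t ^+ n) w = al * pser b (t * w).
Proof.
move=> bK tw; apply: (@cvg_lim C^o (@norm_hausdorff C C^o)).
have -> : ppart (fun n => al * b n * t ^+ n) w = fun N => al * ppart b (t * w) N.
  apply/funext => N; rewrite /ppart mulr_sumr; apply: eq_bigr => i _.
  by rewrite exprMn !mulrA.
by apply: ccvgM; [exact: ccvg_cst | exact: pser_cvg bK tw].
Qed.

Lemma ln2_lt1 : ln 2 < 1 :> R.
Proof.
rewrite -ltr_expR lnK ?posrE//.
by have := @expR_gt1Dx R 1; rewrite oner_eq0 => /(_ isT); apply: le_lt_trans; rewrite -natr1.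
Qed.

Variables (k d : nat) (j : 'I_d -> nat) (f : C -> C) (s : C) (H : R).
Hypotheses (hk : (0 < k)%N) (hd : (1 < d)%N) (s0 : s != 0).
Hypothesis df : forall z, H < Re z -> cdiff f (s * z).
Hypothesis pf : twopii_periodic (fun z => f (s * z)).
Hypothesis ode : forall z, H < Re z ->
  derive1n k (f : C^o -> C^o) (s * z) =
  \prod_(i < d) derive1n (j i) (f : C^o -> C^o) (s * z).

Let F z := f (s * z).
Let L : R := 2 ^+ k.
Let kR : R := k%:R.

Let kR0 : 0 < kR. Proof. by rewrite ltr0n. Qed.
Let L2 : 2 <= L.
Proof. by rewrite /L -[leLHS]expr1; apply: ler_weXn2l; rewrite // ler1n. Qed.
Let L0 : 0 < L. Proof. by rewrite (lt_le_trans _ L2). Qed.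

Let dF z : H < Re z -> cdiff F z.
Proof.
move=> zH; apply: (@cdiff_comp _ (fun z => s * z)); last exact: df.
by apply: cdiffM; [exact: cdiff_cst | exact: cdiff_id].
Qed.

(** The coefficients [c] are those of [F (z' + rho * w) / F z'] at [w = 0]. Far from the
    line [Re z = H] the assumptions on [M], which are those provided by [growth_stop],
    bound this quotient on discs. It is at most 1 in modulus on [Re w <= 0] because the
    maximum over [Re z <= x + rho] is attained at [z'], and at most [1 / L] at [-1] because
    [Re z' - rho <= x]. Each derivation brings a factor [t], and division by [F z'] leaves
    [d - 1] factors [F z'] in the equation. *)
Lemma rescale (M : R -> R) (x rho : R) (N : nat) (z' : C) :
  0 < rho -> H + 1 + N.+1%:R * rho <= x -> x < Re z' -> Re z' <= x + rho ->
  M (x + rho) = normc (F z') -> F z' != 0 ->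
  (forall y z, H + 1 <= Re z -> Re z <= y -> normc (F z) <= M y) ->
  L * M x <= M (x + rho) ->
  (forall r : nat, (0 < r <= N.+1)%N -> M (x + r%:R * rho) <= L ^+ (2 * r) * M (x + rho)) ->
  let t := s * rho%:C in let eta := t ^+ (\sum_(i < d) j i) / (t ^+ k * F z' ^+ d.-1) in
  exists c : nat -> C,
  [/\ forall r : nat, (0 < r < N)%N -> coef_bound c r%:R (2 * L ^+ (2 * r.+1)),
      forall w, Re w <= 0 -> normc w < N%:R -> normc (pser c w) <= 1,
      (1 < N)%N -> normc (pser c (-1)) <= 1 / 2,
      c 0%N = 1 &
      forall w, normc w < N%:R -> \prod_(i < d) pser (iter (j i) dcoef c) w =
        eta * pser (iter k dcoef c) w].
Proof.
move=> rho0 Hx xz' z'x MF f0 MF' LM stop t eta.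
have t0 : t != 0.
  by rewrite mulf_neq0// -normc_gt0 normc_real gtr0_norm.
have nt : 0 < normc t by rewrite normc_gt0.
set f0' := F z' in MF f0 eta *.
have m0 : 0 < M (x + rho) by rewrite MF normc_gt0.
have Rew w : normc w < N.+1%:R -> H + 1 <= Re (z' + rho%:C * w).
  move=> wN; have := le_trans (ler_norm _) (normc_Re (- w)).
  have -> : Re (z' + rho%:C * w) = Re z' - rho * Re (- w).
    by case: (z') (w) => a b [u v] /=; ring.
  rewrite normcN => rw; have : rho * Re (- w) <= rho * N.+1%:R.
    by rewrite ler_wpM2l ?(ltW rho0)// (le_trans rw)// ltW.
  lra.
have st w : s * z' + t * w = s * (z' + rho%:C * w) by rewrite /t; ring.
have HH w : normc w < N.+1%:R -> H < Re (z' + rho%:C * w).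
  by move=> /Rew; apply: lt_le_trans; rewrite ltrDl.
have hw h : normc h < normc t * N.+1%:R -> h = t * (h / t) /\ normc (h / t) < N.+1%:R.
  by move=> ht; split; [rewrite mulrC divfK | rewrite normcM normcV ltr_pdivrMr// mulrC].
have [||a [T1 T2 T3]] := @taylor _ f (s * z') (normc t * N.+1%:R).
- by rewrite mulr_gt0// ltr0n.
- by move=> h hh; have [ht wN] := hw h hh; rewrite ht st; apply/df/HH.
pose c n := f0'^-1 * a n * t ^+ n.
have D m w : normc w < N.+1%:R -> pser (iter m dcoef c) w =
    t ^+ m / f0' * derive1n m (f : C^o -> C^o) (s * (z' + rho%:C * w)).
  move=> wN.
  have tw : normc (t * w) < normc t * N.+1%:R by rewrite normcM ltr_pM2l.
  rewrite -st (pser_derive1n T2 T3)//.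
  have [|K HK] := coef_bound_iter m T2 (rho := (normc (t * w) + normc t * N.+1%:R) / 2).
    have := normc_ge0 (t * w).
    by rewrite ltr_pdivlMr// ltr_pdivrMr// => ?; apply/andP; split; lra.
  rewrite -(pser_scale (t ^+ m / f0') HK); last by rewrite ltr_pdivlMr//; lra.
  congr pser; apply/funext => n; rewrite !iter_dcoef /c exprD.
  by ring.
have D0 w : normc w < N.+1%:R -> pser c w = F (z' + rho%:C * w) / f0'.
  by move=> wN; rewrite (D 0%N w wN) expr0 mul1r mulrC.
have NS (w : C) : normc w < N%:R -> normc w < N.+1%:R.
  by move=> wN; rewrite (lt_trans wN)// ltr_nat.
have FM w B : normc w < N.+1%:R -> normc (F (z' + rho%:C * w)) <= B * M (x + rho) ->
    normc (pser c w) <= B.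
  by move=> wN HB; rewrite D0// normcM normcV -MF ler_pdivrMr.
exists c; split.
- move=> r /andP[r0 rN] n.
  have nr : 0 < normc t * r%:R < normc t * N.+1%:R.
    by rewrite mulr_gt0 ?ltr0n//= ltr_pM2l// ltr_nat (ltn_trans rN).
  have TT := T1 (normc t * r%:R) (L ^+ (2 * r.+1) * M (x + rho)) nr _ n.
  rewrite /c !normcM normcX normcV -MF.
  have -> : (M (x + rho))^-1 * normc (a n) * normc t ^+ n * r%:R ^+ n =
      normc (a n) * (normc t * r%:R) ^+ n / M (x + rho).
    by rewrite exprMn; ring.
  rewrite ler_pdivrMr// -mulrA; apply: TT => h hr.
  have hlt : normc h < normc t * N.+1%:R by rewrite hr; case/andP: nr.
  have [ht wN] := hw h hlt; rewrite ht st.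
  apply: le_trans (stop r.+1 _); last by rewrite /= ltnS (ltnW rN).
  apply: MF'; first exact: Rew.
  have -> : Re (z' + rho%:C * (h / t)) = Re z' + rho * Re (h / t).
    by case: (z') (h / t) => u v [u' v'] /=; ring.
  have : Re (h / t) <= r%:R.
    rewrite (le_trans (ler_norm _))// (le_trans (normc_Re _))//.
    by rewrite normcM normcV hr mulrAC divff ?mul1r// gt_eqF.
  by move=> /(ler_wpM2l (ltW rho0)); rewrite -natr1; lra.
- move=> w w0 /NS wN; apply: FM => //; rewrite mul1r; apply: MF'; first exact: Rew.
  have -> : Re (z' + rho%:C * w) = Re z' + rho * Re w.
    by case: (z') (w) => u v [u' v'] /=; ring.
  have : rho * Re w <= 0 by rewrite mulr_ge0_le0// ltW.
  lra.
- move=> N1; have n1 : normc (-1 : C) < N.+1%:R.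
    by rewrite normcN normc1 (ltr_nat R 1) (ltn_trans N1).
  apply: FM => //; apply: (@le_trans _ _ (M x)).
    apply: MF'; first exact: Rew.
    have -> : Re (z' + rho%:C * -1) = Re z' - rho by case: (z') => u v /=; ring.
    lra.
  have Mx0 : 0 <= M x.
    apply: le_trans (normc_ge0 _) (MF' x x%:C _ (lexx _)).
    by rewrite /= (le_trans _ Hx)// lerDl mulr_ge0// ltW.
  have := ler_wpM2r Mx0 L2; lra.
- by rewrite -pser0 D0 ?normc0 ?ltr0n// mulr0 addr0 divff.
- move=> w /NS wN; rewrite (D k w wN) ode; last exact: HH.
  under eq_bigr do rewrite (D _ _ wN).
  rewrite big_split/= big_split/= prodr_const card_ord -expr_sum.
  have -> : f0'^-1 ^+ d = f0'^-1 * (f0' ^+ d.-1)^-1.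
    by rewrite -exprVn -exprS (prednK (ltnW hd)).
  have tk : t ^+ k != 0 by rewrite expf_neq0.
  have fd0 : f0' ^+ d.-1 != 0 by rewrite expf_neq0.
  by rewrite /eta; field; rewrite tk fd0 f0.
Qed.

(** If [F] is unbounded then either the maximum [M] grows slowly, which
    [slow_growth_bounded] excludes, or [growth_stop] applies with [M x0] as large as
    desired and the rescaled functions contradict [rescaled_limit_absurd]. The factor
    [L = 2 ^+ k] is chosen so that [rho ^+ k = k ^+ k / L ^+ n] is compensated by
    [M x >= L ^+ n * M x0], which makes [eta] tend to 0. *)
Lemma growth_bounded : exists X B, forall z, X <= Re z -> normc (f (s * z)) <= B.
Proof.
apply: contrapT => unb.
have {}unb X B : exists z, X <= Re z /\ B < normc (F z).
  apply: contrapT => nz; apply: unb; exists X, B => z zX.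
  by rewrite leNgt; apply/negP => Bz; apply: nz; exists z.
pose H1 := H + 1.
have HH1 : H < H1 by rewrite ltrDl.
have [zm Hzm] : {zm : R -> C & forall x, H1 <= x -> H1 <= Re (zm x) <= x /\
    forall z, H1 <= Re z <= x -> normc (F z) <= normc (F (zm x))}.
  apply: (@choice _ _ (fun x z0 => H1 <= x -> H1 <= Re z0 <= x /\
    forall z, H1 <= Re z <= x -> normc (F z) <= normc (F z0))) => x.
  have [xH|xH] := leP H1 x; last by exists 0.
  have [z0 Hz0] := @strip_max _ F H1 x xH pf
    (fun z zx => cdiff_cont (dF (lt_le_trans HH1 (andP zx).1))).
  by exists z0.
pose M x := normc (F (zm x)).
have MF y z : H1 <= Re z -> Re z <= y -> normc (F z) <= M y.
  by move=> z1 zy; apply: (Hzm y (le_trans z1 zy)).2; rewrite z1.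
have Mm x y : H1 <= x -> x <= y -> M x <= M y.
  move=> x1 xy; have [/andP[zx1 zx2] _] := Hzm x x1.
  by apply: MF => //; exact: le_trans xy.
have Mbig B : exists X, H1 <= X /\ forall x, X <= x -> B < M x.
  have [z [zH zB]] := unb H1 B; exists (Re z); split => // x zx.
  by rewrite (lt_le_trans zB)// MF.
have start X : H1 <= X -> exists x, X <= x /\ L * M x <= M (x + kR).
  move=> HX; apply: contrapT => nx.
  have {}nx x : X <= x -> M (x + kR) <= L * M x.
    by move=> Xx; apply/ltW; rewrite ltNge; apply/negP => xM; apply: nx; exists x.
  have geo (n : nat) : M (X + n%:R * kR) <= L ^+ n * M X.
    elim: n => [|n IH]; first by rewrite mul0r addr0 expr0 mul1r.
    rewrite -natr1 mulrDl mul1r addrA (le_trans (nx _ _))//.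
      by rewrite lerDl mulr_ge0// ltW.
    by rewrite exprS -mulrA ler_wpM2l// ltW.
  have ln20 : 0 <= ln 2 :> R by rewrite ln_ge0// ler1n.
  have MX0 : 0 <= M X by exact: normc_ge0.
  have LE : L = expR (kR * ln 2) by rewrite mulrC expRM_natr lnK// posrE.
  have [|X1 [B HB]] := @slow_growth_bounded _ F H X (ln 2) (M X * expR (ln 2 * (kR - X))) pf
    (lt_le_trans HH1 HX) ln20 ln2_lt1 dF.
    move=> z zX; rewrite -mulrA -expRD -mulrDr.
    (* the number of steps of length [k] that lead from [X] beyond [Re z] *)
    pose n := (Num.trunc ((Re z - X) / kR)).+1.
    have q0 : 0 <= (Re z - X) / kR by rewrite divr_ge0 ?subr_ge0// ltW.
    have /andP[n1 n2] := truncn_itv q0.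
    have zn : Re z <= X + n%:R * kR.
      by rewrite -lerBlDl -ler_pdivrMr// ltW.
    rewrite (le_trans (MF _ _ (le_trans HX zX) zn))// (le_trans (geo n))// mulrC ler_wpM2l//.
    rewrite LE -expRM_natl ler_expR mulrA mulrC ler_wpM2l//.
    rewrite /n -natr1 mulrDl mul1r; move: n1; rewrite ler_pdivlMr//; lra.
  by have [z [zX zB]] := unb X1 B; have := HB z zX; rewrite leNgt zB.
pose Kst := (normc s * kR) ^+ (\sum_(i < d) j i) * (normc s ^+ k)^-1.
have ns : 0 < normc s by rewrite normc_gt0.
have data (N : nat) : exists ce : (nat -> C) * C,
  [/\ forall r : nat, (0 < r < N)%N -> coef_bound ce.1 r%:R (2 * L ^+ (2 * r.+1)),
      forall w, Re w <= 0 -> normc w < N%:R -> normc (pser ce.1 w) <= 1,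
      (1 < N)%N -> normc (pser ce.1 (-1)) <= 1 / 2,
      ce.1 0%N = 1 &
      (forall w, normc w < N%:R -> \prod_(i < d) pser (iter (j i) dcoef ce.1) w =
        ce.2 * pser (iter k dcoef ce.1) w) /\ normc ce.2 <= Kst / N.+1%:R].
  have [X [HX XM]] := Mbig N.+1%:R.
  (* leave room for a disc of radius [N.+1] times a step, which is at most [k] *)
  pose X' := X + N.+1%:R * kR.
  have XX' : X <= X' by rewrite lerDl mulr_ge0// ltW.
  have [x0 [x0X x0M]] := start X' (le_trans HX XX').
  have H1x0 : H1 <= x0 by rewrite (le_trans HX)// (le_trans XX').
  have M0 : N.+1%:R < M x0 by apply: XM; exact: le_trans XX' x0X.
  have M00 : 0 < M x0 by rewrite (lt_trans _ M0)// ltr0n.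
  have [n [x [x1 x2 x3 x4]]] := @growth_stop R M x0 kR L N.+1 kR0 L2
    (fun x y h1 => @Mm x y (le_trans H1x0 h1)) M00 x0M.
  pose rho := kR / 2 ^+ n.
  have p20 : 0 < 2 ^+ n :> R by rewrite exprn_gt0.
  have rho0 : 0 < rho by rewrite divr_gt0.
  have rhok : rho <= kR by rewrite ler_pdivrMr// ler_peMr ?(ltW kR0)// exprn_ege1// ler1n.
  have H1x : H1 <= x by exact: le_trans x1.
  have H1xr : H1 <= x + rho by rewrite (le_trans H1x)// lerDl ltW.
  have [/andP[z1 z2] _] := Hzm (x + rho) H1xr.
  set z' := zm (x + rho) in z1 z2.
  have Mx0 : 0 < M x by rewrite (lt_le_trans M00)// Mm.
  have MM : M x < M (x + rho).
    by rewrite (lt_le_trans _ x3)// ltr_pMl// (lt_le_trans _ L2)// ltr1n.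
  have xz' : x < Re z'.
    rewrite ltNge; apply/negP => zx; move: MM; apply/negP; rewrite -leNgt.
    exact: MF.
  have f0 : F z' != 0 by rewrite -normc_gt0 (lt_trans Mx0).
  have Hxx : H + 1 + N.+1%:R * rho <= x.
    rewrite (le_trans _ x1)// (le_trans _ x0X)// lerD// ler_wpM2l//.
  have := rescale rho0 Hxx xz' z2 (erefl _) f0 MF x3 x4.
  cbv zeta; set t := s * rho%:C; set eta := t ^+ _ / _ => -[c [c1 c2 c3 c4 c5]].
  exists (c, eta); split => //; split => //.
  have nt : normc t = normc s * rho by rewrite normcM normc_real gtr0_norm.
  have Mz : normc (F z') = M (x + rho) by [].
  have mge : (2 ^+ n) ^+ k * N.+1%:R <= M (x + rho).
    rewrite -exprM mulnC exprM -/L (le_trans _ (ltW MM))// (le_trans _ x2)//.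
    by rewrite ler_wpM2l ?exprn_ge0 ?(ltW L0)// ltW.
  have m1 : 1 <= M (x + rho).
    rewrite (le_trans _ mge)// mulr_ege1 ?exprn_ege1 ?ler1n//.
  have mm : M (x + rho) <= M (x + rho) ^+ d.-1.
    by rewrite -[leLHS]expr1 ler_weXn2l// -ltnS (prednK (ltnW hd)).
  have rk0 : 0 <= rho ^+ k by rewrite exprn_ge0// ltW.
  have rkN : N.+1%:R <= rho ^+ k * M (x + rho) ^+ d.-1.
    apply: le_trans (ler_wpM2l rk0 mm); apply: le_trans (ler_wpM2l rk0 mge).
    by rewrite mulrA -exprMn /rho divfK ?gt_eqF// ler_peMl// exprn_ege1// ler1n.
  have sk0 : 0 < normc s ^+ k by rewrite exprn_gt0.
  have den : normc s ^+ k * N.+1%:R <= (normc s * rho) ^+ k * M (x + rho) ^+ d.-1.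
    by rewrite [(normc s * rho) ^+ k]exprMn -mulrA ler_wpM2l// ltW.
  have den0 : 0 < normc s ^+ k * N.+1%:R by rewrite mulr_gt0// ltr0n.
  rewrite /eta normcM normcV normcM !normcX nt Mz /Kst -mulrA -invfM.
  apply: ler_pM.
  - by rewrite exprn_ge0// mulr_ge0// ltW.
  - by rewrite invr_ge0 (le_trans (ltW den0)).
  - have srk : normc s * rho <= normc s * kR by rewrite ler_wpM2l// ltW.
    have sr0 : 0 <= normc s * rho by rewrite mulr_ge0// ltW.
    by rewrite lerXn2r// nnegrE (le_trans sr0).
  - by rewrite lef_pV2 ?posrE// (lt_le_trans den0).
have [ce Hce] := choice data.
apply: (@rescaled_limit_absurd R k d j L (fun N => (ce N).1) (fun N => (ce N).2)).
- by move=> N; have [] := Hce N.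
- by move=> N; have [] := Hce N.
- by move=> N; have [] := Hce N.
- by move=> N; have [] := Hce N.
- by move=> N; have [_ _ _ _ []] := Hce N.
have K0 : 0 <= Kst by rewrite mulr_ge0 ?exprn_ge0 ?invr_ge0 ?mulr_ge0 ?(ltW ns) ?(ltW kR0)// exprn_ge0// ltW.
apply/(@cvg_normc R nat \oo) => e e0.
exists (Num.bound (Kst / e)) => // N /= NK; rewrite subr0.
have [_ _ _ _ [_ /le_lt_trans]] := Hce N; apply.
rewrite ltr_pdivrMr ?ltr0n// mulrC -ltr_pdivrMr//.
rewrite (lt_le_trans (archi_boundP _))//; first by rewrite divr_ge0// ltW.
by rewrite ler_nat (leq_trans NK).
Qed.

End Growth.

(** * Poles and periodic entire functions *)

Section PeriodicMeromorphic.
Context {R : realType}.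
Local Notation C := R[i].
Local Notation Re := complex.Re.
Implicit Types (F g h : C -> C) (u w z p : C) (Q : {poly C}).

Lemma cdiff_horner Q z : cdiff (fun w => Q.[w]) z.
Proof.
elim/poly_ind: Q => [|Q c IH].
  rewrite (_ : (fun w => _) = fun=> 0); first exact: cdiff_cst.
  by apply/funext => w; rewrite horner0.
rewrite (_ : (fun w => _) = fun w => Q.[w] * w + c).
  apply: cdiffD; last exact: cdiff_cst.
  by apply: (@cdiffM _ (fun w => Q.[w]) (fun w => w)); [exact: IH | exact: cdiff_id].
by apply/funext => w; rewrite !hornerE.
Qed.

Lemma normc_horner_le Q w : normc Q.[w] <= \sum_(i < size Q) normc Q`_i * normc w ^+ i.
Proof.
rewrite horner_coef (le_trans (normc_sum _ _ _))// le_eqVlt; apply/orP; left; apply/eqP.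
by apply: eq_bigr => i _; rewrite normcM normcX.
Qed.

(** The function [1 / g] is bounded near [p], so it is given there by a power series,
    and this series is not zero: [pser_lower] bounds [1 / g] below by a power of the
    distance to [p]. *)
Lemma pole_order g p (d : R) : 0 < d ->
  (forall w, w != p -> normc (w - p) < d -> cdiff g w) ->
  (forall w, w != p -> normc (w - p) < d -> 1 <= normc (g w)) ->
  exists (m : nat) (B e : R), [/\ 0 < e, 0 < B &
    forall w, w != p -> normc (w - p) < e -> normc (g w) * normc (w - p) ^+ m <= B].
Proof.
move=> d0 dg g1.
have ph (t : C) : 0 < normc t -> p + t != p.
  by rewrite normc_gt0 -[_ == p]subr_eq0 addrAC subrr add0r.
have php (t : C) : p + t - p = t by rewrite addrAC subrr add0r.
have g0 w : w != p -> normc (w - p) < d -> g w != 0.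
  by move=> wp wd; rewrite -normc_gt0 (lt_le_trans _ (g1 w wp wd)).
have [||c [_ c2 c3]] := @punctured_taylor _ (fun w => (g w)^-1) p d d 1 d0 d0.
- move=> h h0 hd; have hp := ph h h0; have hd' : normc (p + h - p) < d by rewrite php.
  by apply: cdiffV; [exact: g0 | exact: dg].
- move=> h h0 hd; have hp := ph h h0; have hd' : normc (p + h - p) < d by rewrite php.
  by rewrite normcV invf_le1 ?g1// (lt_le_trans _ (g1 _ hp hd')).
have d2 : 0 < d / 2 < d by rewrite divr_gt0//= ltr_pdivrMr// ltr_pMr// ltr1n.
have [K HK] := c2 _ d2.
have [|m [a [e [a0 e0 He]]]] := pser_lower (divr_gt0 d0 (ltr0n R 2)) HK.
  apply: contrapT => /forallNP c0.
  have c0' n : c n = 0 by apply/eqP/negPn/negP; exact: c0.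
  have hn : normc ((d / 2)%:C : C) = d / 2.
    by rewrite normc_real gtr0_norm//; case/andP: d2.
  have h0 : 0 < normc ((d / 2)%:C : C) by rewrite hn; case/andP: d2.
  have hd : normc ((d / 2)%:C : C) < d by rewrite hn; case/andP: d2.
  have := c3 _ h0 hd.
  rewrite (@pser_poly _ c 0)// /ppart big_ord0 => /eqP; rewrite invr_eq0; apply/negP.
  by apply: g0; [exact: ph | rewrite php].
exists m, a^-1, (Num.min d e); split; rewrite ?lt_min ?d0 ?invr_gt0//.
move=> w wp; rewrite lt_min => /andP[wd we].
have h0 : 0 < normc (w - p) by rewrite normc_gt0 subr_eq0.
have := He _ we; rewrite -(c3 _ h0 wd) [p + _]addrC subrK normcV.
have gw : 0 < normc (g w) by rewrite normc_gt0 g0.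
by rewrite -ler_pdivlMl// => H; rewrite -ler_pdivlMl// mulrC.
Qed.

(** The value of the extension at [u] is the constant term of the expansion of [h]
    at [u]. Close to [u] the extension is the sum of this expansion, for it agrees with
    [h] wherever [h] is differentiable. *)
Lemma removable h :
  (forall u, exists (d B : R), 0 < d /\ forall w, w != u -> normc (w - u) < d ->
     cdiff h w /\ normc (h w) <= B) ->
  exists ht : C -> C, (forall u, cdiff ht u) /\ (forall u, cdiff h u -> ht u = h u).
Proof.
move=> H.
have T u : exists cr : (nat -> C) * R, 0 < cr.2 /\ (exists rho K, 0 < rho /\ coef_bound cr.1 rho K)
    /\ forall t, 0 < normc t -> normc t < cr.2 -> cdiff h (u + t) /\ h (u + t) = pser cr.1 t.
  have [d [B [d0 Hd]]] := H u.
  have ut (t : C) : 0 < normc t -> u + t != u.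
    by rewrite normc_gt0 -[_ == u]subr_eq0 addrAC subrr add0r.
  have utu (t : C) : u + t - u = t by rewrite addrAC subrr add0r.
  have [||c [_ c2 c3]] := @punctured_taylor _ h u d d B d0 d0.
  - by move=> t t0 td; have [] := Hd (u + t) (ut t t0); rewrite ?utu.
  - by move=> t t0 td; have [] := Hd (u + t) (ut t t0); rewrite ?utu.
  have d2 : 0 < d / 2 < d by rewrite divr_gt0//= ltr_pdivrMr// ltr_pMr// ltr1n.
  have [K HK] := c2 _ d2.
  exists (c, d); split => //; split; first by exists (d / 2), K; case/andP: d2.
  move=> t t0 td; split; last exact: c3.
  by have [] := Hd (u + t) (ut t t0); rewrite ?utu.
have [cr Hcr] := choice T.
pose ht u := (cr u).1 0%N.
have pd u : exists2 d : R, 0 < d & forall t, normc t < d -> cdiff (pser (cr u).1) t.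
  have [_ [[rho [K [rho0 HK]]] _]] := Hcr u; exists rho => // t tr.
  by apply/cdiffP; exists (pser (dcoef (cr u).1) t); exact: pser_deriv HK tr.
have hE u : cdiff h u -> ht u = h u.
  move=> hu; have [r0 [_ H2]] := Hcr u; have [d d0 Hd] := pd u.
  rewrite /ht -pser0 -[u in RHS]addr0.
  apply: (@ccont_eq _ (pser (cr u).1) (fun t => h (u + t)) 0 (cr u).2) => //.
  - by apply/cdiff_cont/Hd; rewrite normc0.
  - apply/cdiff_cont; apply: (@cdiff_comp _ (fun t => u + t)); last by rewrite addr0.
    by apply: cdiffD; [exact: cdiff_cst | exact: cdiff_id].
  - move=> t t0; rewrite subr0 => tr; symmetry; apply: (H2 t _ tr).2.
    by rewrite normc_gt0.
exists ht; split => // u.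
have [r0 [_ H2]] := Hcr u; have [d d0 Hd] := pd u.
apply: (@cdiff_near _ (fun w => pser (cr u).1 (w - u))).
  exists (cr u).2 => // w wu; have [->|wu0] := eqVneq w u.
    by rewrite subrr pser0.
  have wu1 : 0 < normc (w - u) by rewrite normc_gt0 subr_eq0.
  have [h1 h2] := H2 _ wu1 wu.
  rewrite [u + _]addrC subrK in h1 h2.
  by rewrite -h2 hE.
apply: (@cdiff_comp _ (fun w => w - u)).
  by apply: cdiffB; [exact: cdiff_id | exact: cdiff_cst].
by apply: Hd; rewrite subrr normc0.
Qed.

(** [F] is a power series in [Cexp z] that converges everywhere. The coefficient
    bounds on the lines [Re z = x] force the coefficients of index above [N] to vanish
    as [x] grows. *)
Lemma entire_periodic_poly F (x1 x2 B : R) (N : nat) : twopii_periodic F ->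
  (forall z, cdiff F z) -> (forall z, Re z <= x1 -> normc (F z) <= B) ->
  (forall z, x2 <= Re z -> normc (F z) <= B * expR (Re z) ^+ N) ->
  exists P : {poly C}, forall z, F z = P.[Cexp z].
Proof.
move=> pF dF bl br.
have openT (x : R) : setT x -> exists2 y, x < y & setT y.
  by move=> _; exists (x + 1); rewrite // ltrDl.
have [c [c1 c2]] := @half_plane_pser R F setT 0 x1 B pF openT (fun x y _ _ => I) I
  (fun z _ => dF z) bl.
have B0 : 0 <= B by exact: le_trans (normc_ge0 _) (bl x1%:C (lexx _)).
have c0 n : (N < n)%N -> c n = 0.
  move=> Nn; apply: (@normc_small0 _ _ (2 * B)) => e e0 e1.
  (* for this [x] a single extra factor [expR x >= e^-1] beats the bound [br] *)
  pose x := Num.max (Num.max x2 0) (- ln e).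
  have xx2 : x2 <= x by rewrite /x !le_max lexx.
  have x0 : 0 <= x by rewrite /x !le_max lexx orbT.
  have xe : - ln e <= x by rewrite /x !le_max lexx orbT.
  have := c1 x (B * expR x ^+ N) I (fun y => br (x +i* y) xx2) n.
  have ex0 := expR_gt0 x.
  rewrite -(subnK (ltnW Nn)) exprD mulrA mulrA ler_pM2r ?exprn_gt0// (subnK (ltnW Nn)) => H.
  have exn : e^-1 <= expR x ^+ (n - N).
    rewrite -[leLHS]lnK ?posrE ?invr_gt0// lnV ?posrE//.
    apply: (@le_trans _ _ (expR x)); first by rewrite ler_expR.
    rewrite -[leLHS]expr1 ler_weXn2l ?subn_gt0//.
    by rewrite -expR0 ler_expR.
  rewrite -ler_pdivrMr// (le_trans _ H)// ler_wpM2l ?normc_ge0//.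
exists (\poly_(n < N.+1) c n) => z; rewrite c2// (@pser_poly _ c N.+1)//.
by rewrite horner_poly.
Qed.

Lemma cdiff_lip F z : cdiff F z -> exists (d K : R), 0 < d /\
  forall w, normc (w - z) < d -> normc (F w - F z) <= K * normc (w - z).
Proof.
move=> /cdiffP[D /cderivP/(_ 1 ltr01)[d d0 Hd]]; exists d, (1 + normc D); split => // w wd.
rewrite -[F w - F z](subrK (D * (w - z))) (le_trans (le_normcD _ _))// mulrDl normcM.
by rewrite lerD2r Hd.
Qed.

Lemma horner_growth Q : exists2 K, 0 <= K & forall w,
  (normc w <= 1 -> normc Q.[w] <= K) /\ (1 <= normc w -> normc Q.[w] <= K * normc w ^+ size Q).
Proof.
exists (\sum_(i < size Q) normc Q`_i); first by apply: sumr_ge0 => i _; exact: normc_ge0.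
move=> w; split=> w1; apply: (le_trans (normc_horner_le Q w)).
  apply: ler_sum => i _; rewrite -[leRHS]mulr1 ler_wpM2l ?normc_ge0//.
  by rewrite exprn_ile1 ?normc_ge0.
rewrite mulr_suml; apply: ler_sum => i _; rewrite ler_wpM2l ?normc_ge0//.
by rewrite ler_weXn2l// ltnW.
Qed.

Section Sphere.
Variable f : C -> option C.
Hypothesis f_mero : meromorphic f.

Lemma pole_isolated u : exists2 d : R, 0 < d & forall w, w != u -> normc (w - u) < d ->
  ~ pole f w /\ cdiff (finpart f) w.
Proof.
have [iso df _] := f_mero; have /dnbhs_normc[d d0 Hd] := iso u.
by exists d => // w wu wd; have wp := Hd w wu wd; split => //; exact: df.
Qed.

Lemma pole_blowup u (M : R) : pole f u -> exists2 d : R, 0 < d & forall w, w != u ->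
  normc (w - u) < d -> M <= normc (finpart f w).
Proof.
have [_ _ H] := f_mero => /H/(_ [set x | M%:C < x]) Hu.
have : nbhs (+oo : set_system C) [set x | M%:C < x].
  by exists M%:C; split => //; apply/complex_realP; exists M.
move=> /Hu /dnbhs_normc[d d0 Hd]; exists d => // w wu wd.
by have := Hd w wu wd; rewrite /= normcE ltcR => /ltW.
Qed.

Lemma finite_order u : exists (m : nat) (B d : R), 0 < d /\ forall w, w != u ->
  normc (w - u) < d -> normc (finpart f w) * normc (w - u) ^+ m <= B.
Proof.
have [fu|fu] := pselect (pole f u).
  have [d1 d10 H1] := pole_isolated u; have [d2 d20 H2] := pole_blowup 1 fu.
  have [||w wu|m [B [e [e0 _ He]]]] := @pole_order (finpart f) u (Num.min d1 d2).
  - by rewrite lt_min d10.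
  - by move=> w wu; rewrite lt_min => /andP[wd _]; have [] := H1 w wu wd.
  - by rewrite lt_min => /andP[_]; exact: H2.
  - by exists m, B, e.
have [_ df _] := f_mero.
have [d d0 Hd] := cdiff_cont (df u fu) ltr01.
exists 0%N, (1 + normc (finpart f u)), d; split => // w _ /Hd wd.
rewrite expr0 mulr1 -[finpart f w](subrK (finpart f u)) (le_trans (le_normcD _ _))//.
by rewrite lerD2r ltW.
Qed.

End Sphere.

End PeriodicMeromorphic.

(** * Rationality in the exponential *)

Section Final.
Context {R : realType}.
Local Notation C := R[i].
Local Notation Re := complex.Re.
Implicit Types (u w z p : C).

Section Periodic.
Variables (f : C -> option C) (omega : C).
Hypothesis f_mero : meromorphic f.
Hypothesis omega_neq0 : omega != 0.
Hypothesis f_periodic : forall z, f (z + omega) = f z.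

(** The change of variable [u = period_scale * z] turns the period [omega] into
    [2 * pi * i]. *)
Definition period_scale : C := omega / twopii.
Local Notation s := period_scale.
Definition period_exp u : C := Cexp (s^-1 * u).
Local Notation E := period_exp.

Lemma twopii_neq0 : (twopii : C) != 0.
Proof. by rewrite eq_complex/= negb_and [_ *+ 2 == _]gt_eqF ?orbT// twopi_gt0. Qed.

Lemma period_scale_neq0 : s != 0.
Proof. by rewrite mulf_neq0// invr_eq0 twopii_neq0. Qed.

Lemma period_scaleE : s * twopii = omega.
Proof. by rewrite /period_scale divfK// twopii_neq0. Qed.

Lemma period_expE z : E (s * z) = Cexp z.
Proof. by rewrite /period_exp mulKf// period_scale_neq0. Qed.

Lemma period_exp_shift u (n : int) : E (u + omega *~ n) = E u.
Proof.
rewrite /period_exp -period_scaleE mulrDr -mulrzAr mulKf ?period_scale_neq0//.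
by rewrite (periodic_int (@Cexp_periodic R)).
Qed.

Lemma period_exp_eq u w : E u = E w -> exists n : int, u = w + omega *~ n.
Proof.
move=> /Cexp_eq[n H]; exists n.
apply: (mulfI (invr_neq0 period_scale_neq0)); rewrite H mulrDr -period_scaleE -mulrzAr.
by rewrite mulKf// period_scale_neq0.
Qed.

Lemma cdiff_period_exp u : cdiff E u.
Proof.
apply: (@cdiff_comp _ (fun w => s^-1 * w)); last exact: cdiff_Cexp.
by apply: (@cdiffM _ (fun=> s^-1) (fun w => w)); [exact: cdiff_cst | exact: cdiff_id].
Qed.

Lemma finpart_shift u (n : int) : finpart f (u + omega *~ n) = finpart f u.
Proof. by rewrite /finpart (periodic_int f_periodic). Qed.

Lemma cdiff_period_poly (Q : {poly C}) u : cdiff (fun w => Q.[E w]) u.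
Proof.
apply: (@cdiff_comp _ E (fun w => Q.[w])); first exact: cdiff_period_exp.
exact: cdiff_horner.
Qed.

(** When [m p] bounds the order of the pole [p], the factor [('X - (E p)%:P) ^+ m p]
    clears all translates of this pole by multiples of [omega], since [E] has the same
    value there. One more such factor makes every pole a zero of [Q.[E u]], even where
    [m p] is 0. *)
Lemma clear_poles (sq : seq C) :
  (forall u, pole f u -> exists n : int, u + omega *~ n \in sq) ->
  (forall p, p \in sq -> pole f p) ->
  exists2 Q : {poly C}, (forall u, Q.[E u] = 0 <-> pole f u) &
  forall u, exists (d B : R), 0 < d /\ forall w, w != u -> normc (w - u) < d ->
     cdiff (fun w => finpart f w * Q.[E w]) w /\ normc (finpart f w * Q.[E w]) <= B.
Proof.
move=> sqP1 sqP2.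
have [m Hm] := choice (finite_order f_mero).
pose Q : {poly C} := \prod_(p <- sq) ('X - (E p)%:P) ^+ (m p).+1.
have dfQ w : ~ pole f w -> cdiff (fun w => finpart f w * Q.[E w]) w.
  have [_ df _] := f_mero => fw.
  apply: (@cdiffM _ (finpart f) (fun w => Q.[E w])); first exact: df.
  exact: cdiff_period_poly.
exists Q.
  move=> u; split.
    rewrite /Q horner_prod => /eqP; rewrite prodf_seq_eq0 => /hasP[p psq /=].
    rewrite horner_exp expf_eq0/= hornerXsubC subr_eq0 => /eqP/period_exp_eq[n ->].
    by rewrite /pole/= (periodic_int f_periodic); exact: sqP2.
  move=> /sqP1[n nsq]; rewrite -(period_exp_shift u n).
  apply/eqP; rewrite /Q horner_prod prodf_seq_eq0; apply/hasP; exists (u + omega *~ n) => //=.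
  by rewrite horner_exp expf_eq0/= hornerXsubC subrr.
move=> u.
have [d1 d10 H1] := pole_isolated f_mero u.
have [fu|fu] := pselect (pole f u); last first.
  have [d d0 Hd] := cdiff_cont (dfQ u fu) ltr01.
  exists (Num.min d1 d), (1 + normc (finpart f u * Q.[E u])); split.
    by rewrite lt_min d10.
  move=> w wu; rewrite lt_min => /andP[/(H1 _ wu)[fw _] /Hd wd]; split; first exact: dfQ.
  rewrite -[X in normc X](subrK (finpart f u * Q.[E u])) (le_trans (le_normcD _ _))//.
  by rewrite lerD2r ltW.
have [n nsq] := sqP1 u fu; set p := u + omega *~ n in nsq.
have [B [d2 [d20 H2]]] := Hm p.
have Ep : E p = E u by exact: period_exp_shift.
(* [Q] without [m p] of its factors that vanish at [p] *)
pose Q' : {poly C} := ('X - (E p)%:P) * \prod_(p <- rem p sq) ('X - (E p)%:P) ^+ (m p).+1.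
have QE : Q = ('X - (E p)%:P) ^+ (m p) * Q'.
  by rewrite /Q (perm_big _ (perm_to_rem nsq)) big_cons/= exprSr mulrA.
have [d3 d30 H3] := cdiff_cont (@cdiff_period_poly Q' u) ltr01.
have [d4 [K [d40 H4]]] := cdiff_lip (@cdiff_period_exp u).
exists (Num.min (Num.min d1 d2) (Num.min d3 d4)).
exists (`|B| * (`|K| ^+ m p * (1 + normc Q'.[E u]))); split.
  by rewrite !lt_min d10 d20 d30.
move=> w wu; rewrite !lt_min => /andP[/andP[/(H1 _ wu)[fw _] wd2] /andP[wd3 wd4]].
split; first exact: dfQ.
have wp : w + omega *~ n - p = w - u by rewrite /p opprD addrACA subrr addr0.
have := H2 (w + omega *~ n); rewrite wp finpart_shift => /(_ _ wd2).
rewrite -subr_eq0 wp subr_eq0 => /(_ wu) fB.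
have r0 : 0 < normc (w - u) by rewrite normc_gt0 subr_eq0.
have B0 : normc (finpart f w) <= `|B| / normc (w - u) ^+ m p.
  by rewrite ler_pdivlMr ?exprn_gt0// (le_trans fB)// ler_norm.
rewrite QE hornerM horner_exp hornerXsubC Ep 2!normcM normcX.
apply: (@le_trans _ _ (`|B| / normc (w - u) ^+ m p *
   ((`|K| * normc (w - u)) ^+ m p * (1 + normc Q'.[E u])))).
  apply: ler_pM => //; rewrite ?normc_ge0 ?mulr_ge0 ?exprn_ge0 ?normc_ge0//.
  apply: ler_pM; rewrite ?exprn_ge0 ?normc_ge0//.
    rewrite lerXn2r ?nnegrE ?normc_ge0 ?mulr_ge0//; first exact/ltW.
    by rewrite (le_trans (H4 w wd4))// ler_wpM2r ?ler_norm// ltW.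
  rewrite -[X in normc X](subrK Q'.[E u]) (le_trans (le_normcD _ _))//.
  by rewrite lerD2r ltW// H3.
by rewrite exprMn le_eqVlt; apply/orP; left; apply/eqP; field; rewrite expf_neq0// gt_eqF.
Qed.

Lemma pole_representatives (z0 : C) : finite_set (pole f `&` period_strip omega z0) ->
  exists2 sq : seq C, (forall p, p \in sq -> pole f p) &
    forall u, pole f u -> exists n : int, u + omega *~ n \in sq.
Proof.
move=> /finite_seqP[sq Hsq]; exists sq.
  move=> p psq; have : [set` sq] p by [].
  by rewrite -Hsq => -[].
move=> u fu; have [n] := @mod_period R 1 (Re ((u - z0) / omega)) ltr01.
move=> Hn; exists (- n) => //.
have : (pole f `&` period_strip omega z0) (u + omega *~ (- n)); last by rewrite Hsq.
split; first by rewrite /pole/= (periodic_int f_periodic).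
rewrite /period_strip/=; suff -> : (u + omega *~ - n - z0) / omega = (u - z0) / omega - n%:~R.
  by move: Hn; rewrite -(rmorph_int (real_complex R)); case: ((u - z0) / omega) => a b /=.
by rewrite mulrNz addrAC mulrBl -[omega *~ n]mulrzr mulrAC divff// mul1r.
Qed.

(** Translation by [omega] does not change the real part of [u / s]. *)
Lemma poles_near_axis (sq : seq C) :
  (forall u, pole f u -> exists n : int, u + omega *~ n \in sq) ->
  exists H : R, forall z, pole f (s * z) -> `|Re z| <= H.
Proof.
move=> sqP; exists (\sum_(p <- sq) normc (p / s)) => z /sqP[n nsq].
have -> : Re z = Re ((s * z + omega *~ n) / s).
  rewrite -period_scaleE -mulrzAr -mulrDr mulrAC divff ?period_scale_neq0// mul1r.
  by rewrite twopii_mulz; case: z {nsq} => a b /=; rewrite addr0.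
rewrite (le_trans (normc_Re _))// (perm_big _ (perm_to_rem nsq)) big_cons/= lerDl.
by apply: sumr_ge0 => p _; exact: normc_ge0.
Qed.

(** After division by the gcd, the denominator still vanishes at every pole:
    otherwise the quotient, and with it [f], would be bounded there. *)
Lemma rational_of_quotient (P Q : {poly C}) : (forall u, Q.[E u] = 0 <-> pole f u) ->
  (forall u, ~ pole f u -> finpart f u * Q.[E u] = P.[E u]) ->
  exists (g : C -> option C) (c : C), rational_function g /\ forall z, f z = g (Cexp (c * z)).
Proof.
move=> Qf PQ.
have Q0 : Q != 0.
  apply/eqP => Q0; have [d d0 Hd] := pole_isolated f_mero 0.
  have d2 : 0 < normc (d / 2)%:C by rewrite normc_real normr_gt0 gt_eqF// divr_gt0.
  have [||np _] := Hd (d / 2)%:C; last by apply: np; apply/Qf; rewrite Q0 horner0.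
    by rewrite -normc_gt0.
  by rewrite subr0 normc_real gtr0_norm ?divr_gt0// ltr_pdivrMr// ltr_pMr// ltr1n.
pose G := gcdp P Q; pose p := P %/ G; pose q := Q %/ G.
have Pp : P = p * G by rewrite divpK// dvdp_gcdl.
have Qq : Q = q * G by rewrite divpK// dvdp_gcdr.
have fE u : ~ pole f u -> q.[E u] != 0 /\ finpart f u = p.[E u] / q.[E u].
  move=> fu; have : Q.[E u] != 0 by apply/eqP => /Qf.
  move: (PQ u fu); rewrite Qq Pp !hornerM mulf_eq0 negb_or => H /andP[q0 g0].
  by split => //; apply: (mulIf q0); rewrite divfK//; apply: (mulIf g0); rewrite -mulrA.
exists (fun w => if q.[w] == 0 then None else Some (p.[w] / q.[w])), s^-1; split.
  exists p, q; split => //; first by apply: contraNneq Q0 => q0; rewrite Qq q0 mul0r.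
  by apply: coprimep_div_gcd; rewrite Q0 orbT.
move=> z; rewrite -/(E z).
have [fz|fz] := pselect (pole f z); last first.
  have [q0 fz'] := fE z fz; rewrite (negbTE q0) -fz'.
  by rewrite /finpart; move: fz; rewrite /pole/=; case: (f z).
have [_|q0] := eqVneq; first exact: fz.
exfalso.
have [d1 d10 H1] : exists2 d : R, 0 < d & forall w, normc (w - z) < d ->
    normc (p.[E w] / q.[E w] - p.[E z] / q.[E z]) < 1.
  apply: (@cdiff_cont _ (fun w => p.[E w] / q.[E w])) ltr01.
  apply: (@cdiffM _ (fun w => p.[E w]) (fun w => (q.[E w])^-1)).
    exact: cdiff_period_poly.
  by apply: cdiffV; [exact: q0 | exact: cdiff_period_poly].
have [d2 d20 H2] := pole_blowup f_mero (normc (p.[E z] / q.[E z]) + 1) fz.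
have [d3 d30 H3] := pole_isolated f_mero z.
pose d := Num.min (Num.min d1 d2) d3.
have d0 : 0 < d by rewrite !lt_min d10 d20.
(* a point next to the pole at which both bounds apply *)
pose w := z + (d / 2)%:C.
have wz : w - z = (d / 2)%:C by rewrite /w addrAC subrr add0r.
have wzn : normc (w - z) = d / 2 by rewrite wz normc_real gtr0_norm ?divr_gt0.
have wz0 : w != z by rewrite -subr_eq0 -normc_gt0 wzn divr_gt0.
have : normc (w - z) < d by rewrite wzn ltr_pdivrMr// ltr_pMr// ltr1n.
rewrite !lt_min => /andP[/andP[wd1 wd2] wd3].
have [/fE[_ fw] _] := H3 w wz0 wd3.
have := H2 w wz0 wd2; rewrite fw leNgt => /negP; apply.
rewrite -[X in normc X](subrK (p.[E z] / q.[E z])) (le_lt_trans (le_normcD _ _))//.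
by rewrite addrC ltrD2l H1.
Qed.

Section Equation.
Variables (k d : nat) (j : 'I_d -> nat).
Hypotheses (hk : (0 < k)%N) (hd : (1 < d)%N).
Hypothesis f_sol : forall z : C, ~ pole f z ->
  ((finpart f)^`(k))%classic z = \prod_(i < d) ((finpart f)^`(j i))%classic z.

(** To be used with [e = s] and [e = - s], for the two ends of the plane. *)
Lemma end_bounded (e : C) (H : R) : e != 0 -> (exists n : int, e * twopii = omega *~ n) ->
  (forall z, H < Re z -> ~ pole f (e * z)) ->
  exists X B : R, forall z, X <= Re z -> normc (finpart f (e * z)) <= B.
Proof.
move=> e0 [n en] np; have [_ df _] := f_mero.
apply: (@growth_bounded R k d j (finpart f) e H hk hd e0).
- by move=> z /np; exact: df.
- by move=> z; rewrite mulrDr en finpart_shift.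
- by move=> z /np; exact: f_sol.
Qed.

Lemma solution_rational (z0 : C) : finite_set (pole f `&` period_strip omega z0) ->
  exists (g : C -> option C) (c : C), rational_function g /\ forall z, f z = g (Cexp (c * z)).
Proof.
move=> /pole_representatives[sq sqP1 sqP2].
have [H HH] := poles_near_axis sqP2.
have [Q Qf /removable[ht [dht hth]]] := clear_poles sqP2 sqP1.
have [_ df _] := f_mero.
have htE u : ~ pole f u -> ht u = finpart f u * Q.[E u].
  move=> fu; apply: hth; apply: (@cdiffM _ (finpart f) (fun w => Q.[E w])); first exact: df.
  exact: cdiff_period_poly.
have [X1 [B1 bd1]] : exists X B : R, forall z, X <= Re z -> normc (finpart f (s * z)) <= B.
  apply: (@end_bounded s H); [exact: period_scale_neq0 | |].
    by exists 1; rewrite period_scaleE mulr1z.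
  by move=> z Hz /HH; rewrite leNgt (lt_le_trans Hz)// ler_norm.
have [X2 [B2 bd2]] : exists X B : R, forall z, X <= Re z -> normc (finpart f (- s * z)) <= B.
  apply: (@end_bounded (- s) H); [by rewrite oppr_eq0 period_scale_neq0 | |].
    by exists (-1); rewrite mulNr period_scaleE mulrN1z.
  move=> z Hz; rewrite mulNr -mulrN => /HH; rewrite raddfN/= normrN leNgt.
  by rewrite (lt_le_trans Hz)// ler_norm.
have [K K0 HK] := horner_growth Q.
pose B := Num.max (`|B1| * K) (`|B2| * K).
have np z : H < `|Re z| -> ~ pole f (s * z) by move=> Hz /HH; rewrite leNgt Hz.
have [||||P HP] := @entire_periodic_poly _ (fun z => ht (s * z))
    (Num.min (- X2) (Num.min (- (H + 1)) 0)) (Num.max X1 (Num.max (H + 1) 0)) B (size Q).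
- move=> z; rewrite mulrDr period_scaleE.
  have [d1 d10 H1] := pole_isolated f_mero (s * z).
  apply: (@ccont_eq _ (fun w => ht (w + omega)) ht (s * z) d1) => //.
  + apply/cdiff_cont; apply: (@cdiff_comp _ (fun w => w + omega)); last exact: dht.
    by apply: cdiffD; [exact: cdiff_id | exact: cdiff_cst].
  + exact/cdiff_cont/dht.
  + move=> w wz /(H1 w wz)[fw _]; rewrite !htE//.
      by have := finpart_shift w 1; have := period_exp_shift w 1; rewrite mulr1z => -> ->.
    by rewrite /pole/= f_periodic.
- move=> z; apply: (@cdiff_comp _ (fun w => s * w)); last exact: dht.
  by apply: (@cdiffM _ (fun=> s) (fun w => w)); [exact: cdiff_cst | exact: cdiff_id].
- move=> z; rewrite !le_min => /and3P[zX zH z1].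
  rewrite htE; last by apply: np; rewrite ler0_norm//; lra.
  rewrite period_expE normcM /B le_max; apply/orP; right.
  apply: ler_pM; rewrite ?normc_ge0//.
    rewrite (le_trans _ (ler_norm _))// -[z]opprK mulrN -mulNr bd2// raddfN/=; lra.
  by apply: (HK _).1; rewrite normc_Cexp expR_le1.
- move=> z; rewrite !ge_max => /and3P[zX zH z1].
  rewrite htE; last by apply: np; rewrite ger0_norm//; lra.
  rewrite period_expE normcM; apply: (@le_trans _ _ (`|B1| * (K * expR (Re z) ^+ size Q))).
    apply: ler_pM; rewrite ?normc_ge0//; first by rewrite (le_trans (bd1 _ zX))// ler_norm.
    by rewrite -normc_Cexp; apply: (HK _).2; rewrite normc_Cexp -expR0 ler_expR.
  by rewrite mulrA ler_wpM2r ?exprn_ge0 ?expR_ge0// /B le_max lexx.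
apply: (@rational_of_quotient P Q Qf) => u fu.
have us : u = s * (u / s) by rewrite mulrCA divff ?mulr1 ?period_scale_neq0.
by rewrite -htE// us HP period_expE.
Qed.

End Equation.
End Periodic.
End Final.

Theorem theoremB (R : realType) (k d : nat) (j : 'I_d -> nat)
  (hk : (1 <= k)%N) (hd : (1 < d)%N) (hj : forall i, (j i < k)%N)
  (f : R[i] -> option R[i])
  (f_mero : meromorphic f)
  (f_sol : forall z : R[i], ~ pole f z ->
     ((finpart f)^`(k))%classic z = \prod_(i < d) ((finpart f)^`(j i))%classic z)
  (omega : R[i]) (omega_neq0 : omega != 0)
  (f_periodic : forall z, f (z + omega) = f z)
  (z0 : R[i])
  (f_poles : finite_set (pole f `&` period_strip omega z0)) :
  exists (g : R[i] -> option R[i]) (c : R[i]),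
    rational_function g /\ forall z, f z = g (Cexp (c * z)).
Proof. exact: (solution_rational f_mero omega_neq0 f_periodic hk hd f_sol f_poles). Qed.
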